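(* With the parameter choice and the synchronous sampling described in the context, if $$p_{\rm comm}=\left(1+\sqrt{\frac{2\gamma}{\kappa_{\rm comm}}}\,(m+\sqrt{m\kappa_s})\right)^{-1},$$ then, for $\rho^2=\min\left(\frac{\gamma}{\kappa_{\rm comm}}p_{\rm comm}^2,\frac{p_{\rm comp}^2}{2(m+\sqrt{m\kappa_s})^2}\right)$, running the ADFS algorithm with parameter $\rho$ for $K=\rho^{-1}\log(\varepsilon^{-1})$ iterations guarantees $\mathbb{E}\left[\|\theta_K-\theta^\star\|^2\right]\le C_0\varepsilon$, and takes time $T(K)$ such that $$\mathbb{E}[T(K)]\le\left(\sqrt2\,(m+\sqrt{m\kappa_s})+\tau\sqrt{\frac{\kappa_{\rm comm}}{\gamma}}\right)\log\left(\frac1\varepsilon\right).$$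
   Context: Problem. A connected communication graph has $n$ nodes and $E$ edges. Node $i$ holds $f_i(\theta)=\sum_{j=1}^mf_{i,j}(\theta)+\frac{\sigma_i}{2}\|\theta\|^2$, $\theta\in\mathbb{R}^d$, $\sigma_i>0$, with $f_{i,j}$ convex and $L_{i,j}$-smooth ($L_{i,j}>0$) with respect to an orthogonal projector $P_{ij}\in\mathbb{R}^{d\times d}$, i.e. $f_{i,j}(x)-f_{i,j}(y)\le\nabla f_{i,j}(y)^\top P_{ij}(x-y)+\frac{L_{i,j}}2(x-y)^\top P_{ij}(x-y)$ for all $x,y$. $\theta^\star$ minimizes $\sum_if_i$. $\|x\|_Q^2=x^\top Qx$; $\lambda^+_{\min}$ is the smallest non-zero eigenvalue; $^\dagger$ is the pseudo-inverse; $f^*$ is the Fenchel conjugate; $\mathrm{prox}_{\eta f}(x)=\arg\min_v\frac1{2\eta}\|v-x\|^2+f(v)$. Augmented graph. It has the $n$ communication nodes $i$ and $nm$ virtual nodes $(i,j)$, $1\le j\le m$; its edges are the $E$ communication edges and the $nm$ virtual edges joining $i$ to $(i,j)$ (denoted $(i,j)$). $e^{(k)}\in\mathbb{R}^{n(1+m)}$, $e_{k\ell}\in\mathbb{R}^{E+nm}$ are the unit vectors of node $k$ and edge $(k,\ell)$; $x^{(k)}\in\mathbb{R}^d$ is the block of a node vector $x\in\mathbb{R}^{n(1+m)d}$, $\lambda_{k\ell}\in\mathbb{R}^d$ the block of an edge vector $\lambda\in\mathbb{R}^{(E+nm)d}$. For weights $\mu_{k\ell}>0$, $A\in\mathbb{R}^{n(1+m)d\times(E+nm)d}$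 is defined by $A(e_{k\ell}\otimes x)=\mu_{k\ell}(e^{(k)}-e^{(\ell)})\otimes P_{k\ell}x$, with $P_{k\ell}=I_d$ for communication edges and $k=i$, $\ell=(i,j)$, $P_{k\ell}=P_{ij}$, $\mu_{k\ell}=\mu_{ij}$ for virtual edges. $A_{\rm comm}\in\mathbb{R}^{n\times E}$ has column $\mu_{k\ell}(e^{(k)}-e^{(\ell)})$ (with $e^{(k)}\in\mathbb{R}^n$) for communication edge $(k,\ell)$. $\Sigma$ is block-diagonal with blocks $\sigma_iI_d$ at communication nodes and $L_{i,j}P_{ij}$ at virtual nodes; $\Sigma_{\rm comm}=\mathrm{diag}(\sigma_1,\dots,\sigma_n)$. $\sigma_A=\lambda_{\min}^+(A^\top\Sigma^\dagger A)$. $\tilde D_M$ is the $n\times n$ diagonal matrix with $(\tilde D_M)_{ii}=\sigma_i+2\lambda_{\max}\big(\sum_{j=1}^mL_{i,j}P_{ij}\big)$. Constants. $\gamma=\lambda_{\min}^+(L_{\rm comm})/\lambda_{\max}(L_{\rm comm})$ with $L_{\rm comm}=A_{\rm comm}A_{\rm comm}^\top$; $\kappa_s=\max_i\big(1+\sigma_i^{-1}\sum_{j=1}^mL_{i,j}\big)$; $$\kappa_{\rm comm}=\frac{\lambda_{\max}(A_{\rm comm}^\top\Sigma_{\rm comm}^{-1}A_{\rm comm})\,/\,\lambda_{\max}(A_{\rm comm}^\top A_{\rm comm})}{\lambda_{\min}^+(A_{\rm comm}^\top\tilde D_M^{-1}A_{\rm comm})\,/\,\lambda_{\min}^+(A_{\rm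 comm}^\top A_{\rm comm})}.$$ Parameter choice. The communication weights $\mu_{k\ell}$ are arbitrary; the virtual weights are $\mu_{ij}^2=\alpha L_{i,j}$ with $\alpha=2\lambda_{\min}^+(A_{\rm comm}^\top\tilde D_M^{-1}A_{\rm comm})$; the probabilities of virtual edges are $p_{ij}=p_{\rm comp}(1+L_{i,j}\sigma_i^{-1})^{1/2}/S_i$ with $S_i=\sum_{j=1}^m(1+L_{i,j}\sigma_i^{-1})^{1/2}$. Synchronous sampling. At each iteration, independently of the past: with probability $p_{\rm comm}$, the block $b$ is the set of all communication edges; with probability $p_{\rm comp}=1-p_{\rm comm}$, $b=\{(i,j(i)):1\le i\le n\}$ where each node $i$ picks exactly one virtual edge, in such a way that virtual edge $(i,j)$ belongs to the sampled block with overall probability $p_{ij}$. $P_b$ is the diagonal matrix with entry equal to the probability ($p_{\rm comm}$ or $p_{ij}$) of the edge if it is in $b$ and $0$ otherwise (acting as $P_b\otimes I_d$). ADFS with parameter $\rho$: $W_b=AP_b^\dagger A^\top$, $\tilde W_b=AP_b^\dagger A^\dagger$, $\eta=\rho/\sigma_A$, $\tilde f^*_{ij}(x)=f^*_{i,j}(x)-\frac1{2L_{i,j}}\|x\|_{P_{ij}}^2$, $x_0=y_0=v_0=z_0=0$; for $t\ge0$: $y_t=\frac1{1+\rho}(x_t+\rho v_t)$; sample $b$; $v_{t+1}=z_{t+1}=(1-\rho)v_t+\rho y_t-\eta W_b\Sigma^\dagger y_t$; if $b$ consists of virtual edges, for every $(i,j)\in b$ set $v_{t+1}^{(i,j)}=\mathrm{prox}_{\eta\mu_{ij}^2p_{ij}^{-1}\tilde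 f^*_{ij}}(z_{t+1}^{(i,j)})$ and for every $i$ set $v_{t+1}^{(i)}=z_{t+1}^{(i)}+\sum_{j:(i,j)\in b}(z_{t+1}^{(i,j)}-v_{t+1}^{(i,j)})$; $x_{t+1}=y_t+\rho\tilde W_b(v_{t+1}-(1-\rho)v_t-\rho y_t)$. The output after $K$ iterations is $\theta_K=\Sigma^\dagger v_K$, and $\|\theta_K-\theta^\star\|^2=\sum_{i=1}^n\|\theta_K^{(i)}-\theta^\star\|^2$ (communication nodes). Here $C_0=\lambda_{\max}(A^\top(\Sigma^\dagger)^2A)\big[\|A^\dagger A\theta_A^\star\|^2+2\sigma_A^{-1}(F_A^*(0)-F_A^*(\theta_A^\star))\big]$, with $\theta_A^\star$ a minimizer of $F_A^*(\lambda)=\frac12\lambda^\top A^\top\Sigma^\dagger A\lambda+\sum_{i,j}\tilde f^*_{ij}(-\mu_{ij}\lambda_{ij})$. Time model. An iteration whose block consists of virtual edges (a computation step) takes time $1$; an iteration whose block is the set of communication edges takes time $\tau$; $T(K)$ is the total time of $K$ iterations. $K$ is treated as an integer (rounding is ignored). *)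

(* Defs.v *)
From HB Require Import structures.
From mathcomp Require Import all_boot all_order all_algebra.
From mathcomp Require Import all_classical all_reals all_analysis.

Set Implicit Arguments.
Unset Strict Implicit.
Unset Printing Implicit Defensive.

Import Order.TTheory GRing.Theory Num.Theory.
Import numFieldNormedType.Exports.

Local Open Scope classical_set_scope.
Local Open Scope ring_scope.

Section LinearAlgebra.
Context {R : realType}.

Definition qnorm d (Q : 'M[R]_d) (x : 'cV[R]_d) : R := (x^T *m Q *m x) 0 0.

Definition normsq d (x : 'cV[R]_d) : R := (x^T *m x) 0 0.

(* The matrices these two are applied to are symmetric positive semi-definite
   and the sets below finite and nonempty, so sup and inf are attained and the
   real eigenvalues are all the eigenvalues. *)
Definition lambda_max d (M : 'M[R]_d) : R := sup [set a | eigenvalue M a].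

Definition lambda_minp d (M : 'M[R]_d) : R :=
  inf [set a | eigenvalue M a /\ a != 0].

Definition penrose p q (A : 'M[R]_(p, q)) (X : 'M[R]_(q, p)) : Prop :=
  [/\ A *m X *m A = A, X *m A *m X = X,
      (A *m X)^T = A *m X & (X *m A)^T = X *m A].

Definition pseudo_inv p q (A : 'M[R]_(p, q)) : 'M[R]_(q, p) :=
  xget 0 [set X | penrose A X].

Definition orth_projector d (P : 'M[R]_d) : Prop := P *m P = P /\ P^T = P.

(* R^(|I| d) is represented by column vectors indexed by the enumeration of
   I * 'I_d: coordinate a of block k has index enum_rank (k, a). *)
Definition bvec (I : finType) (d : nat) := 'cV[R]_#|{: I * 'I_d}|.

Definition blk (I : finType) d (x : bvec I d) (k : I) : 'cV[R]_d :=
  \col_a x (enum_rank (k, a)) 0.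

Definition of_blks (I : finType) d (F : I -> 'cV[R]_d) : bvec I d :=
  \col_r F (enum_val r).1 (enum_val r).2 0.

Definition blk_mx (I J : finType) d (F : I -> J -> 'M[R]_d) :
    'M[R]_(#|{: I * 'I_d}|, #|{: J * 'I_d}|) :=
  \matrix_(r, c) F (enum_val r).1 (enum_val c).1 (enum_val r).2 (enum_val c).2.

End LinearAlgebra.

Section ConvexAnalysis.
Context {R : realType} {d : nat}.

Definition grad (f : 'cV[R]_d -> R) (y : 'cV[R]_d) : 'cV[R]_d :=
  \col_a 'D_(delta_mx a 0) f y.

Definition smooth_wrt (L : R) (P : 'M[R]_d) (f : 'cV[R]_d -> R) : Prop :=
  (forall y, differentiable f y) /\
  (forall x y, f x - f y <=
     ((grad f y)^T *m P *m (x - y)) 0 0 + L / 2 * qnorm P (x - y)).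

Definition fenchel (f : 'cV[R]_d -> R) (y : 'cV[R]_d) : \bar R :=
  ereal_sup [set ((y^T *m x) 0 0 - f x)%:E | x in [set: 'cV[R]_d]].

Definition prox (eta : R) (g : 'cV[R]_d -> \bar R) (x : 'cV[R]_d) : 'cV[R]_d :=
  xget 0 [set v | forall w,
    (((2 * eta)^-1 * normsq (v - x))%:E + g v
      <= ((2 * eta)^-1 * normsq (w - x))%:E + g w)%E].

End ConvexAnalysis.

Definition node (n m : nat) : finType := ('I_n + 'I_n * 'I_m)%type.

Definition edge (E n m : nat) : finType := ('I_E + 'I_n * 'I_m)%type.

(* None is the set of all communication edges; Some phi is the set of the
   virtual edges (i, phi i), one for each node i. *)
Definition block (n m : nat) : finType := option {ffun 'I_n -> 'I_m}.

(* esrc e and edst e are the nodes k and l of the communication edge e = (k,l). *)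
Record instance (R : realType) (n m E d : nat) := Instance {
  esrc : 'I_E -> 'I_n ;
  edst : 'I_E -> 'I_n ;
  mu_comm : 'I_E -> R ;
  mu_virt : 'I_n -> 'I_m -> R ;
  sigma : 'I_n -> R ;
  Lsm : 'I_n -> 'I_m -> R ;
  vproj : 'I_n -> 'I_m -> 'M[R]_d ;
  fun_of : 'I_n -> 'I_m -> 'cV[R]_d -> R
}.

Section ADFS.
Context {R : realType} {n m E d : nat} (D : instance R n m E d).

Definition simple_graph : Prop :=
  (forall e, esrc D e != edst D e) /\
  (forall e e',
     (esrc D e = esrc D e' /\ edst D e = edst D e') \/
     (esrc D e = edst D e' /\ edst D e = esrc D e') -> e = e').

Definition adj : rel 'I_n := fun k l =>
  [exists e, ((esrc D e == k) && (edst D e == l)) ||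
             ((esrc D e == l) && (edst D e == k))].

Definition connected_graph : Prop := forall k l, connect adj k l.

Definition local_obj (i : 'I_n) (theta : 'cV[R]_d) : R :=
  \sum_(j < m) fun_of D i j theta + sigma D i / 2 * normsq theta.

Definition objective (theta : 'cV[R]_d) : R := \sum_(i < n) local_obj i theta.

Definition etail (e : edge E n m) : node n m :=
  match e with inl c => inl (esrc D c) | inr ij => inl ij.1 end.

Definition ehead (e : edge E n m) : node n m :=
  match e with inl c => inl (edst D c) | inr ij => inr ij end.

Definition mu (e : edge E n m) : R :=
  match e with inl c => mu_comm D c | inr ij => mu_virt D ij.1 ij.2 end.

Definition eproj (e : edge E n m) : 'M[R]_d :=
  match e with inl _ => 1%:M | inr ij => vproj D ij.1 ij.2 end.

Definition Amx :=
  blk_mx (fun (k : node n m) (e : edge E n m) =>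
    (mu e * ((k == etail e)%:R - (k == ehead e)%:R)) *: eproj e).

Definition Acomm : 'M[R]_(n, E) :=
  \matrix_(k, e) (mu_comm D e * ((k == esrc D e)%:R - (k == edst D e)%:R)).

Definition sigma_blk (k : node n m) : 'M[R]_d :=
  match k with
  | inl i => (sigma D i)%:M
  | inr ij => Lsm D ij.1 ij.2 *: vproj D ij.1 ij.2
  end.

Definition Sigma :=
  blk_mx (fun k l : node n m => if k == l then sigma_blk k else 0).

Definition Sigma_comm : 'M[R]_n := diag_mx (\row_i sigma D i).

Definition DM_tilde : 'M[R]_n :=
  diag_mx (\row_i (sigma D i +
    2 * lambda_max (\sum_(j < m) Lsm D i j *: vproj D i j))).

Definition sigma_A : R := lambda_minp (Amx^T *m pseudo_inv Sigma *m Amx).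

Definition gamma : R :=
  lambda_minp (Acomm *m Acomm^T) / lambda_max (Acomm *m Acomm^T).

(* All terms are at least 1, so the default value 0 plays no role. *)
Definition kappa_s : R :=
  \big[Num.max/0]_(i < n) (1 + (sigma D i)^-1 * \sum_(j < m) Lsm D i j).

Definition kappa_comm : R :=
  (lambda_max (Acomm^T *m invmx Sigma_comm *m Acomm)
     / lambda_max (Acomm^T *m Acomm)) /
  (lambda_minp (Acomm^T *m invmx DM_tilde *m Acomm)
     / lambda_minp (Acomm^T *m Acomm)).

Definition alpha : R :=
  2 * lambda_minp (Acomm^T *m invmx DM_tilde *m Acomm).

Definition S_ (i : 'I_n) : R :=
  \sum_(j < m) Num.sqrt (1 + Lsm D i j * (sigma D i)^-1).

Definition p_virt (pcomm : R) (i : 'I_n) (j : 'I_m) : R :=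
  (1 - pcomm) * Num.sqrt (1 + Lsm D i j * (sigma D i)^-1) / S_ i.

Definition p_edge (pcomm : R) (e : edge E n m) : R :=
  match e with inl _ => pcomm | inr ij => p_virt pcomm ij.1 ij.2 end.

Definition in_block (b : block n m) (e : edge E n m) : bool :=
  match b, e with
  | None, inl _ => true
  | Some phi, inr ij => phi ij.1 == ij.2
  | _, _ => false
  end.

Definition P_ (pcomm : R) (b : block n m) :=
  blk_mx (fun e e' : edge E n m =>
    (if (e == e') && in_block b e then p_edge pcomm e else 0)%:M : 'M[R]_d).

Definition W_ (pcomm : R) (b : block n m) :=
  Amx *m pseudo_inv (P_ pcomm b) *m Amx^T.

Definition Wtilde (pcomm : R) (b : block n m) :=
  Amx *m pseudo_inv (P_ pcomm b) *m pseudo_inv Amx.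

Definition fstar_tilde (i : 'I_n) (j : 'I_m) (x : 'cV[R]_d) : \bar R :=
  (fenchel (fun_of D i j) x
     - ((2 * Lsm D i j)^-1 * qnorm (vproj D i j) x)%:E)%E.

(* The state before iteration t is the pair (x_t, v_t). *)
Definition state := (@bvec R (node n m) d * @bvec R (node n m) d)%type.

Definition adfs_step (pcomm rho : R) (b : block n m) (s : state) : state :=
  let: (x, v) := s in
  let eta := rho / sigma_A in
  let y := (1 + rho)^-1 *: (x + rho *: v) in
  let w := (1 - rho) *: v + rho *: y in
  let z := w - eta *: (W_ pcomm b *m pseudo_inv Sigma *m y) in
  let zb := @blk R (node n m) d z in
  let vprox i j := prox (eta * mu_virt D i j ^+ 2 * (p_virt pcomm i j)^-1)
                        (fstar_tilde i j) (zb (inr (i, j))) in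
  let v' :=
    match b with
    | None => z
    | Some phi => of_blks (fun k : node n m =>
        match k with
        | inl i => zb (inl i) +
            \sum_(j < m | phi i == j) (zb (inr (i, j)) - vprox i j)
        | inr (i, j) => if phi i == j then vprox i j else zb (inr (i, j))
        end)
    end in
  (y + rho *: (Wtilde pcomm b *m (v' - w)), v').

Fixpoint adfs (pcomm rho : R) (b : nat -> block n m) (t : nat) : state :=
  if t is t'.+1 then adfs_step pcomm rho (b t') (adfs pcomm rho b t')
  else (0, 0).

Definition adfs_output pcomm rho b (K : nat) : bvec (node n m) d :=
  pseudo_inv Sigma *m (adfs pcomm rho b K).2.

Definition sq_error (thetaK : @bvec R (node n m) d) (theta : 'cV[R]_d) : R :=
  \sum_(i < n) normsq (blk thetaK (inl i) - theta).

(* +oo is a possible value: the conjugates are extended-real valued. *)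
Definition FAstar (l : @bvec R (edge E n m) d) : \bar R :=
  ((1 / 2 * qnorm (Amx^T *m pseudo_inv Sigma *m Amx) l)%:E +
   \sum_(i < n) \sum_(j < m)
      fstar_tilde i j (- mu_virt D i j *: blk l (inr (i, j)))%R)%E.

Definition C0 (thetaA : @bvec R (edge E n m) d) : \bar R :=
  ((lambda_max (Amx^T *m (pseudo_inv Sigma *m pseudo_inv Sigma) *m Amx))%:E *
   ((normsq (pseudo_inv Amx *m Amx *m thetaA))%:E +
    (2 * sigma_A^-1)%:E * (FAstar 0%R - FAstar thetaA)))%E.

Definition iter_time (tau : R) (b : block n m) : R :=
  if b is Some _ then 1 else tau.

Definition total_time (tau : R) (b : nat -> block n m) (K : nat) : R :=
  \sum_(t < K) iter_time tau (b t).

Definition sync_sampling {disp : measure_display} {T : measurableType disp}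
    (Pr : probability T R) (pcomm : R) (B : nat -> T -> block n m) : Prop :=
  [/\ forall t b, measurable [set w | B t w = b],
      forall t, Pr [set w | B t w = None] = pcomm%:E,
      forall t i j,
        Pr [set w | in_block (B t w) (inr (i, j))] = (p_virt pcomm i j)%:E &
      forall (K : nat) (b : nat -> block n m),
        Pr [set w | forall t, (t < K)%N -> B t w = b t] =
        (\prod_(t < K) Pr [set w | B t w = b t])%E].

End ADFS.

(* Main.v *)
(** ADFS is accelerated proximal coordinate descent on the dual objective
    [F_A^*], seen through [A]: the iterates are [v = A lv] and [x = A lx] for
    edge vectors [lv] and [lx], because the block-sparse scalings preserve the
    kernel of [A] and each proximal step stays in the range of [P i j].
    The functions [f^* - |.|_P^2 / 2L] are suprema of affine functions, so their
    proximal points exist and satisfy a variational inequality.  This makes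
    [sigma_A / 2 * |lv - theta|^2 + F_A^*(lx) - F_A^*(theta)] contract by
    [1 - rho] in expectation, once [F_A^*(lx)] is replaced by the upper bound
    that follows from writing [lx] blockwise as a convex combination.
    The rate requires [rho <= p_e] and a bound on the quadratic form along each
    sampled block; both follow from [sigma_A >= lambda_min^+(A_comm^T D_M^-1
    A_comm)], which is where the choice of the virtual weights enters.
    Finally, [F_A^*] grows quadratically in the primal residual away from an
    explicit dual point built from the gradients at [theta_star], so that
    [Sigma^+ A theta_A] is [theta_star] at every communication node. *)
Require Import Defs.
From HB Require Import structures.
From mathcomp Require Import all_boot all_order all_algebra.
From mathcomp Require Import complex.
From mathcomp Require Import all_classical all_reals all_analysis.
From mathcomp Require Import ring lra.

Set Implicit Arguments.
Unset Strict Implicit.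
Unset Printing Implicit Defensive.

Import Order.TTheory GRing.Theory Num.Theory.
Import numFieldNormedType.Exports.

Local Open Scope classical_set_scope.
Local Open Scope ring_scope.

(** * Quadratic forms and eigenvalues *)

(** Strong convexity of the dual with constant [sigma_A] holds only orthogonally to the kernel of
    [A], and [A] need not be injective. Every edge vector of the analysis therefore has to stay
    orthogonal to that kernel in spite of the sparse updates, and [theta_A] is replaced by its
    projection [proj_theta], whence the norm of [A^+ A theta_A] in [C0]. The value of [pcomm] is the
    one that makes both arguments of the minimum in [rhoE] equal. So
    [rho = pcomm * sqrt (gamma / kappa_comm)] and [1 - pcomm = rho * sqrt 2 * (m + sqrt (m *
    kappa_s))] hold together, and the mean cost of an iteration divided by [rho] is computed
    exactly. The factors 2 in [alpha] and [DM_tilde] cut the virtual quadratic term in two halves: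
    one absorbs its coupling with the communication part, the other remains as strong convexity. *)

Section Spectral.
Context {R : realType}.

Definition dot d (x y : 'cV[R]_d) : R := (x^T *m y) 0 0.

Lemma dotE d (x y : 'cV[R]_d) : dot x y = \sum_i x i 0 * y i 0.
Proof. by rewrite /dot mxE; apply: eq_bigr => i _; rewrite mxE. Qed.

Lemma dotC d (x y : 'cV[R]_d) : dot x y = dot y x.
Proof. by rewrite !dotE; apply: eq_bigr => i _; rewrite mulrC. Qed.

Lemma dotDl d (x y z : 'cV[R]_d) : dot (x + y) z = dot x z + dot y z.
Proof. by rewrite /dot raddfD mulmxDl mxE. Qed.

Lemma dotDr d (x y z : 'cV[R]_d) : dot z (x + y) = dot z x + dot z y.
Proof. by rewrite dotC dotDl !(dotC z). Qed.

Lemma dotZl d a (x y : 'cV[R]_d) : dot (a *: x) y = a * dot x y.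
Proof. by rewrite /dot linearZ -scalemxAl mxE. Qed.

Lemma dotZr d a (x y : 'cV[R]_d) : dot x (a *: y) = a * dot x y.
Proof. by rewrite dotC dotZl dotC. Qed.

Lemma dotNl d (x y : 'cV[R]_d) : dot (- x) y = - dot x y.
Proof. by rewrite -scaleN1r dotZl mulN1r. Qed.

Lemma dotNr d (x y : 'cV[R]_d) : dot x (- y) = - dot x y.
Proof. by rewrite dotC dotNl dotC. Qed.

Lemma dotBl d (x y z : 'cV[R]_d) : dot (x - y) z = dot x z - dot y z.
Proof. by rewrite dotDl dotNl. Qed.

Lemma dotBr d (x y z : 'cV[R]_d) : dot z (x - y) = dot z x - dot z y.
Proof. by rewrite dotDr dotNr. Qed.

Lemma dot0l d (x : 'cV[R]_d) : dot 0 x = 0.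
Proof. by rewrite -(scale0r (0 : 'cV_d)) dotZl mul0r. Qed.

Lemma dot0r d (x : 'cV[R]_d) : dot x 0 = 0.
Proof. by rewrite dotC dot0l. Qed.

Lemma dot_suml d (I : Type) (r : seq I) (P : pred I) (F : I -> 'cV[R]_d) y :
  dot (\sum_(i <- r | P i) F i) y = \sum_(i <- r | P i) dot (F i) y.
Proof.
by elim/big_rec2: _ => [|i a b _ <-]; rewrite ?dot0l ?dotDl.
Qed.

Lemma dot_sumr d (I : Type) (r : seq I) (P : pred I) (F : I -> 'cV[R]_d) y :
  dot y (\sum_(i <- r | P i) F i) = \sum_(i <- r | P i) dot y (F i).
Proof. by rewrite dotC dot_suml; apply: eq_bigr => i _; rewrite dotC. Qed.

Lemma dot_mulmxr p q (M : 'M[R]_(p, q)) x y : dot x (M *m y) = dot (M^T *m x) y.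
Proof. by rewrite /dot trmx_mul trmxK mulmxA. Qed.

Lemma dot_ge0 d (x : 'cV[R]_d) : 0 <= dot x x.
Proof. by rewrite dotE; apply: sumr_ge0 => i _; rewrite -expr2 sqr_ge0. Qed.

Lemma dot_eq0 d (x : 'cV[R]_d) : (dot x x == 0) = (x == 0).
Proof.
apply/idP/eqP => [|->]; last by rewrite dot0l.
rewrite dotE psumr_eq0 => [/allP h|i _]; last by rewrite -expr2 sqr_ge0.
apply/matrixP => i j; rewrite ord1 mxE.
by have := h i (mem_index_enum _); rewrite mulf_eq0 orbb => /eqP.
Qed.

Lemma dot_gt0 d (x : 'cV[R]_d) : (0 < dot x x) = (x != 0).
Proof. by rewrite lt_def dot_ge0 andbT dot_eq0. Qed.

Lemma normsq_dot d (x : 'cV[R]_d) : normsq x = dot x x.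
Proof. by []. Qed.

Lemma qnorm_dot d (Q : 'M[R]_d) x : qnorm Q x = dot x (Q *m x).
Proof. by rewrite /qnorm /dot mulmxA. Qed.

(* The [w i x] are the squared coordinates of [x] in an orthonormal eigenbasis
   over [C], which avoids constructing a real one.  Keeping [C] abstract keeps
   the kernel from unfolding complex arithmetic. *)
Lemma symmetric_spectral_closed (C : numClosedFieldType) (inj : {rmorphism R -> C})
    (re : C -> R) n (M : 'M[R]_n) :
  (forall r, inj r \is Num.real) ->
  (forall c, c \is Num.real -> inj (re c) = c) ->
  (forall r, (0 <= inj r) = (0 <= r)) ->
  M^T = M ->
  exists (a : 'I_n -> R) (w : 'I_n -> 'cV[R]_n -> R),
  [/\ forall i, eigenvalue M (a i),
      forall i x, 0 <= w i x,
      forall x, dot x x = \sum_i w i x,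
      forall x, dot x (M *m x) = \sum_i a i * w i x &
      forall i x, w i (M *m x) = a i ^+ 2 * w i x].
Proof.
move=> injR reK inj_ge0 Msym.
have injI : injective inj by exact: fmorph_inj.
pose MC : 'M[C]_n := map_mx inj M.
have injconj (r : R) : Num.conj (inj r) = inj r by apply: conj_Creal.
have Mherm : MC \is hermsymmx.
  apply: realsym_hermsym; last by apply/mxOverP => i j; rewrite mxE.
  apply/is_hermitianmxP; rewrite expr0 scale1r map_mx_id //.
  by rewrite map_trmx Msym.
have /orthomx_spectralP ME := hermitian_normalmx Mherm.
have /mxOverP Dreal := hermitian_spectral_diag_real Mherm.
set sp := spectralmx MC in ME *; set D := spectral_diag MC in ME Dreal *.
have spU : sp \is unitarymx by exact: spectral_unitarymx.
have spu : sp \in unitmx by exact: unitarymx_unit.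
pose a i := re (D 0 i).
have aE i : inj (a i) = D 0 i by exact: reK.
pose y (x : 'cV[R]_n) : 'cV[C]_n := sp *m map_mx inj x.
pose w i x : R := re (`|y x i 0| ^+ 2).
have wE i x : inj (w i x) = `|y x i 0| ^+ 2.
  by apply: reK; rewrite realX // normr_real.
have spM : sp *m MC = diag_mx D *m sp.
  by rewrite ME !mulmxA mulmxV // mul1mx.
have dotC_ (x z : 'cV[R]_n) : ((map_mx inj x)^T *m map_mx inj z) 0 0 = inj (dot x z).
  rewrite dotE rmorph_sum mxE; apply: eq_bigr => i _.
  by rewrite !mxE rmorphM.
have ynorm x (e : 'rV[C]_n) : ((map_mx inj x)^T *m (invmx sp *m diag_mx e *m sp)
     *m map_mx inj x) 0 0 = \sum_i e 0 i * `|y x i 0| ^+ 2.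
  have -> : (map_mx inj x)^T *m (invmx sp *m diag_mx e *m sp) *m map_mx inj x =
    map_mx Num.conj (y x)^T *m (diag_mx e *m y x).
    have xc : map_mx Num.conj (map_mx inj x)^T = (map_mx inj x)^T.
      by apply/matrixP => i j; rewrite !mxE injconj.
    by rewrite invmx_unitary // /y trmx_mul map_mxM xc !mulmxA.
  rewrite mxE; apply: eq_bigr => i _.
  by rewrite mul_diag_mx !mxE normCK mulrCA [X in _ * X]mulrC.
exists a, w; split.
(* Being an eigenvalue is a root condition on the characteristic polynomial, which the injective
   morphism [inj] reflects; the rows of [sp] are eigenvectors over [C]. *)
- move=> i; rewrite eigenvalue_root_char -(fmorph_root inj) map_char_poly aE.
  rewrite -eigenvalue_root_char; apply/eigenvalueP; exists (row i sp).
    by rewrite -row_mul spM row_mul row_diag_mx -scalemxAl -rowE.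
  apply/eqP => r0; have /row_unitarymxP/(_ i i) := spU.
  by rewrite r0 linear0l eqxx => /eqP; rewrite eq_sym oner_eq0.
- by move=> i x; rewrite -inj_ge0 wE exprn_ge0.
- move=> x; apply: injI; rewrite -dotC_ rmorph_sum.
  rewrite -[X in X *m _]mulmx1 -(mulVmx spu) -[invmx sp]mulmx1 -diag_const_mx.
  by rewrite ynorm; apply: eq_bigr => i _; rewrite mxE mul1r wE.
- move=> x; apply: injI; rewrite -dotC_ rmorph_sum.
  rewrite map_mxM -/MC [in LHS]ME mulmxA ynorm; apply: eq_bigr => i _.
  by rewrite rmorphM wE -aE.
- move=> i x; apply: injI; rewrite rmorphM rmorphXn [LHS]wE [X in _ * X]wE.
  rewrite /y map_mxM -/MC mulmxA spM -mulmxA mul_diag_mx mxE normrM exprMn.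
  by rewrite -aE real_normK.
Qed.

(** The last property makes [w] vanish at the zero eigenvalues on the range of [M]; all bounds by
    [lambda_minp] rest on it. *)
Lemma symmetric_spectral n (M : 'M[R]_n) : M^T = M ->
  exists (a : 'I_n -> R) (w : 'I_n -> 'cV[R]_n -> R),
  [/\ forall i, eigenvalue M (a i),
      forall i x, 0 <= w i x,
      forall x, dot x x = \sum_i w i x,
      forall x, dot x (M *m x) = \sum_i a i * w i x &
      forall i x, w i (M *m x) = a i ^+ 2 * w i x].
Proof.
apply: (@symmetric_spectral_closed R[i]%C (real_complex R) (@complex.Re R)).
- by move=> r; rewrite complex_real.
- exact: RRe_real.
- exact: ler0c.
Qed.

End Spectral.

(** * Extreme eigenvalues of symmetric matrices and the pseudo-inverse *)

Section Eigenvalues.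
Context {R : realType}.

Lemma eigenvalue_symP n (M : 'M[R]_n) (a : R) : M^T = M ->
  eigenvalue M a <-> exists2 x : 'cV[R]_n, x != 0 & M *m x = a *: x.
Proof.
move=> Ms; split.
  move=> /eigenvalueP[v vM v0]; exists v^T.
    by apply: contra v0 => /eqP /(congr1 trmx); rewrite trmxK trmx0 => ->.
  by rewrite -{1}Ms -trmx_mul vM linearZ.
move=> [x x0 Mx]; apply/eigenvalueP; exists x^T.
  by rewrite -{1}Ms -trmx_mul Mx linearZ.
by apply: contra x0 => /eqP /(congr1 trmx); rewrite trmxK trmx0 => ->.
Qed.

Definition psd n (M : 'M[R]_n) := forall x, 0 <= dot x (M *m x).

Lemma eigenvalue_psd n (M : 'M[R]_n) (a : R) : M^T = M -> psd M ->
  eigenvalue M a -> 0 <= a.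
Proof.
move=> Ms Mp /(eigenvalue_symP _ Ms)[x x0 Mx].
by have := Mp x; rewrite Mx dotZr pmulr_lge0 // dot_gt0.
Qed.

Lemma eigenvalue_has_sup n (M : 'M[R]_n) (a : R) : M^T = M ->
  eigenvalue M a -> has_sup [set b | eigenvalue M b].
Proof.
move=> Ms Ma; split; first by exists a.
have [c [w [_ w0 ws wd _]]] := symmetric_spectral Ms.
exists (\sum_i `|c i|) => b /(eigenvalue_symP _ Ms)[x x0 Mx].
have xx : 0 < dot x x by rewrite dot_gt0.
rewrite -(ler_pM2r xx) -dotZr -Mx wd ws mulr_sumr; apply: ler_sum => i _.
apply: ler_wpM2r => //; apply: le_trans (ler_norm _) _.
by rewrite (bigD1 i) //= lerDl sumr_ge0.
Qed.

Lemma lambda_max_ub n (M : 'M[R]_n) (a : R) : M^T = M ->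
  eigenvalue M a -> a <= lambda_max M.
Proof.
move=> Ms Ma; apply: sup_upper_bound => //.
exact: eigenvalue_has_sup Ma.
Qed.

Lemma lambda_max_dot n (M : 'M[R]_n) x : M^T = M ->
  dot x (M *m x) <= lambda_max M * dot x x.
Proof.
move=> Ms; have [c [w [ce w0 ws wd _]]] := symmetric_spectral Ms.
rewrite wd ws mulr_sumr; apply: ler_sum => i _.
by apply: ler_wpM2r => //; apply: lambda_max_ub.
Qed.

Lemma lambda_max_ge0 n (M : 'M[R]_n) : (0 < n)%N -> M^T = M -> psd M ->
  0 <= lambda_max M.
Proof.
case: n M => // n M _ Ms Mp.
have x0 : 0 < dot (delta_mx 0 0 : 'cV[R]_n.+1) (delta_mx 0 0).
  by rewrite dot_gt0; apply/eqP => /matrixP/(_ 0 0)/eqP; rewrite !mxE oner_eq0.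
rewrite -(pmulr_lge0 _ x0).
exact: le_trans (Mp _) (lambda_max_dot _ Ms).
Qed.

Lemma lambda_max_le n (M : 'M[R]_n) c : (0 < n)%N -> M^T = M ->
  (forall x, dot x (M *m x) <= c * dot x x) -> lambda_max M <= c.
Proof.
move=> n0 Ms h; apply: ge_sup.
  have [a [w [ce _ _ _ _]]] := symmetric_spectral Ms.
  by exists (a (Ordinal n0)); apply: ce.
move=> b /(eigenvalue_symP _ Ms)[x x0 Mx].
have xx : 0 < dot x x by rewrite dot_gt0.
by rewrite -(ler_pM2r xx) -dotZr -Mx.
Qed.

Lemma lambda_minp_le n (M : 'M[R]_n) (a : R) : M^T = M -> psd M ->
  eigenvalue M a -> a != 0 -> lambda_minp M <= a.
Proof.
move=> Ms Mp Ma a0; apply: ge_inf => //.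
by exists 0 => b [Mb _]; apply: eigenvalue_psd Mb.
Qed.

(** A vector of the range has no weight on zero eigenvalues, since [w i (M *m v)] carries the factor
    [c i ^+ 2]. *)
Lemma lambda_minp_range n (M : 'M[R]_n) v : M^T = M -> psd M ->
  lambda_minp M * dot (M *m v) (M *m v) <= dot (M *m v) (M *m (M *m v)).
Proof.
move=> Ms Mp; have [c [w [ce w0 ws wd wM]]] := symmetric_spectral Ms.
rewrite wd ws mulr_sumr; apply: ler_sum => i _.
have [ci|ci] := eqVneq (c i) 0; first by rewrite wM ci expr0n !mul0r mulr0.
by apply: ler_wpM2r => //; apply: lambda_minp_le.
Qed.

Lemma sym_eigenvalue_neq0 n (M : 'M[R]_n) : M^T = M -> M != 0 ->
  exists2 a : R, eigenvalue M a & a != 0.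
Proof.
move=> Ms M0; have [c [w [ce w0 ws wd wM]]] := symmetric_spectral Ms.
have [/existsP[i ci]|/existsPn c0] := boolP [exists i, c i != 0].
  by exists (c i).
case/negP: M0; apply/eqP/matrixP => i j.
have -> : M i j = (M *m (delta_mx j 0 : 'cV_n)) i 0 by rewrite -colE mxE.
suff -> : M *m (delta_mx j 0 : 'cV_n) = 0 by rewrite !mxE.
apply/eqP; rewrite -dot_eq0 ws big1 // => k _.
by have /negPn/eqP ck := c0 k; rewrite wM ck expr0n mul0r.
Qed.

(** [M != 0] provides a nonzero eigenvalue, without which the infimum would be a default value. *)
Lemma lambda_minp_ge n (M : 'M[R]_n) c : M^T = M -> M != 0 ->
  (forall v, c * dot (M *m v) (M *m v) <= dot (M *m v) (M *m (M *m v))) ->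
  c <= lambda_minp M.
Proof.
move=> Ms M0 h; apply: lb_le_inf.
  by have [a ? ?] := sym_eigenvalue_neq0 Ms M0; exists a.
move=> b [/(eigenvalue_symP _ Ms)[x x0 Mx] b0].
have xx : 0 < dot x x by rewrite dot_gt0.
(* An eigenvector of a nonzero eigenvalue lies in the range, so the hypothesis applies to it. *)
have xE : x = M *m (b^-1 *: x) by rewrite -scalemxAr Mx scalerA mulVf // scale1r.
by have := h (b^-1 *: x); rewrite -xE Mx dotZr ler_pM2r.
Qed.

Lemma lambda_minp_gt0 n (M : 'M[R]_n) : M^T = M -> psd M -> M != 0 ->
  0 < lambda_minp M.
Proof.
move=> Ms Mp M0; have [c [w [ce w0 ws wd wM]]] := symmetric_spectral Ms.
(* The default 1 is harmless: [e] only has to be a positive lower bound of the nonzero [c i]. *)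
pose e := \big[Num.min/1]_(i | c i != 0) c i.
have e0 : 0 < e.
  rewrite /e; elim/big_ind: _ => // [x y x0 y0|i ci]; first by rewrite lt_min x0.
  by rewrite lt_def ci (eigenvalue_psd Ms Mp).
apply: lt_le_trans e0 _; apply: lambda_minp_ge => // v.
rewrite wd ws mulr_sumr; apply: ler_sum => i _.
have [ci|ci] := eqVneq (c i) 0; first by rewrite wM ci expr0n !mul0r mulr0.
by apply: ler_wpM2r => //; rewrite /e (bigD1 i) //= ge_min lexx.
Qed.

Lemma eigenvalue_mul_tr p q (A : 'M[R]_(p, q)) a : a != 0 ->
  eigenvalue (A *m A^T) a -> eigenvalue (A^T *m A) a.
Proof.
move=> a0 /eigenvalueP[v vA v0]; apply/eigenvalueP; exists (v *m A).
  by rewrite mulmxA -(mulmxA v) vA -scalemxAl.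
apply: contra v0 => /eqP vA0; move: vA; rewrite mulmxA vA0 mul0mx => /esym/eqP.
by rewrite scaler_eq0 (negPf a0).
Qed.

Lemma tr_mul_sym p q (A : 'M[R]_(p, q)) : (A^T *m A)^T = A^T *m A.
Proof. by rewrite trmx_mul trmxK. Qed.

Lemma tr_mul_psd p q (A : 'M[R]_(p, q)) : psd (A^T *m A).
Proof. by move=> x; rewrite -mulmxA dot_mulmxr trmxK dot_ge0. Qed.

Lemma lambda_minp_mul_tr p q (A : 'M[R]_(p, q)) :
  lambda_minp (A *m A^T) = lambda_minp (A^T *m A).
Proof.
congr inf; apply/seteqP; split=> a [e a0]; split=> //.
  exact: eigenvalue_mul_tr.
by rewrite -[X in X *m _]trmxK; apply: eigenvalue_mul_tr; rewrite ?trmxK.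
Qed.

(** The two products share their nonzero eigenvalues; 0 may belong to only one of them and is
    covered by positive semi-definiteness. *)
Lemma lambda_max_mul_tr_le p q (A : 'M[R]_(p, q)) : (0 < p)%N -> (0 < q)%N ->
  lambda_max (A *m A^T) <= lambda_max (A^T *m A).
Proof.
move=> p0 q0; have As : (A *m A^T)^T = A *m A^T by rewrite trmx_mul trmxK.
apply: ge_sup.
  have [a [w [ce _ _ _ _]]] := symmetric_spectral As.
  by exists (a (Ordinal p0)); apply: ce.
move=> a /= ea; have [->|a0] := eqVneq a 0.
  by apply: lambda_max_ge0 => //; [exact: tr_mul_sym|exact: tr_mul_psd].
by apply: lambda_max_ub; [exact: tr_mul_sym|apply: eigenvalue_mul_tr].
Qed.

Lemma lambda_max_mul_tr p q (A : 'M[R]_(p, q)) : (0 < p)%N -> (0 < q)%N ->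
  lambda_max (A *m A^T) = lambda_max (A^T *m A).
Proof.
move=> p0 q0; apply/eqP; rewrite eq_le lambda_max_mul_tr_le //=.
by rewrite -{2}[A]trmxK -{3}[A]trmxK; apply: lambda_max_mul_tr_le.
Qed.

Lemma tr_mul_inj p q r (A : 'M[R]_(p, q)) (B : 'M[R]_(q, r)) :
  A^T *m (A *m B) = 0 -> A *m B = 0.
Proof.
move=> h; apply/matrixP => i j; rewrite [RHS]mxE.
have /eqP : dot (col j (A *m B)) (col j (A *m B)) = 0.
  rewrite colE -!mulmxA dot_mulmxr (mulmxA A B) mulmxA h.
  by rewrite mul0mx dot0l.
by rewrite dot_eq0 => /eqP/matrixP/(_ i 0); rewrite !mxE.
Qed.

Lemma row_free_mul_tr_unit p q (B : 'M[R]_(p, q)) : row_free B ->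
  B *m B^T \in unitmx.
Proof.
move=> Bf; rewrite -row_free_unit -kermx_eq0 -submx0; apply/row_subP => i.
set v := row i _.
have /sub_kermxP : (v <= kermx (B *m B^T))%MS by apply: row_sub.
rewrite mulmxA => h.
have : B^T *m v^T = 0.
  apply: tr_mul_inj; apply: trmx_inj.
  by rewrite trmxK trmx0 !trmx_mul !trmxK.
move=> /(congr1 trmx); rewrite trmx_mul !trmxK trmx0 => /eqP.
by rewrite mulmx_free_eq0 // => /eqP ->; apply: sub0mx.
Qed.

(** With a rank factorization [A = C B], the matrix [B^T (B B^T)^-1 (C^T C)^-1 C^T] works; both Gram
    matrices are invertible because [B] has full row rank and [C] full column rank. *)
Lemma penrose_ex p q (A : 'M[R]_(p, q)) : exists X, penrose A X.
Proof.
pose C := col_base A; pose B := row_base A.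
have BU : B *m B^T \in unitmx by apply/row_free_mul_tr_unit/row_base_free.
have CU : C^T *m C \in unitmx.
  have := @row_free_mul_tr_unit _ _ C^T; rewrite trmxK; apply.
  by rewrite /row_free mxrank_tr; apply: col_base_full.
have CBE : C *m B = A by apply: mulmx_base.
clearbody C B; pose X := B^T *m invmx (B *m B^T) *m (invmx (C^T *m C) *m C^T).
have AX : A *m X = C *m invmx (C^T *m C) *m C^T.
  transitivity (C *m B *m X); first by rewrite CBE.
  by rewrite /X !mulmxA -(mulmxA C B) mulmxK.
have XA : X *m A = B^T *m invmx (B *m B^T) *m B.
  transitivity (X *m (C *m B)); first by rewrite CBE.
  by rewrite /X -!mulmxA (mulmxA C^T) mulKmx // !mulmxA.
exists X; split.
- transitivity (A *m X *m (C *m B)); first by rewrite CBE.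
  by rewrite AX !mulmxA -(mulmxA _ C^T C) mulmxKV // CBE.
- by rewrite XA /X !mulmxA -(mulmxA _ B B^T) mulmxKV.
- by rewrite AX !trmx_mul trmxK trmx_inv trmx_mul trmxK mulmxA.
- by rewrite XA !trmx_mul trmxK trmx_inv trmx_mul trmxK mulmxA.
Qed.

Lemma pseudo_invP p q (A : 'M[R]_(p, q)) : penrose A (pseudo_inv A).
Proof. by have [X AX] := penrose_ex A; apply: (@xgetPex _ 0 (penrose A)); exists X. Qed.

Lemma penrose_uniq p q (A : 'M[R]_(p, q)) X Y : penrose A X -> penrose A Y -> X = Y.
Proof.
move=> [x1 x2 x3 x4] [y1 y2 y3 y4].
have AXY : A *m X = A *m Y.
  have h : A *m Y *m (A *m X) = A *m X by rewrite mulmxA y1.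
  have h' : A *m X *m (A *m Y) = A *m Y by rewrite mulmxA x1.
  by rewrite -x3 -{1}h trmx_mul x3 y3 h'.
have XYA : X *m A = Y *m A.
  have h : X *m A *m (Y *m A) = X *m A by rewrite -mulmxA (mulmxA A) y1.
  have h' : Y *m A *m (X *m A) = Y *m A by rewrite -mulmxA (mulmxA A) x1.
  by rewrite -x4 -{1}h trmx_mul x4 y4 h'.
by rewrite -x2 XYA -mulmxA AXY mulmxA y2.
Qed.

Lemma pseudo_inv_eq p q (A : 'M[R]_(p, q)) X : penrose A X -> pseudo_inv A = X.
Proof. by move=> AX; apply: penrose_uniq AX; apply: pseudo_invP. Qed.

End Eigenvalues.

(** * Block vectors *)

Section Blocks.
Context {R : realType}.

Lemma mulmx_ext p q (M N : 'M[R]_(p, q)) : (forall x : 'cV_q, M *m x = N *m x) -> M = N.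
Proof.
move=> h; apply/matrixP => i j.
by have /matrixP/(_ i 0) := h (delta_mx j 0); rewrite -!colE !mxE.
Qed.

Lemma sum_pair_ord (I : finType) d (F : 'I_#|{: I * 'I_d}| -> R) :
  \sum_r F r = \sum_k \sum_a F (enum_rank (k, a)).
Proof.
rewrite pair_bigA (reindex (@enum_rank (I * 'I_d)%type)) /=; last first.
  by apply: onW_bij; apply: enum_rank_bij.
by apply: eq_bigr => -[].
Qed.

Lemma of_blksK (I : finType) d (F : I -> 'cV[R]_d) k : blk (of_blks F) k = F k.
Proof. by apply/matrixP => i j; rewrite !mxE enum_rankK ord1. Qed.

Lemma blk_inj (I : finType) d (x y : @bvec R I d) :
  (forall k, blk x k = blk y k) -> x = y.
Proof.
move=> h; apply/matrixP => r j; rewrite ord1.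
have /matrixP/(_ (enum_val r).2 0) := h (enum_val r).1.
by rewrite !mxE -surjective_pairing enum_valK.
Qed.

Lemma blkD (I : finType) d (x y : @bvec R I d) k : blk (x + y) k = blk x k + blk y k.
Proof. by apply/matrixP => i j; rewrite !mxE. Qed.

Lemma blkZ (I : finType) d a (x : @bvec R I d) k : blk (a *: x) k = a *: blk x k.
Proof. by apply/matrixP => i j; rewrite !mxE. Qed.

Lemma blkN (I : finType) d (x : @bvec R I d) k : blk (- x) k = - blk x k.
Proof. by apply/matrixP => i j; rewrite !mxE. Qed.

Lemma blkB (I : finType) d (x y : @bvec R I d) k : blk (x - y) k = blk x k - blk y k.
Proof. by rewrite blkD blkN. Qed.

Lemma blk0 (I : finType) d k : blk (0 : @bvec R I d) k = 0.
Proof. by apply/matrixP => i j; rewrite !mxE. Qed.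

Lemma dot_blk (I : finType) d (x y : @bvec R I d) :
  dot x y = \sum_k dot (blk x k) (blk y k).
Proof.
rewrite dotE sum_pair_ord; apply: eq_bigr => k _.
by rewrite dotE; apply: eq_bigr => a _; rewrite !mxE.
Qed.

Lemma blk_mulmx (I J : finType) d (F : I -> J -> 'M[R]_d) (x : @bvec R J d) k :
  blk (blk_mx F *m x) k = \sum_l F k l *m blk x l.
Proof.
apply/matrixP => a j; rewrite ord1 !mxE sum_pair_ord summxE.
apply: eq_bigr => l _; rewrite mxE; apply: eq_bigr => b _.
by rewrite !mxE !enum_rankK.
Qed.

Lemma tr_blk_mx (I J : finType) d (F : I -> J -> 'M[R]_d) :
  (blk_mx F)^T = blk_mx (fun l k => (F k l)^T).
Proof. by apply/matrixP => i j; rewrite !mxE. Qed.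

(** The body has the shape of [Sigma], so that [Sigma D] is [blk_diag (sigma_blk D)] by
    conversion. *)
Definition blk_diag (I : finType) d (F : I -> 'M[R]_d) :=
  blk_mx (fun k l : I => if k == l then F k else 0).

Lemma blk_diag_mulmx (I : finType) d (F : I -> 'M[R]_d) (x : @bvec R I d) k :
  blk (blk_diag F *m x) k = F k *m blk x k.
Proof.
rewrite blk_mulmx (bigD1 k) //= eqxx big1 ?addr0 // => l lk.
by rewrite eq_sym (negPf lk) mul0mx.
Qed.

Lemma tr_blk_diag (I : finType) d (F : I -> 'M[R]_d) :
  (blk_diag F)^T = blk_diag (fun k => (F k)^T).
Proof.
rewrite tr_blk_mx; congr blk_mx; apply/funext => k; apply/funext => l.
by rewrite eq_sym; case: eqP => [->|_]; rewrite ?trmx0.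
Qed.

Lemma blk_diag_mul (I : finType) d (F G : I -> 'M[R]_d) :
  blk_diag F *m blk_diag G = blk_diag (fun k => F k *m G k).
Proof.
apply: mulmx_ext => x; apply: blk_inj => k.
by rewrite -mulmxA !blk_diag_mulmx mulmxA.
Qed.

Lemma pseudo_inv_blk_diag (I : finType) d (F G : I -> 'M[R]_d) :
  (forall k, penrose (F k) (G k)) -> pseudo_inv (blk_diag F) = blk_diag G.
Proof.
move=> h; apply: pseudo_inv_eq.
split; rewrite !blk_diag_mul ?tr_blk_diag; congr blk_diag; apply/funext => k;
  by have [] := h k.
Qed.

End Blocks.

(** * Expectation over independent blocks *)

Section Expectation.
Context {R : realType} {I : finType} (pi : nat -> I -> R) (b0 : nat -> I).

Definition upd (b : nat -> I) K c := fun t => if t == K then c else b t.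

(* Expectation of [g] under the product law of weights [pi], for [g] depending
   on the first [K] coordinates only. *)
Fixpoint Ex K (g : (nat -> I) -> R) : R :=
  if K is K'.+1 then \sum_c pi K' c * Ex K' (fun b => g (upd b K' c)) else g b0.

Definition adapted {U : Type} K (g : (nat -> I) -> U) :=
  forall b b', (forall t, (t < K)%N -> b t = b' t) -> g b = g b'.

Lemma adapted_upd U K (g : (nat -> I) -> U) c :
  adapted K.+1 g -> adapted K (fun b => g (upd b K c)).
Proof.
move=> gK b b' bb'; apply: gK => t; rewrite ltnS leq_eqVlt /upd.
by case: eqP => //= _; apply: bb'.
Qed.

Hypothesis pi_ge0 : forall t c, 0 <= pi t c.

Lemma Ex_le K g h : (forall b, g b <= h b) -> Ex K g <= Ex K h.
Proof.
elim: K g h => [|K IH] g h gh //=.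
by apply: ler_sum => c _; apply: ler_wpM2l => //; apply: IH.
Qed.

Lemma Ex_ext K g h : (forall b, g b = h b) -> Ex K g = Ex K h.
Proof. by move=> gh; congr Ex; apply/funext. Qed.

Lemma ExD K g h : Ex K (fun b => g b + h b) = Ex K g + Ex K h.
Proof.
elim: K g h => [|K IH] g h //=.
by rewrite -big_split /=; apply: eq_bigr => c _; rewrite IH mulrDr.
Qed.

Lemma ExZ K a g : Ex K (fun b => a * g b) = a * Ex K g.
Proof.
elim: K g => [|K IH] g //=.
by rewrite mulr_sumr; apply: eq_bigr => c _; rewrite IH mulrCA.
Qed.

Lemma Ex_sum K (J : Type) (r : seq J) (P : pred J) (g : J -> (nat -> I) -> R) :
  Ex K (fun b => \sum_(j <- r | P j) g j b) = \sum_(j <- r | P j) Ex K (g j).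
Proof.
elim: r => [|j r IH].
  rewrite big_nil -[RHS](mul0r (Ex K (fun=> 0))) -ExZ.
  by apply: Ex_ext => b; rewrite big_nil mul0r.
rewrite big_cons -IH; case: ifP => Pj; last first.
  by apply: Ex_ext => b; rewrite big_cons Pj.
by rewrite -ExD; apply: Ex_ext => b; rewrite big_cons Pj.
Qed.

Lemma Ex_cst K c : (forall t, \sum_c pi t c = 1) -> Ex K (fun=> c) = c.
Proof.
by move=> h; elim: K => //= K ->; rewrite -mulr_suml h mul1r.
Qed.

Lemma ExS K g : Ex K.+1 g = Ex K (fun b => \sum_c pi K c * g (upd b K c)).
Proof. by rewrite Ex_sum; apply: eq_bigr => c _; rewrite ExZ. Qed.

(** [ExS] conditions on the earlier samples, which turns the pathwise one-step bound into a
    geometric one. *)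
Lemma Ex_supermartingale (g : nat -> (nat -> I) -> R) (q : R) : 0 <= q ->
  (forall t b, \sum_c pi t c * g t.+1 (upd b t c) <= q * g t b) ->
  forall K, Ex K (g K) <= q ^+ K * g 0%N b0.
Proof.
move=> q0 gq; elim=> [|K IH]; first by rewrite expr0 mul1r.
rewrite ExS exprS -mulrA; apply: le_trans (Ex_le K (gq K)) _.
by rewrite ExZ; apply: ler_wpM2l.
Qed.

Context {disp : measure_display} {T : measurableType disp}
  (Pr : probability T R) (B : nat -> T -> I).
Hypothesis measB : forall t b, measurable [set w | B t w = b].
Hypothesis lawB : forall t c, Pr [set w | B t w = c] = (pi t c)%:E.
Hypothesis indepB : forall K (b : nat -> I),
  Pr [set w | forall t, (t < K)%N -> B t w = b t] =
  (\prod_(t < K) Pr [set w | B t w = b t])%E.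

(** The set [Y] is arbitrary because [g] depends on finitely many samples with values in a finite
    type. *)
Lemma adapted_measurable U K (g : (nat -> I) -> U) (Y : set U) :
  adapted K g -> measurable [set w | Y (g (B^~ w))].
Proof.
elim: K g => [|K IH] g gK.
  have [Yg|Yg] := pselect (Y (g b0)).
    rewrite (_ : [set _ | _] = setT); first exact: measurableT.
    by apply/seteqP; split=> w //= _; rewrite (gK _ b0).
  rewrite (_ : [set _ | _] = set0); first exact: measurable0.
  by apply/seteqP; split=> w //=; rewrite (gK _ b0).
rewrite (_ : [set _ | _] = \bigcup_(c in [set: I]) ([set w | B K w = c] `&`
  [set w | Y (g (upd (B^~ w) K c))])); last first.
  have gE w : g (upd (B^~ w) K (B K w)) = g (B^~ w).
    by apply: gK => t _; rewrite /upd; case: eqP => [->|].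
  apply/seteqP; split=> w /=; first by move=> Yg; exists (B K w) => //=; rewrite gE.
  by move=> [c _ [/= <-]]; rewrite gE.
apply: fin_bigcup_measurable => [|c _]; first exact: finite_finset.
by apply: measurableI => //; apply: (IH (fun b => g (upd b K c))); apply: adapted_upd.
Qed.

(** Independence is stated for initial segments of samples. Prescribing the samples from [K] to
    [K + J - 1] as well lets the induction on [K] move coordinates out of [h] into the prescribed
    tail until, at [K = 0], the event is such a segment. *)
Lemma integral_adapted K J b (h : (nat -> I) -> R) :
  adapted K h -> (forall b, 0 <= h b) ->
  (\int[Pr]_(w in [set w | forall t, (K <= t < K + J)%N -> B t w = b t])
      (h (B^~ w))%:E)%E
  = (Ex K h * \prod_(K <= t < K + J) pi t (b t))%:E.
Proof.
elim: K J b h => [|K IH] J b h hK h0.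
  rewrite (eq_integral (cst (h b0)%:E)); last by move=> w _; rewrite (hK _ b0).
  rewrite (_ : [set _ | _] = [set w | forall t, (t < J)%N -> B t w = b t]) //.
  rewrite integral_cst; last first.
    pose g (b' : nat -> I) := [forall t : 'I_J, b' t == b t].
    rewrite (_ : [set _ | _] = [set w | is_true (g (B^~ w))]).
      apply: (@adapted_measurable _ J g is_true) => b1 b2 b12.
      by apply: eq_forallb => t; rewrite b12.
    apply/seteqP; split=> w /=.
      by move=> hw; apply/forallP => t; rewrite hw.
    by move=> /forallP hw t tJ; have /eqP := hw (Ordinal tJ).
  transitivity ((h b0)%:E * \prod_(t < J) Pr [set w | B t w = b t])%E.
    by congr (_ * _)%E; apply: indepB.
  rewrite /= EFinM add0n big_mkord; congr (_ * _)%E.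
  by elim/big_rec2: _ => // t y x _ ->; rewrite lawB -EFinM.
(* Splitting by the value [c] of sample [K] prescribes one more coordinate, so the induction
   hypothesis is used with [J.+1]. *)
pose S c := [set w | forall t, (K <= t < K + J.+1)%N -> B t w = upd b K c t].
have SE c w : S c w -> B K w = c.
  by move=> /(_ K); rewrite leqnn addnS ltnS leq_addr /upd eqxx; apply.
rewrite (_ : [set _ | _] = \big[setU/set0]_(c <- index_enum I) S c); last first.
  rewrite -bigcup_seq; apply/seteqP; split=> w /=.
    move=> hw; exists (B K w); first exact: mem_index_enum.
    move=> t /andP[Kt tK]; rewrite /upd; case: eqP => [->//|/eqP tneK].
    by apply: hw; rewrite ltn_neqAle eq_sym tneK Kt /= addSnnS.
  move=> [c _ Scw] t /andP[Kt tK]; rewrite Scw ?(ltnW Kt) /=; last by rewrite -addSnnS.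
  by rewrite /upd gtn_eqF.
have mS c : measurable (S c).
  pose g (b' : nat -> I) :=
    [forall t : 'I_(K + J.+1), (K <= t)%N ==> (b' t == upd b K c t)].
  rewrite (_ : S c = [set w | is_true (g (B^~ w))]).
    apply: (@adapted_measurable _ (K + J.+1) g is_true) => b1 b2 b12.
    by apply: eq_forallb => t; rewrite b12.
  apply/seteqP; split=> w /=.
    by move=> hw; apply/forallP => t; apply/implyP => Kt; rewrite hw ?Kt /=.
  by move=> /forallP hw t /andP[Kt tK]; have := hw (Ordinal tK); rewrite /= Kt => /eqP.
rewrite ge0_integral_bigsetU //=; last 4 first.
- exact: index_enum_uniq.
- apply/trivIsetP => c c' _ _ cc'; apply/seteqP; split=> w //= [/SE Bc /SE Bc'].
  by move: cc'; rewrite -Bc -Bc' eqxx.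
- move=> mD Y _; apply: measurableI => //.
  exact: (@adapted_measurable _ K.+1 h (fun r => Y r%:E)).
- by move=> w _; rewrite lee_fin.
rewrite mulr_suml -sumEFin; apply: eq_bigr => c _.
transitivity (\int[Pr]_(w in S c) (h (upd (B^~ w) K c))%:E)%E.
  apply: eq_integral => w; rewrite inE => /SE <-; congr (_%:E).
  by apply: hK => t _; rewrite /upd; case: eqP => [->|].
rewrite (IH J.+1 (upd b K c) (fun b => h (upd b K c))) //; last exact: adapted_upd.
rewrite [X in _ * X]big_ltn ?addnS ?ltnS ?leq_addr //.
have -> : upd b K c K = c by rewrite /upd eqxx.
rewrite mulrCA mulrA; congr (_ * _)%:E; rewrite addSn; apply: eq_big_nat => t /andP[Kt _].
by rewrite /upd gtn_eqF.
Qed.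

Lemma expectation_adapted K (h : (nat -> I) -> R) :
  adapted K h -> (forall b, 0 <= h b) ->
  ('E_Pr[fun w => h (B^~ w)] = (Ex K h)%:E)%E.
Proof.
move=> hK h0; rewrite unlock.
have := @integral_adapted K 0 b0 h hK h0.
rewrite addn0 big_geq // mulr1 => <-; congr (integral _ _ _).
by apply/seteqP; split=> w //= _ t; rewrite ltnNge andbN.
Qed.

End Expectation.

(** * Convex analysis *)

Section ConvexGradient.
Context {R : realType} {d : nat}.
Implicit Types (x y v : 'cV[R]_d).

Lemma dot_grad (f : 'cV[R]_d -> R) y v : differentiable f y ->
  dot (grad f y) v = 'D_v f y.
Proof.
move=> df; rewrite deriveE // dotE {2}(matrix_sum_delta v) linear_sum.
apply: eq_bigr => a _; rewrite linear_sum big_ord1 linearZ /= mxE deriveE //.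
by rewrite mulrC.
Qed.

(** By convexity the difference quotients from [y] towards [x] with step in (0, 1] are at most
    [f x - f y]; the directional derivative is their limit from the right. *)
Lemma convex_grad (f : 'cV[R]_d -> R) x y :
  convex_function setT f -> differentiable f y ->
  f y + dot (grad f y) (x - y) <= f x.
Proof.
move=> fc df; rewrite dot_grad // -lerBrDl.
have dv : derivable f y (x - y) by apply: diff_derivable.
have c0 := cvg_dnbhs_at_right dv.
rewrite /derive -(cvg_lim (@Rhausdorff R) c0); apply: limr_le.
  by apply/cvg_ex; eexists; exact: c0.
near=> h.
have h0 : 0 < h by near: h; exact: nbhs_right_gt.
have h1 : h <= 1 by apply: ltW; near: h; exact: nbhs_right_lt.
have := fc (Itv01 (ltW h0) h1) x y (in_setT _) (in_setT _).
rewrite /conv /= /unstable.onem.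
have -> : h *: x + (1 - h) *: y = (h *: (x - y) + y).
  by rewrite scalerBr scalerBl scale1r addrCA addrC -addrA [- _ + _]addrC.
move=> fh; rewrite ler_pdivrMl // lerBlDr.
have {}fh : f (h *: (x - y) + y) <= h * f x + (1 - h) * f y := fh.
by apply: le_trans fh _; rewrite /= mulrBr; lra.
Unshelve. all: by end_near. Qed.

End ConvexGradient.

(** * Proximal points of suprema of affine functions *)

Section SupAffine.
Context {R : realType} {d : nat} {X : Type}.
Variables (x0 : X) (u : X -> 'cV[R]_d) (c : X -> R).
Implicit Types (a b v w z : 'cV[R]_d).

Definition aff x a : R := dot a (u x) + c x.
Definition saff_dom a := has_ubound [set aff x a | x in [set: X]].
(** Meaningful on [saff_dom] only: elsewhere [sup] is a default value, whereas [esaff] is [+oo]. *)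
Definition saff a : R := sup [set aff x a | x in [set: X]].
Definition esaff a : \bar R := ereal_sup [set (aff x a)%:E | x in [set: X]].

Lemma aff_comb x t a b : aff x ((1 - t) *: a + t *: b) = (1 - t) * aff x a + t * aff x b.
Proof. by rewrite /aff dotDl !dotZl; ring. Qed.

Lemma aff_le_saff x a : saff_dom a -> aff x a <= saff a.
Proof. by move=> da; apply: ub_le_sup => //; exists x. Qed.

Lemma saff_le a M : (forall x, aff x a <= M) -> saff a <= M.
Proof.
move=> h; apply: ge_sup; first by exists (aff x0 a), x0.
by move=> _ [x _ <-].
Qed.

Lemma saff_dom_ub a M : (forall x, aff x a <= M) -> saff_dom a.
Proof. by move=> h; exists M => _ [x _ <-]. Qed.

Lemma esaff_dom a : saff_dom a -> esaff a = (saff a)%:E.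
Proof.
move=> da; rewrite -ereal_sup_EFin //; last by exists (aff x0 a), x0.
congr ereal_sup; apply/seteqP; split=> r /=.
  by move=> [x _ <-]; exists (aff x a) => //; exists x.
by move=> [_ [x _ <-] <-]; exists x.
Qed.

Lemma esaff_gtNy a : (-oo < esaff a)%E.
Proof.
apply: (@lt_le_trans _ _ (aff x0 a)%:E); first exact: ltNyr.
by apply: ereal_sup_ubound; exists x0.
Qed.

Lemma esaff_lty a : (esaff a < +oo)%E -> saff_dom a.
Proof.
move=> alty; have aN := esaff_gtNy a.
have af : esaff a \is a fin_num by rewrite fin_real // aN alty.
apply: (@saff_dom_ub _ (fine (esaff a))) => x.
by rewrite -lee_fin fineK //; apply: ereal_sup_ubound; exists x.
Qed.

Lemma saff_dom_comb t a b : 0 <= t -> t <= 1 -> saff_dom a -> saff_dom b ->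
  saff_dom ((1 - t) *: a + t *: b).
Proof.
move=> t0 t1 da db; apply: (@saff_dom_ub _ ((1 - t) * saff a + t * saff b)) => x.
by rewrite aff_comb lerD // ler_wpM2l ?subr_ge0 ?aff_le_saff.
Qed.

Lemma saff_comb t a b : 0 <= t -> t <= 1 -> saff_dom a -> saff_dom b ->
  saff ((1 - t) *: a + t *: b) <= (1 - t) * saff a + t * saff b.
Proof.
move=> t0 t1 da db; apply: saff_le => x.
by rewrite aff_comb lerD // ler_wpM2l ?subr_ge0 ?aff_le_saff.
Qed.

Section Prox.
Variables (eta : R) (z a0 : 'cV[R]_d).
Hypotheses (eta0 : 0 < eta) (da0 : saff_dom a0).

Let e := (2 * eta)^-1.
Let e0 : 0 < e. Proof. by rewrite invr_gt0 mulr_gt0. Qed.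
Let phi v := e * dot (v - z) (v - z) + saff v.

Let phi_bounded v : saff_dom v ->
  dot z (u x0) + c x0 - (4 * e)^-1 * dot (u x0) (u x0) <= phi v.
Proof.
move=> dv; rewrite /phi; have := aff_le_saff x0 dv; rewrite /aff.
(* Completing the square: the bound is the minimum over [v] of the quadratic term plus the single
   affine piece [x0]. *)
have := dot_ge0 ((2 * e) *: (v - z) + u x0).
rewrite !(dotDl, dotDr, dotZl, dotZr, dotNl, dotNr) !(dotC (u x0)) !(dotC z v).
set A := dot v v; set B := dot v z; set C := dot z z; set F := dot v _.
set G := dot z _; set H := dot _ _; set s := saff v => h1 h2.
have h3 : (4 * e)^-1 * H >= F * -1 + G - e * (A - B - (B - C)).
  rewrite -(ler_pM2l (_ : 0 < 4 * e)); last by rewrite mulr_gt0.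
  by rewrite mulVKf ?mulf_neq0 ?gt_eqF //; lra.
by lra.
Qed.

Let inf_phi := inf [set phi v | v in saff_dom].

Let phi_ge_inf v : saff_dom v -> inf_phi <= phi v.
Proof.
move=> dv; apply: ge_inf; last by exists v.
by eexists => _ [w dw <-]; apply: phi_bounded.
Qed.

Let prox_seq : exists v : nat -> 'cV[R]_d,
  forall k, saff_dom (v k) /\ phi (v k) <= inf_phi + harmonic k.
Proof.
suff /choice[v hv] : forall k, exists v, saff_dom v /\ phi v <= inf_phi + harmonic k.
  by exists v.
move=> k.
have hI : has_inf [set phi v | v in saff_dom].
  split; first by exists (phi a0), a0.
  by eexists => _ [w dw <-]; apply: phi_bounded.
have [_ [v dv <-] hv] := inf_adherent (harmonic_gt0 k) hI.
by exists v; split=> //; apply: ltW.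
Qed.

(** Strong convexity at the midpoint: near-minimizers of [phi] are close to each other, so a
    minimizing sequence is Cauchy. *)
Let phi_mid v w : saff_dom v -> saff_dom w ->
  e * dot (v - w) (v - w) <= 2 * (phi v + phi w) - 4 * inf_phi.
Proof.
move=> dv dw.
have h0 : 0 <= 2^-1 :> R by rewrite invr_ge0.
have h1 : 2^-1 <= 1 :> R by rewrite invf_le1 // ler1n.
have := saff_comb h0 h1 dv dw; have := phi_ge_inf (saff_dom_comb h0 h1 dv dw).
rewrite /phi !(dotDl, dotDr, dotZl, dotZr, dotNl, dotNr) (dotC w v) !(dotC z).
set A := dot v v; set B := dot v w; set C := dot w w; set F := dot v z.
set G := dot w z; set H := dot z z; set s := saff _; set s1 := saff v.
by set s2 := saff w => k1 k2; lra.
Qed.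

Lemma prox_min_ex : exists2 v, saff_dom v &
  forall w, saff_dom w -> phi v <= phi w.
Proof.
have [v hv] := prox_seq.
have dist j k i : (v j i 0 - v k i 0) ^+ 2 <= 2 / e * (harmonic j + harmonic k).
  have [dj pj] := hv j; have [dk pk] := hv k.
  apply: (@le_trans _ _ (dot (v j - v k) (v j - v k))).
    rewrite dotE (bigD1 i) //= !mxE expr2 lerDl.
    by apply: sumr_ge0 => l _; rewrite -expr2 sqr_ge0.
  rewrite -(ler_pM2l e0) mulrA mulrCA divff ?gt_eqF // mulr1.
  by apply: le_trans (phi_mid dj dk) _; lra.
have cv i : cvg ((fun k => v k i 0) @ \oo).
  apply/cauchy_cvgP; apply: cauchy_exP => r r0.
  have r1 : 0 < r ^+ 2 * e / 4 by rewrite divr_gt0 // mulr_gt0 // exprn_gt0.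
  have [N _ hN] := cvgr_lt _ (@cvg_harmonic R) _ r1.
  exists (v N i 0); exists N => // k Nk /=.
  rewrite -ball_normE /= -(ltr_pXn2r (_ : 0 < 2)%N) ?nnegrE ?normr_ge0 ?ltW //.
  rewrite real_normK ?num_real //; apply: le_lt_trans (dist N k i) _.
  have h1 : harmonic N < r ^+ 2 * e / 4 := hN N (leqnn _).
  have h2 : harmonic k < r ^+ 2 * e / 4 := hN k Nk.
  rewrite mulrAC ltr_pdivrMr //; move: h1 h2.
  by set hk := harmonic k; set hN' := harmonic N; lra.
pose l := \col_i lim ((fun k => v k i 0) @ \oo) : 'cV[R]_d.
have vl i : (fun k => v k i 0) @ \oo --> l i 0 by rewrite mxE; exact: cv.
clearbody l.
have vz i : (fun k => (v k - z) i 0) @ \oo --> (l - z) i 0.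
  have -> : (fun k => (v k - z) i 0) = (fun k => v k i 0 - z i 0).
    by apply/funext => k; rewrite !mxE.
  by rewrite !mxE; apply: cvgB; [exact: vl|exact: cvg_cst].
have cdot (a b : nat -> 'cV[R]_d) a' b' : (forall i, (fun k => a k i 0) @ \oo --> a' i 0) ->
    (forall i, (fun k => b k i 0) @ \oo --> b' i 0) ->
    (fun k => dot (a k) (b k)) @ \oo --> dot a' b'.
  move=> ha hb; rewrite dotE.
  under [X in X @ _ --> _]eq_fun do rewrite dotE.
  apply: (@cvg_big _ _ _ _ _ add_continuous) => i _.
  by apply: cvgM; [exact: ha|exact: hb].
(* [saff] may be discontinuous, but each affine piece is continuous. Passing to the limit piece by
   piece and then taking the supremum serves as lower semicontinuity. *)
have key x : e * dot (l - z) (l - z) + aff x l <= inf_phi.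
  have c1 : (fun k => e * dot (v k - z) (v k - z) + aff x (v k)) @ \oo -->
      e * dot (l - z) (l - z) + aff x l.
    apply: cvgD.
      by apply: cvgMr; apply: cdot.
    apply: cvgD; last exact: cvg_cst.
    by apply: cdot => // i; exact: cvg_cst.
  have c2 : (fun k => inf_phi + harmonic k) @ \oo --> inf_phi + 0.
    by apply: cvgD; [exact: cvg_cst|exact: cvg_harmonic].
  rewrite -[X in _ <= X]addr0; apply: (ler_cvg_to c1 c2).
  apply: nearW => k; have [dk pk] := hv k; apply: le_trans pk.
  by rewrite /phi lerD2l aff_le_saff.
have dl : saff_dom l.
  by apply: (@saff_dom_ub _ (inf_phi - e * dot (l - z) (l - z))) => x; have := key x; lra.
exists l => // w dw; apply: le_trans (phi_ge_inf dw); rewrite /phi -lerBrDl.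
by apply: saff_le => x; have := key x; lra.
Qed.

Lemma prox_spec : let v := prox eta esaff z in
  saff_dom v /\ forall w, saff_dom w -> phi v <= phi w.
Proof.
have [v0 dv0 hv0] := prox_min_ex.
set S := [set v | forall w, (((2 * eta)^-1 * normsq (v - z))%:E + esaff v
      <= ((2 * eta)^-1 * normsq (w - z))%:E + esaff w)%E].
have Sv : S (prox eta esaff z).
  apply: (@xgetPex _ 0 S); exists v0 => w.
  have [dw|dw] := pselect (saff_dom w).
    by rewrite !esaff_dom // -!EFinD lee_fin; apply: hv0.
  suff -> : esaff w = +oo%E by rewrite addey // leey.
  by have := @esaff_lty w; case: (esaff w) (esaff_gtNy w) => // r _ /(_ (ltry r)).
have dv : saff_dom (prox eta esaff z).
  apply: esaff_lty; have := Sv v0; rewrite (esaff_dom dv0) -EFinD.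
  by case: (esaff (prox eta esaff z)) => // r _; exact: ltry.
split=> // w dw; have := Sv w.
by rewrite !esaff_dom // -!EFinD lee_fin.
Qed.

Lemma prox_dom : saff_dom (prox eta esaff z).
Proof. by have [] := prox_spec. Qed.

(** The minimizer [v] is compared with [(1 - t) v + t w]: the quadratic error is of order [t^2], so
    a strict failure of the inequality would show for small [t]. *)
Lemma prox_variational w : saff_dom w ->
  saff (prox eta esaff z) +
    eta^-1 * dot (z - prox eta esaff z) (w - prox eta esaff z) <= saff w.
Proof.
move=> dw; set v := prox eta esaff z; have [dv hv] := prox_spec; rewrite -/v in dv hv.
have -> : eta^-1 = 2 * e by rewrite /e invfM mulrA divff ?mul1r ?pnatr_eq0.
rewrite leNgt; apply/negP => hlt.
set N := dot (w - v) (w - v); have N0 : 0 <= N by apply: dot_ge0.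
set del := saff v + 2 * e * dot (z - v) (w - v) - saff w.
have del0 : 0 < del by rewrite /del subr_gt0.
have eN : 0 <= e * N by apply: mulr_ge0 => //; exact: ltW.
have dN : 0 < del + e * N by exact: ltr_pwDl.
(* Chosen so that [t <= 1] and [t * (e * N) < del]: the quadratic error cannot make up for the gap
   [del]. *)
pose t := del / (del + e * N).
have t0 : 0 < t by rewrite divr_gt0.
have t1 : t <= 1 by rewrite ler_pdivrMr // mul1r lerDl.
have := hv _ (saff_dom_comb (ltW t0) t1 dv dw).
have := saff_comb (ltW t0) t1 dv dw; rewrite /phi => k1 k2.
have {k1 k2} : 0 <= t * (saff w - saff v - 2 * e * dot (z - v) (w - v) + t * (e * N)).
  have -> : t * (saff w - saff v - 2 * e * dot (z - v) (w - v) + t * (e * N)) =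
    e * dot ((1 - t) *: v + t *: w - z) ((1 - t) *: v + t *: w - z) +
    ((1 - t) * saff v + t * saff w) - (e * dot (v - z) (v - z) + saff v).
    rewrite /N !(dotDl, dotDr, dotZl, dotZr, dotNl, dotNr) (dotC w v) !(dotC z).
    by ring.
  by rewrite subr_ge0; apply: le_trans k2 _; rewrite lerD2l.
rewrite pmulr_rge0 //; apply/negP; rewrite -ltNge.
have : t * (e * N) < del; last by rewrite /del; lra.
by rewrite /t mulrAC ltr_pdivrMr // ltr_pM2l // ltrDr.
Qed.

End Prox.
End SupAffine.

(** * Conjugates of convex functions smooth along a projector *)

Section SmoothConjugate.
Context {R : realType} {d : nat}.
Variables (f : 'cV[R]_d -> R) (P : 'M[R]_d) (L : R).
Implicit Types (a x : 'cV[R]_d).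

(* Maximising [dot a (x + h) - f (x + h)] over [h] after replacing [f] by its
   quadratic upper model at [x] exhibits the conjugate minus its quadratic part
   as a supremum of affine functions. *)
Definition conj_slope x := x - L^-1 *: (P *m grad f x).
Definition conj_const x := (2 * L)^-1 * qnorm P (grad f x) - f x.
Definition conj_dom := saff_dom conj_slope conj_const.
Definition conj_val := saff conj_slope conj_const.
Definition conj_tilde a : \bar R := (fenchel f a - ((2 * L)^-1 * qnorm P a)%:E)%E.

Hypotheses (L0 : 0 < L) (Po : orth_projector P)
  (fconv : convex_function setT f) (fsm : smooth_wrt L P f).

Lemma proj_dot x y : dot (P *m x) y = dot x (P *m y).
Proof. by have [_ Pt] := Po; rewrite [in RHS]dot_mulmxr Pt. Qed.

Lemma orth_projK x : P *m (P *m x) = P *m x.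
Proof. by have [PP _] := Po; rewrite mulmxA PP. Qed.

Lemma dot_proj x y : dot (P *m x) (P *m y) = dot x (P *m y).
Proof. by rewrite proj_dot orth_projK. Qed.

Lemma smooth_ub x h : f (x + h) <= f x + dot (grad f x) (P *m h) + L / 2 * dot h (P *m h).
Proof.
have [_ /(_ (x + h) x)] := fsm; rewrite [x + h - x]addrAC subrr add0r.
rewrite qnorm_dot -[_^T *m P *m h]mulmxA -/(dot _ _); lra.
Qed.

Lemma conj_aff_le x a : exists y,
  aff conj_slope conj_const x a + (2 * L)^-1 * qnorm P a <= dot a y - f y.
Proof.
(* A maximizer of [dot a] minus the quadratic model at [x], reached by moving within the range of
   [P]. *)
exists (x + L^-1 *: (P *m (a - grad f x))).
have := smooth_ub x (L^-1 *: (P *m (a - grad f x))).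
rewrite /aff /conj_slope /conj_const !qnorm_dot -!scalemxAr !orth_projK.
set g := grad f x; set y := f _; set y0 := f x.
rewrite !mulmxBr !(dotDr, dotDl, dotZl, dotZr, dotNr, dotNl) !dot_proj.
rewrite !(dotC g (P *m a)) !(proj_dot a g).
set A := dot a (P *m a); set B := dot a (P *m g); set C := dot g (P *m g).
set G := dot a x => H; have Ln : L != 0 by rewrite gt_eqF.
rewrite -subr_ge0; rewrite -subr_ge0 in H; apply: le_trans H _.
rewrite le_eqVlt; apply/orP; left; apply/eqP; by field.
Qed.

(** The gap between the two sides is [|P (a - grad f x)|^2 / (2 L)]. *)
Lemma le_conj_aff x a :
  dot a x - f x - (2 * L)^-1 * qnorm P a <= aff conj_slope conj_const x a.
Proof.
have := dot_ge0 (P *m (a - grad f x)).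
rewrite /aff /conj_slope /conj_const !qnorm_dot; set g := grad f x; set y0 := f x.
rewrite !mulmxBr !(dotDr, dotDl, dotZl, dotZr, dotNr, dotNl) !dot_proj.
rewrite !(dotC g (P *m a)) !(proj_dot a g).
set A := dot a (P *m a); set B := dot a (P *m g); set C := dot g (P *m g).
set G := dot a x => H; have Ln : L != 0 by rewrite gt_eqF.
rewrite -subr_ge0; apply: le_trans (_ : 0 <= (2 * L)^-1 * (A - B - (B - C))) _.
  by apply: mulr_ge0; [rewrite invr_ge0 ltW // mulr_gt0|lra].
by rewrite le_eqVlt; apply/orP; left; apply/eqP; field.
Qed.

Lemma conj_tildeE a : conj_tilde a = esaff conj_slope conj_const a.
Proof.
apply/eqP; rewrite eq_le; apply/andP; split.
  rewrite /conj_tilde leeBlDr //; apply: ge_ereal_sup => _ [x _ <-].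
  apply: (@le_trans _ _ ((aff conj_slope conj_const x a)%:E
      + ((2 * L)^-1 * qnorm P a)%:E)%E).
    by rewrite -EFinD lee_fin -lerBlDr; apply: le_conj_aff.
  by apply: leeD => //; apply: ereal_sup_ubound; exists x.
apply: ge_ereal_sup => _ [x _ <-]; rewrite /conj_tilde leeBrDr // -EFinD.
have [y hy] := conj_aff_le x a.
apply: (@le_trans _ _ (dot a y - f y)%:E); first by rewrite lee_fin.
by apply: ereal_sup_ubound; exists y.
Qed.

Lemma fenchel_young a x : conj_dom a ->
  dot a x - f x <= conj_val a + (2 * L)^-1 * qnorm P a.
Proof.
move=> da; rewrite -lerBlDr; apply: le_trans (le_conj_aff x a) _.
exact: aff_le_saff.
Qed.

Lemma conj_grad_aff x y : aff conj_slope conj_const y (grad f x) <=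
  dot (grad f x) x - f x - (2 * L)^-1 * qnorm P (grad f x).
Proof.
rewrite lerBrDr; have [z hz] := conj_aff_le y (grad f x).
apply: le_trans hz _; have [df _] := fsm.
by have := convex_grad z fconv (df x); rewrite dotBr; lra.
Qed.

(** Gradients supply points of the domain: by convexity the supremum defining the conjugate at
    [grad f x] is attained at [x]. *)
Lemma conj_dom_grad x : conj_dom (grad f x).
Proof. exact: saff_dom_ub (conj_grad_aff x). Qed.

Lemma conj_val_grad x :
  conj_val (grad f x) + (2 * L)^-1 * qnorm P (grad f x) <= dot (grad f x) x - f x.
Proof. by rewrite -lerBrDr; apply: (saff_le 0); apply: conj_grad_aff. Qed.

Lemma smooth_ker x h : P *m h = 0 -> f (x + h) <= f x.
Proof. by move=> Ph; have := smooth_ub x h; rewrite Ph !dot0r; lra. Qed.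

(** Along the kernel of [P], [f] never exceeds its value at the origin, so a component of [a] in
    that kernel would make [dot a y - f y] unbounded in [y]. *)
Lemma conj_dom_proj a : conj_dom a -> P *m a = a.
Proof.
move=> da; set h := a - P *m a.
have Ph : P *m h = 0 by rewrite /h mulmxBr orth_projK subrr.
have hh : dot a h = dot h h.
  by rewrite {2}/h dotBl proj_dot Ph dot0r subr0.
suff /eqP : dot h h == 0 by move/eqP; rewrite dot_eq0 subr_eq0 => /eqP.
rewrite eq_le dot_ge0 andbT leNgt; apply/negP => hp.
set M := conj_val a + (2 * L)^-1 * qnorm P a - dot a 0 + f 0.
have key t : t * dot h h <= M.
  have := fenchel_young (0 + t *: h) da.
  have := @smooth_ker 0 (t *: h); rewrite -scalemxAr Ph scaler0 => /(_ erefl).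
  by rewrite dotDr dotZr hh /M; lra.
have := key ((M + 1) / dot h h); rewrite divfK ?gt_eqF //; lra.
Qed.

End SmoothConjugate.

(** * The augmented graph *)

Section Range.
Context {R : realType}.

(** The columns of [cokermx A] lie in the kernel of [A], and vanishing against all of them is the
    membership test for the row space. *)
Lemma perp_range p q (A : 'M[R]_(p, q)) (l : 'cV_q) :
  (forall k, A *m k = 0 -> dot k l = 0) -> exists y, l = A^T *m y.
Proof.
move=> h; have /submxP[y ly] : (l^T <= A)%MS.
  rewrite submxE; apply/eqP/matrixP => i j; rewrite ord1 [RHS]mxE.
  have /h : A *m col j (cokermx A) = 0.
    by rewrite colE mulmxA mulmx_coker mul0mx.
  by rewrite dotC /dot colE mulmxA -colE mxE.
by exists y^T; rewrite -trmx_mul -ly trmxK.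
Qed.

End Range.

(** * The matrix [A], the dual Hessian and the range of [A^T] *)

Section DualMatrices.
Context {R : realType} {n m E d : nat}.

Record admissible (D : instance R n m E d) : Prop := Admissible {
  adm_n : (1 < n)%N;
  adm_m : (0 < m)%N;
  adm_d : (0 < d)%N;
  adm_connected : connected_graph D;
  adm_sigma : forall i, 0 < sigma D i;
  adm_L : forall i j, 0 < Lsm D i j;
  adm_proj : forall i j, orth_projector (vproj D i j);
  adm_convex : forall i j, convex_function setT (fun_of D i j);
  adm_smooth : forall i j, smooth_wrt (Lsm D i j) (vproj D i j) (fun_of D i j);
  adm_mu_comm : forall e, 0 < mu_comm D e;
  adm_mu_virt : forall i j, 0 < mu_virt D i j;
  adm_mu_virtE : forall i j, mu_virt D i j ^+ 2 = alpha D * Lsm D i j }.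

Lemma sum_sum_ord (V : zmodType) (J : nat) (F : ('I_J + 'I_n * 'I_m)%type -> V) :
  \sum_k F k = \sum_i F (inl i) + \sum_i \sum_j F (inr (i, j)).
Proof. by rewrite big_sumType /= pair_bigA; congr (_ + _); apply: eq_bigr => -[]. Qed.

Variable D : instance R n m E d.
Hypothesis H : admissible D.
Local Notation A := (Amx D).
Local Notation Sg := (pseudo_inv (Sigma D)).
Local Notation P := (vproj D).

Lemma blk_A_comm (l : @bvec R (edge E n m) d) i : blk (A *m l) (inl i) =
  \sum_e Acomm D i e *: blk l (inl e) +
  \sum_j mu_virt D i j *: (P i j *m blk l (inr (i, j))).
Proof.
rewrite blk_mulmx sum_sum_ord; congr (_ + _).
  by apply: eq_bigr => e _; rewrite -scalemxAl mul1mx mxE.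
rewrite (bigD1 i) //= [X in _ + X]big1 ?addr0 => [|k ki].
  by apply: eq_bigr => j _; rewrite eqxx subr0 mulr1 -scalemxAl.
apply: big1 => j _; rewrite /= (_ : (inl i == inl k :> node n m) = false) ?subr0 ?mulr0 ?scale0r ?mul0mx //.
by apply: contraNF ki => /eqP[->].
Qed.

Lemma blk_A_virt (l : @bvec R (edge E n m) d) i j : blk (A *m l) (inr (i, j)) =
  - (mu_virt D i j *: (P i j *m blk l (inr (i, j)))).
Proof.
rewrite blk_mulmx sum_sum_ord big1 ?add0r => [|e _]; last first.
  by rewrite /= subr0 mulr0 scale0r mul0mx.
rewrite pair_bigA (bigD1 (i, j)) //= big1 ?addr0 => [|[k l'] kl].
  by rewrite eqxx sub0r mulrN1 -scalemxAl scaleNr.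
rewrite /= (_ : (inr (i, j) == inr (k, l') :> node n m) = false) ?subr0 ?mulr0 ?scale0r ?mul0mx //.
by apply: contraNF kl => /eqP[-> ->].
Qed.

Definition sigma_inv_blk (k : node n m) : 'M[R]_d :=
  match k with
  | inl i => ((sigma D i)^-1)%:M
  | inr ij => (Lsm D ij.1 ij.2)^-1 *: P ij.1 ij.2
  end.

Lemma SgE : Sg = blk_diag sigma_inv_blk.
Proof.
apply: (@pseudo_inv_blk_diag R _ _ (sigma_blk D)) => -[i|[i j]] /=.
  have s0 : sigma D i != 0 by rewrite gt_eqF ?(adm_sigma H).
  by split; rewrite -?scalar_mxM ?tr_scalar_mx ?mulfV ?mulVf ?mulrA ?mul1r // mul1r.
have L0 : Lsm D i j != 0 by rewrite gt_eqF ?(adm_L H).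
have [PP Pt] := adm_proj H i j.
have e1 : (Lsm D i j *: P i j) *m ((Lsm D i j)^-1 *: P i j) = P i j.
  by rewrite -scalemxAl -scalemxAr scalerA mulfV // scale1r PP.
have e2 : ((Lsm D i j)^-1 *: P i j) *m (Lsm D i j *: P i j) = P i j.
  by rewrite -scalemxAl -scalemxAr scalerA mulVf // scale1r PP.
by split; rewrite ?e1 ?e2 // -scalemxAr PP.
Qed.

Lemma blk_Sg_comm (y : @bvec R (node n m) d) i :
  blk (Sg *m y) (inl i) = (sigma D i)^-1 *: blk y (inl i).
Proof. by rewrite SgE blk_diag_mulmx mul_scalar_mx. Qed.

Lemma blk_Sg_virt (y : @bvec R (node n m) d) i j :
  blk (Sg *m y) (inr (i, j)) = (Lsm D i j)^-1 *: (P i j *m blk y (inr (i, j))).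
Proof. by rewrite SgE blk_diag_mulmx /= -scalemxAl. Qed.

Lemma tr_Sg : Sg^T = Sg.
Proof.
rewrite SgE tr_blk_diag; congr blk_diag; apply/funext => -[i|[i j]] /=.
  by rewrite tr_scalar_mx.
by rewrite linearZ /=; have [_ ->] := adm_proj H i j.
Qed.

(** The Hessian of the quadratic part of [FAstar]. *)
Definition Mq := A^T *m Sg *m A.

Lemma Mq_sym : Mq^T = Mq.
Proof. by rewrite /Mq !trmx_mul trmxK tr_Sg mulmxA. Qed.

Lemma Mq_mul (l : @bvec R (edge E n m) d) : Mq *m l = A^T *m (Sg *m (A *m l)).
Proof. by rewrite /Mq !mulmxA. Qed.

Lemma dot_Mq (l k : @bvec R (edge E n m) d) : dot k (Mq *m l) = dot (A *m k) (Sg *m (A *m l)).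
Proof. by rewrite Mq_mul dot_mulmxr trmxK. Qed.

Lemma dot_Sg (x y : @bvec R (node n m) d) : dot x (Sg *m y) =
  \sum_i (sigma D i)^-1 * dot (blk x (inl i)) (blk y (inl i)) +
  \sum_i \sum_j (Lsm D i j)^-1 * dot (P i j *m blk x (inr (i, j))) (P i j *m blk y (inr (i, j))).
Proof.
rewrite dot_blk sum_sum_ord; congr (_ + _).
  by apply: eq_bigr => i _; rewrite blk_Sg_comm dotZr.
apply: eq_bigr => i _; apply: eq_bigr => j _.
by rewrite blk_Sg_virt dotZr (dot_proj (adm_proj H i j)).
Qed.

Lemma dot_Sg_ge0 (x : @bvec R (node n m) d) : 0 <= dot x (Sg *m x).
Proof.
rewrite dot_Sg addr_ge0 //; apply: sumr_ge0 => i _.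
  by rewrite mulr_ge0 ?dot_ge0 // invr_ge0 ltW // (adm_sigma H).
apply: sumr_ge0 => j _.
by rewrite mulr_ge0 ?dot_ge0 // invr_ge0 ltW // (adm_L H).
Qed.

Lemma Mq_psd : psd Mq.
Proof. by move=> l; rewrite dot_Mq dot_Sg_ge0. Qed.

(** [Sg] is only semi-definite, but the virtual blocks of [A *m l] lie in the ranges of the
    projectors, where it is definite. *)
Lemma Sg_A_eq0 (l : @bvec R (edge E n m) d) : dot (A *m l) (Sg *m (A *m l)) = 0 -> A *m l = 0.
Proof.
rewrite dot_Sg => /eqP.
have h1 i : 0 <= (sigma D i)^-1 * dot (blk (A *m l) (inl i)) (blk (A *m l) (inl i)).
  by rewrite mulr_ge0 ?dot_ge0 // invr_ge0 ltW // (adm_sigma H).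
have h2 i j : 0 <= (Lsm D i j)^-1 * dot (P i j *m blk (A *m l) (inr (i, j))) (P i j *m blk (A *m l) (inr (i, j))).
  by rewrite mulr_ge0 ?dot_ge0 // invr_ge0 ltW // (adm_L H).
rewrite paddr_eq0; last 2 first.
- by apply: sumr_ge0 => i _.
- by apply: sumr_ge0 => i _; apply: sumr_ge0.
move=> /andP[]; rewrite psumr_eq0 // => /allP k1.
rewrite psumr_eq0; last by move=> i _; apply: sumr_ge0.
move=> /allP k2; apply: blk_inj => -[i|[i j]]; rewrite blk0.
  have := k1 i (mem_index_enum _).
  by rewrite mulf_eq0 invr_eq0 gt_eqF ?(adm_sigma H) //= dot_eq0 => /eqP.
have := k2 i (mem_index_enum _); rewrite psumr_eq0 // => /allP/(_ j (mem_index_enum _)).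
rewrite mulf_eq0 invr_eq0 gt_eqF ?(adm_L H) //= dot_eq0 blk_A_virt.
by rewrite mulmxN -scalemxAr (orth_projK (adm_proj H i j)) => /eqP.
Qed.

(** The range of [A^T], written as orthogonality to the kernel of [A]: in this form it passes
    through symmetric scalings that preserve the kernel. *)
Definition in_range (l : @bvec R (edge E n m) d) := forall k, A *m k = 0 -> dot k l = 0.

Lemma in_rangeD l k : in_range l -> in_range k -> in_range (l + k).
Proof. by move=> hl hk x Ax; rewrite dotDr hl // hk // addr0. Qed.

Lemma in_rangeZ a l : in_range l -> in_range (a *: l).
Proof. by move=> hl x Ax; rewrite dotZr hl // mulr0. Qed.

Lemma in_range0 : in_range 0.
Proof. by move=> x Ax; rewrite dot0r. Qed.

Lemma in_range_tr y : in_range (A^T *m y).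
Proof. by move=> k Ak; rewrite dot_mulmxr trmxK Ak dot0l. Qed.

(** By [Sg_A_eq0] the kernel of [Mq] is that of [A], so [l] lies in the range of [Mq]. *)
Lemma sigma_A_strong l : in_range l -> sigma_A D * dot l l <= dot l (Mq *m l).
Proof.
move=> hl; have [v ->] : exists v, l = Mq *m v.
  rewrite -{1}Mq_sym; apply: perp_range => k Mk; apply: hl; apply: Sg_A_eq0.
  by rewrite -dot_Mq Mk dot0r.
exact: lambda_minp_range Mq_sym Mq_psd.
Qed.

Lemma sigma_A_ge c : Mq != 0 -> (forall l, in_range l -> c * dot l l <= dot l (Mq *m l)) ->
  c <= sigma_A D.
Proof.
move=> M0 h; apply: lambda_minp_ge => //; first exact: Mq_sym.
by move=> v; apply: h; rewrite Mq_mul; apply: in_range_tr.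
Qed.

End DualMatrices.

(** * Weighted Gram matrices and the inequalities that decouple a node from its virtual edges *)

Section Weighted.
Context {R : realType}.

Lemma lambda_max_gt0 n (M : 'M[R]_n) : M^T = M -> psd M -> M != 0 -> 0 < lambda_max M.
Proof.
move=> Ms Mp M0; have [a ea a0] := sym_eigenvalue_neq0 Ms M0.
apply: lt_le_trans (lambda_max_ub Ms ea).
by rewrite lt_def a0 (eigenvalue_psd Ms Mp).
Qed.

Lemma invmx_diag n (r : 'rV[R]_n) : (forall i, r 0 i != 0) ->
  invmx (diag_mx r) = diag_mx (\row_i (r 0 i)^-1).
Proof.
move=> r0; have h : diag_mx r *m diag_mx (\row_i (r 0 i)^-1) = 1%:M.
  rewrite mulmx_diag; apply/matrixP => i j; rewrite !mxE mulfV //.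
by have [u _] := mulmx1_unit h; rewrite -[LHS]mulmx1 -h mulKmx.
Qed.

Variables (p q : nat) (A : 'M[R]_(p, q)) (w : 'rV[R]_p).
Hypothesis w0 : forall i, 0 < w 0 i.
Definition weighted := A^T *m diag_mx w *m A.

Lemma weighted_sym : weighted^T = weighted.
Proof. by rewrite /weighted !trmx_mul trmxK tr_diag_mx mulmxA. Qed.

Lemma dot_weighted (x : 'cV_q) : dot x (weighted *m x) = \sum_i w 0 i * (A *m x) i 0 ^+ 2.
Proof.
rewrite /weighted -!mulmxA dot_mulmxr trmxK dotE; apply: eq_bigr => i _.
by rewrite mul_diag_mx [X in _ * X]mxE mulrCA expr2.
Qed.

Lemma weighted_psd : psd weighted.
Proof.
by move=> x; rewrite dot_weighted; apply: sumr_ge0 => i _; rewrite mulr_ge0 ?sqr_ge0 // ltW.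
Qed.

Lemma weighted_ker (x : 'cV_q) : weighted *m x = 0 -> A *m x = 0.
Proof.
move=> wx; have := dot_weighted x; rewrite wx dot0r => /esym/eqP.
rewrite psumr_eq0 => [/allP h|i _]; last by rewrite mulr_ge0 ?sqr_ge0 // ltW.
apply/matrixP => i j; rewrite ord1 [RHS]mxE.
have := h i (mem_index_enum _).
by rewrite mulf_eq0 gt_eqF //= expf_eq0 => /eqP.
Qed.

Lemma weighted_neq0 : A != 0 -> weighted != 0.
Proof.
apply: contra_neq => w00; apply: mulmx_ext => x; rewrite mul0mx.
by apply: weighted_ker; rewrite w00 mul0mx.
Qed.

Lemma weighted_minp (x : 'cV_q) : (forall k : 'cV_q, A *m k = 0 -> dot k x = 0) ->
  lambda_minp weighted * dot x x <= dot x (weighted *m x).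
Proof.
move=> hx; have [v ->] : exists v, x = weighted *m v.
  rewrite -{1}weighted_sym; apply: perp_range => k wk.
  by apply: hx; apply: weighted_ker.
exact: lambda_minp_range weighted_sym weighted_psd.
Qed.

(** Joint convexity of [|x|^2 / s]: splitting [a] as [(a + v) - v] gives [|a|^2 / (s + r) <= |a +
    v|^2 / s + |v|^2 / r]. *)
Lemma node_ineq d (a v : 'cV[R]_d) s r t : 0 < s -> 0 <= r -> 0 <= t ->
  dot v v <= r * t -> (s + r)^-1 * dot a a <= s^-1 * dot (a + v) (a + v) + t.
Proof.
move=> s0 r0 t0 vrt; have sr : 0 < s + r by rewrite ltr_pwDl.
have [rz|rn] := eqVneq r 0.
  have /eqP : dot v v = 0.
    by apply/eqP; rewrite eq_le dot_ge0 andbT (le_trans vrt) // rz mul0r.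
  by rewrite dot_eq0 rz addr0 => /eqP ->; rewrite addr0; lra.
have rp : 0 < r by rewrite lt_def rn.
(* This square is exactly the defect of that inequality multiplied by [(s + r) s r]. *)
have := dot_ge0 (r *: a + (s + r) *: v).
rewrite !(dotDl, dotDr, dotZl, dotZr) (dotC v a).
move: (dot a a) (dot a v) (dot v v) vrt => x y z vrt hx.
rewrite -(ler_pM2l (_ : 0 < (s + r) * s * r)); last by rewrite !mulr_gt0.
have -> : (s + r) * s * r * ((s + r)^-1 * x) = s * r * x.
  by field; rewrite gt_eqF.
have -> : (s + r) * s * r * (s^-1 * (x + y + (y + z)) + t) =
   (s + r) * r * (x + y + (y + z)) + (s + r) * s * (r * t).
  by field; rewrite gt_eqF.
have : (s + r) * s * z <= (s + r) * s * (r * t) by rewrite ler_pM2l // mulr_gt0.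
nra.
Qed.

(** Expand [dot v v] as the sum of [mu j * dot (P j *m v) (u j)] and apply Young's inequality with a
    free parameter [c]; since [mu j ^+ 2 = al * L j], the terms in [v] add up to [al] times the
    quadratic form bounded by [lambda_max]. *)
Lemma sum_proj_bound d m (P : 'I_m -> 'M[R]_d) (L : 'I_m -> R) (mu : 'I_m -> R)
   (u : 'I_m -> 'cV[R]_d) al :
  (forall j, orth_projector (P j)) -> (forall j, 0 < L j) -> 0 <= al ->
  (forall j, mu j ^+ 2 = al * L j) ->
  let v := \sum_j mu j *: (P j *m u j) in
  0 <= lambda_max (\sum_j L j *: P j) ->
  dot v v <= lambda_max (\sum_j L j *: P j) * (al * \sum_j dot (u j) (u j)).
Proof.
move=> Po L0 al0 muE v; set lam := lambda_max _ => lam0.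
set U := \sum_j dot (u j) (u j).
have U0 : 0 <= U by apply: sumr_ge0 => j _; exact: dot_ge0.
have W0 := dot_ge0 v; set W := dot v v in W0 *.
have hlam : \sum_j L j * dot (P j *m v) (P j *m v) <= lam * W.
  have Ss : (\sum_j L j *: P j)^T = \sum_j L j *: P j.
    rewrite linear_sum; apply: eq_bigr => j _ /=.
    by rewrite linearZ /=; have [_ ->] := Po j.
  have := lambda_max_dot v Ss; rewrite mulmx_suml dot_sumr.
  under eq_bigr do rewrite -scalemxAl dotZr.
  by under [X in X <= _ -> _]eq_bigr => j _ do rewrite -(dot_proj (Po j)).
have key c : 0 < c -> W <= c / 2 * (al * (lam * W)) + (2 * c)^-1 * U.
  move=> c0; rewrite {1}/W {2}/v dot_sumr.
  apply: (@le_trans _ _ (\sum_j (c / 2 * (al * (L j * dot (P j *m v) (P j *m v)))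
     + (2 * c)^-1 * dot (u j) (u j)))); last first.
    rewrite big_split /= -!mulr_sumr lerD2r ler_pM2l ?divr_gt0 //.
    exact: ler_wpM2l.
  apply: ler_sum => j _; rewrite dotZr -(proj_dot (Po j)) [al * (L j * _)]mulrA -muE.
  have := dot_ge0 ((c * mu j) *: (P j *m v) - u j).
  rewrite !(dotDl, dotDr, dotZl, dotZr, dotNl, dotNr) (dotC (u j)).
  move: (dot (P j *m v) (P j *m v)) (dot (P j *m v) (u j)) (dot (u j) (u j)) => x y z.
  move=> h; rewrite -(ler_pM2l (_ : 0 < 2 * c)) ?mulr_gt0 //.
  have -> : 2 * c * (c / 2 * (mu j ^+ 2 * x) + (2 * c)^-1 * z) = c ^+ 2 * mu j ^+ 2 * x + z.
    by field; rewrite gt_eqF.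
  by nra.
(* The optimal [c] is the inverse of [al * lam]. If that product is 0, a large [c] forces
   [W = 0]. *)
have [lz|ln] := eqVneq (al * lam) 0.
  rewrite mulrA (mulrC lam) lz mul0r.
  rewrite leNgt; apply/negP => Wp.
  have := key ((U + 1) / W) (divr_gt0 (ltr_wpDl U0 ltr01) Wp).
  rewrite (mulrA al) lz mul0r mulr0 add0r.
  have -> : (2 * ((U + 1) / W))^-1 * U = (W * U) / (2 * (U + 1)).
    by field; rewrite !gt_eqF // ltr_wpDl.
  by rewrite ler_pdivlMr ?mulr_gt0 ?ltr_wpDl //; nra.
have lp : 0 < al * lam by rewrite lt_def ln mulr_ge0.
have := key (al * lam)^-1; rewrite invr_gt0 => /(_ lp).
have -> : (al * lam)^-1 / 2 * (al * (lam * W)) = W / 2.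
  by field; move: ln; rewrite mulf_eq0 negb_or => /andP[-> ->].
have -> : (2 / (al * lam))^-1 * U = lam * (al * U) / 2.
  by field; move: ln; rewrite mulf_eq0 negb_or => /andP[-> ->].
lra.
Qed.

End Weighted.

(** * Spectral constants of the communication graph *)

Section CommunicationGraph.
Context {R : realType} {n m E d : nat}.
Variable D : instance R n m E d.
Hypothesis H : admissible D.
Local Notation A := (Amx D).
Local Notation Ac := (Acomm D).
Local Notation P := (vproj D).

Lemma tr_Acomm_mul (x : 'cV[R]_n) e :
  (Ac^T *m x) e 0 = mu_comm D e * (x (esrc D e) 0 - x (edst D e) 0).
Proof.
rewrite mxE.
transitivity (mu_comm D e * (\sum_i (i == esrc D e)%:R * x i 0 -
    \sum_i (i == edst D e)%:R * x i 0)).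
  rewrite -sumrB mulr_sumr; apply: eq_bigr => i _.
  by rewrite !mxE -mulrA mulrBl.
have delta k : \sum_i (i == k)%:R * x i 0 = x k 0.
  rewrite (bigD1 k) //= eqxx mul1r big1 ?addr0 // => i /negPf ->.
  by rewrite mul0r.
by rewrite !delta.
Qed.

(** Connectedness enters here: values that agree across every edge propagate along paths. *)
Lemma Acomm_ker (x : 'cV[R]_n) : Ac^T *m x = 0 -> forall i j, x i 0 = x j 0.
Proof.
move=> Ax i j.
have edge_eq e : x (esrc D e) 0 = x (edst D e) 0.
  have := tr_Acomm_mul x e; rewrite Ax mxE => /esym/eqP.
  by rewrite mulf_eq0 gt_eqF ?(adm_mu_comm H) //= subr_eq0 => /eqP.
have adj_eq k l : adj D k l -> x k 0 = x l 0.
  by move=> /existsP[e /orP[]] /andP[/eqP <- /eqP <-]; rewrite edge_eq.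
have /connectP[s] := adm_connected H i j.
elim: s i => [|k s IH] i /=; first by move=> _ ->.
by move=> /andP[/adj_eq -> /IH]; apply.
Qed.

Lemma Acomm_neq0 : Ac != 0.
Proof.
apply/eqP => A0; have n0 : (0 < n)%N by apply: ltn_trans (adm_n H).
have := @Acomm_ker (delta_mx (Ordinal n0) 0).
rewrite A0 trmx0 mul0mx => /(_ erefl (Ordinal n0) (Ordinal (adm_n H))).
by rewrite !mxE !eqxx /= => /eqP; rewrite oner_eq0.
Qed.

(** The kernel of [Acomm^T] consists of constants, so a zero sum is the only solvability condition;
    it is tested on each coordinate, that is on each row of [Hm]. *)
Lemma Acomm_solve (h : 'I_n -> 'cV[R]_d) : \sum_i h i = 0 ->
  exists c : 'I_E -> 'cV[R]_d, forall i, \sum_e Ac i e *: c e = h i.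
Proof.
move=> h0; pose Hm := \matrix_(a, i) h i a 0 : 'M[R]_(d, n).
have /submxP[C HC] : (Hm <= Ac^T)%MS.
  rewrite submxE; apply/eqP/matrixP => a j; rewrite [RHS]mxE.
  have Ak : Ac^T *m col j (cokermx Ac^T) = 0.
    by rewrite colE mulmxA mulmx_coker mul0mx.
  have n0 : (0 < n)%N by apply: ltn_trans (adm_n H).
  have cst := Acomm_ker Ak; rewrite mxE.
  transitivity ((\sum_i h i a 0) * col j (cokermx Ac^T) (Ordinal n0) 0).
    rewrite mulr_suml; apply: eq_bigr => i _; rewrite !mxE; congr (_ * _).
    by have := cst i (Ordinal n0); rewrite !mxE.
  by rewrite -summxE h0 mxE mul0r.
exists (fun e => col e C) => i; apply/matrixP => a b; rewrite ord1 summxE.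
have := congr1 (fun M : 'M[R]_(d, n) => M a i) HC; rewrite !mxE => ->.
by apply: eq_bigr => e _; rewrite !mxE mulrC.
Qed.

Definition DMi i := sigma D i + 2 * lambda_max (\sum_(j < m) Lsm D i j *: P i j).

Lemma LP_sym i : (\sum_(j < m) Lsm D i j *: P i j)^T = \sum_(j < m) Lsm D i j *: P i j.
Proof.
rewrite linear_sum; apply: eq_bigr => j _ /=.
by rewrite linearZ /=; have [_ ->] := adm_proj H i j.
Qed.

Lemma LP_ge0 i : 0 <= lambda_max (\sum_(j < m) Lsm D i j *: P i j).
Proof.
apply: lambda_max_ge0 (adm_d H) (LP_sym i) _ => x.
rewrite mulmx_suml dot_sumr; apply: sumr_ge0 => j _.
rewrite -scalemxAl dotZr -(dot_proj (adm_proj H i j)).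
by rewrite mulr_ge0 ?dot_ge0 // ltW // (adm_L H).
Qed.

Lemma DMi_ge i : sigma D i <= DMi i.
Proof. by rewrite lerDl mulr_ge0 // LP_ge0. Qed.

Lemma DMi_gt0 i : 0 < DMi i.
Proof. exact: lt_le_trans (adm_sigma H i) (DMi_ge i). Qed.

Definition wM := \row_i (DMi i)^-1.
Definition wS := \row_i (sigma D i)^-1.

Lemma wM_gt0 i : 0 < wM 0 i.
Proof. by rewrite mxE invr_gt0 DMi_gt0. Qed.

Lemma wS_gt0 i : 0 < wS 0 i.
Proof. by rewrite mxE invr_gt0 (adm_sigma H). Qed.

Lemma DM_weighted : Ac^T *m invmx (DM_tilde D) *m Ac = weighted Ac wM.
Proof.
rewrite /DM_tilde invmx_diag => [|i]; last by rewrite mxE gt_eqF // DMi_gt0.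
by rewrite /weighted; congr (mulmx (mulmx _ (diag_mx _)) _); apply/rowP => i; rewrite !mxE.
Qed.

Lemma Sigma_weighted : Ac^T *m invmx (Sigma_comm D) *m Ac = weighted Ac wS.
Proof.
rewrite /Sigma_comm invmx_diag => [|i]; last by rewrite mxE gt_eqF // (adm_sigma H).
by rewrite /weighted; congr (mulmx (mulmx _ (diag_mx _)) _); apply/rowP => i; rewrite !mxE.
Qed.

Definition delta := lambda_minp (weighted Ac wM).

Lemma alphaE : alpha D = 2 * delta.
Proof. by rewrite /alpha DM_weighted. Qed.

Lemma delta_gt0 : 0 < delta.
Proof.
apply: lambda_minp_gt0; [exact: weighted_sym|exact: weighted_psd wM_gt0|].
exact: (weighted_neq0 wM_gt0 Acomm_neq0).
Qed.

Definition comm_part (l : @bvec R (edge E n m) d) i : 'cV[R]_d :=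
  \sum_e Ac i e *: blk l (inl e).

Definition virt_part (l : @bvec R (edge E n m) d) i : 'cV[R]_d :=
  \sum_j mu_virt D i j *: (P i j *m blk l (inr (i, j))).

(* Testing against kernel vectors of the form [k (x) e_a] reduces the claim to
   the scalar matrix [Acomm], coordinate by coordinate. *)
Lemma comm_minp (w : 'rV[R]_n) (l : @bvec R (edge E n m) d) : (forall i, 0 < w 0 i) -> in_range D l ->
  lambda_minp (weighted Ac w) * \sum_e dot (blk l (inl e)) (blk l (inl e)) <=
  \sum_i w 0 i * dot (comm_part l i) (comm_part l i).
Proof.
move=> w0 hl; pose x a : 'cV[R]_E := \col_e blk l (inl e) a 0.
have -> : \sum_e dot (blk l (inl e)) (blk l (inl e)) = \sum_a dot (x a) (x a).
  under eq_bigr do rewrite dotE; rewrite exchange_big /=; apply: eq_bigr => a _.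
  by rewrite dotE; apply: eq_bigr => e _; rewrite [x a e 0]mxE.
have -> : \sum_i w 0 i * dot (comm_part l i) (comm_part l i) =
    \sum_a dot (x a) (weighted Ac w *m x a).
  under eq_bigr do rewrite dotE mulr_sumr; rewrite exchange_big /=.
  apply: eq_bigr => a _; rewrite dot_weighted; apply: eq_bigr => i _.
  rewrite expr2; congr (_ * (_ * _)); rewrite summxE mxE;
    by apply: eq_bigr => e _; rewrite mxE [x a e 0]mxE.
rewrite mulr_sumr; apply: ler_sum => a _; apply: weighted_minp => // k Ak.
pose K : @bvec R (edge E n m) d := of_blks (fun e => match e with
  | inl e => k e 0 *: delta_mx a 0 | inr _ => 0 end).
have AK : A *m K = 0.
  apply: blk_inj => -[i|[i j]]; rewrite blk0; last first.
    by rewrite blk_A_virt of_blksK mulmx0 scaler0 oppr0.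
  rewrite blk_A_comm [X in _ + X]big1 ?addr0 => [|j _]; last first.
    by rewrite of_blksK mulmx0 scaler0.
  under eq_bigr do rewrite of_blksK scalerA.
  rewrite -scaler_suml.
  have -> : \sum_e Ac i e * k e 0 = (Ac *m k) i 0 by rewrite mxE.
  by rewrite Ak mxE scale0r.
have := hl _ AK; rewrite dot_blk sum_sum_ord [X in _ + X]big1 ?addr0 => [|i _]; last first.
  by rewrite big1 // => j _; rewrite of_blksK dot0l.
move=> <-; rewrite dotE; apply: eq_bigr => e _; rewrite of_blksK dotZl mxE; congr (_ * _).
rewrite dotE (bigD1 a) //= !mxE !eqxx mul1r big1 ?addr0 // => b ba.
by rewrite mxE (negPf ba) mul0r.
Qed.

Lemma comm_max (w : 'rV[R]_n) (l : @bvec R (edge E n m) d) :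
  \sum_i w 0 i * dot (comm_part l i) (comm_part l i) <=
  lambda_max (weighted Ac w) * \sum_e dot (blk l (inl e)) (blk l (inl e)).
Proof.
pose x a : 'cV[R]_E := \col_e blk l (inl e) a 0.
have -> : \sum_e dot (blk l (inl e)) (blk l (inl e)) = \sum_a dot (x a) (x a).
  under eq_bigr do rewrite dotE; rewrite exchange_big /=; apply: eq_bigr => a _.
  by rewrite dotE; apply: eq_bigr => e _; rewrite [x a e 0]mxE.
have -> : \sum_i w 0 i * dot (comm_part l i) (comm_part l i) =
    \sum_a dot (x a) (weighted Ac w *m x a).
  under eq_bigr do rewrite dotE mulr_sumr; rewrite exchange_big /=.
  apply: eq_bigr => a _; rewrite dot_weighted; apply: eq_bigr => i _.
  rewrite expr2; congr (_ * (_ * _)); rewrite summxE mxE;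
    by apply: eq_bigr => e _; rewrite mxE [x a e 0]mxE.
by rewrite mulr_sumr; apply: ler_sum => a _; apply: lambda_max_dot (weighted_sym _ _).
Qed.

(** The weights [mu^2 = alpha * L] cancel the factors [1 / L], so all virtual edges get the same
    coefficient [alpha]. *)
Lemma dot_MqE (l : @bvec R (edge E n m) d) : dot l (Mq D *m l) =
  \sum_i (sigma D i)^-1 * dot (comm_part l i + virt_part l i) (comm_part l i + virt_part l i) +
  \sum_i \sum_j alpha D * dot (P i j *m blk l (inr (i, j))) (P i j *m blk l (inr (i, j))).
Proof.
rewrite dot_Mq // dot_Sg //; congr (_ + _).
  by apply: eq_bigr => i _; rewrite blk_A_comm.
apply: eq_bigr => i _; apply: eq_bigr => j _.
rewrite blk_A_virt mulmxN -scalemxAr (orth_projK (adm_proj H i j)).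
rewrite dotNl dotNr opprK dotZl dotZr mulrA -expr2 (adm_mu_virtE H) mulrA.
by congr (_ * _); rewrite mulrC mulfK // gt_eqF // (adm_L H).
Qed.

(** The component of a virtual block outside the range of [P i j], placed alone on its edge, is in
    the kernel of [A]. *)
Lemma in_range_virt l i j : in_range D l -> P i j *m blk l (inr (i, j)) = blk l (inr (i, j)).
Proof.
move=> hl; set u := blk l _; set h := u - P i j *m u.
have Ph : P i j *m h = 0 by rewrite /h mulmxBr (orth_projK (adm_proj H i j)) subrr.
pose K : @bvec R (edge E n m) d := of_blks (fun e => if e == inr (i, j) then h else 0).
have bK k e : vproj D k e *m blk K (inr (k, e)) = 0.
  by rewrite of_blksK; case: eqP => [[-> ->]//|_]; rewrite mulmx0.
have /hl : A *m K = 0.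
  apply: blk_inj => -[k|[k e]]; rewrite blk0.
    rewrite blk_A_comm !big1 ?addr0 // => e _; first by rewrite bK scaler0.
    by rewrite of_blksK scaler0.
  by rewrite blk_A_virt bK scaler0 oppr0.
rewrite dot_blk (bigD1 (inr (i, j))) //= big1 ?addr0 => [|e ei]; last first.
  by rewrite of_blksK (negPf ei) dot0l.
rewrite of_blksK eqxx -/u => hu.
have /eqP : dot h h = 0.
  by rewrite {2}/h dotBr hu -(proj_dot (adm_proj H i j)) Ph dot0l subrr.
by rewrite dot_eq0 subr_eq0 => /eqP.
Qed.

Lemma Mq_neq0 : Mq D != 0.
Proof.
apply/eqP => M0; have /eqP := Acomm_neq0; apply; apply/matrixP => i e; rewrite [RHS]mxE.
pose l : @bvec R (edge E n m) d := of_blks (fun k => if k == inl e then const_mx 1 else 0).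
have /(congr1 (fun x => blk x (inl i))) : A *m l = 0.
  by apply: (Sg_A_eq0 H); rewrite -dot_Mq // M0 mul0mx dot0r.
rewrite blk0 blk_A_comm [X in _ + X]big1 ?addr0 => [|j _]; last first.
  by rewrite of_blksK mulmx0 scaler0.
rewrite (bigD1 e) //= of_blksK eqxx big1 ?addr0 => [|k ke]; last first.
  by rewrite of_blksK (_ : (inl k == inl e) = false) ?scaler0 //; apply/negbTE.
move: (Ac i e) => a /matrixP/(_ (Ordinal (adm_d H)) 0).
by rewrite !mxE mulr1.
Qed.

(** [node_ineq] is used with [r = 2 * lambda_max] and [t = delta * U i], where [U i] is the squared
    norm of the virtual blocks at [i]. As [alpha = 2 * delta], one [delta * U i] pays for [t] and
    the other is the strong convexity of the virtual blocks. *)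
Lemma sigma_A_ge_delta : delta <= sigma_A D.
Proof.
apply: (sigma_A_ge H Mq_neq0) => l hl; rewrite dot_MqE dot_blk sum_sum_ord mulrDr.
pose U i := \sum_j dot (blk l (inr (i, j))) (blk l (inr (i, j))).
have U0 i : 0 <= U i by apply: sumr_ge0 => j _; exact: dot_ge0.
have d0 := delta_gt0.
have h1 : \sum_i wM 0 i * dot (comm_part l i) (comm_part l i) <=
    \sum_i ((sigma D i)^-1 * dot (comm_part l i + virt_part l i) (comm_part l i + virt_part l i)
      + delta * U i).
  apply: ler_sum => i _; rewrite mxE; apply: node_ineq (adm_sigma H i) _ _ _.
  - by rewrite mulr_ge0 // LP_ge0.
  - by rewrite mulr_ge0 // ltW.
  have a0 : 0 <= alpha D by rewrite alphaE mulr_ge0 // ltW.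
  have hb : dot (virt_part l i) (virt_part l i) <=
      lambda_max (\sum_(j < m) Lsm D i j *: P i j) * (alpha D * U i).
    exact: (sum_proj_bound (fun j => blk l (inr (i, j)))
      (adm_proj H i) (adm_L H i) a0 (adm_mu_virtE H i) (LP_ge0 i)).
  apply: le_trans hb _; rewrite alphaE.
  by rewrite le_eqVlt; apply/orP; left; apply/eqP; ring.
have h2 := comm_minp wM_gt0 hl; rewrite -/delta in h2.
apply: le_trans (lerD (le_trans h2 h1) (lexx _)) _.
rewrite big_split /= -addrA lerD2l mulr_sumr -big_split /=.
apply: ler_sum => i _; rewrite -mulrDr -mulr_sumr alphaE.
under [X in _ <= _ * X]eq_bigr => j _ do rewrite (in_range_virt _ _ hl).
by rewrite -/(U i) le_eqVlt; apply/orP; left; apply/eqP; ring.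
Qed.

Lemma E_gt0 : (0 < E)%N.
Proof.
rewrite lt0n; apply/eqP => E0; case/eqP: Acomm_neq0.
by apply/matrixP => i e; have := ltn_ord e; rewrite {2}E0.
Qed.

Definition lamS := lambda_max (weighted Ac wS).

Lemma lamS_gt0 : 0 < lamS.
Proof.
apply: lambda_max_gt0; [exact: weighted_sym|exact: weighted_psd wS_gt0|].
exact: (weighted_neq0 wS_gt0 Acomm_neq0).
Qed.

(** [A A^T] and [A^T A] share their extreme nonzero eigenvalues, so the normalizations in
    [kappa_comm] cancel [gamma]. *)
Lemma gamma_kappaE : gamma D / kappa_comm D = delta / lamS.
Proof.
rewrite /gamma /kappa_comm DM_weighted Sigma_weighted -/delta -/lamS.
rewrite lambda_minp_mul_tr lambda_max_mul_tr ?E_gt0 //; last exact: ltn_trans (adm_n H).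
have AA : Ac^T *m Ac != 0.
  apply: contra Acomm_neq0 => /eqP AA; rewrite -[Ac]mulmx1.
  by apply/eqP; apply: tr_mul_inj; rewrite mulmx1.
have m1 := lambda_minp_gt0 (tr_mul_sym Ac) (tr_mul_psd Ac) AA.
have m2 := lambda_max_gt0 (tr_mul_sym Ac) (tr_mul_psd Ac) AA.
have m3 := delta_gt0; have m4 := lamS_gt0.
move: delta lamS (lambda_minp _) (lambda_max _) m1 m2 m3 m4 => a b x y *.
by field; rewrite !gt_eqF.
Qed.

(** The weights [wM] are below [wS], and a nonzero eigenvalue for [wM] separates the two constants.
    This yields [gk_le1], hence [rho <= pcomm]. *)
Lemma delta_le_lamS : delta <= lamS.
Proof.
rewrite /delta /lamS.
have [a ea a0] := sym_eigenvalue_neq0 (weighted_sym Ac wM) (weighted_neq0 wM_gt0 Acomm_neq0).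
apply: le_trans (lambda_minp_le (weighted_sym Ac wM) (@weighted_psd _ _ _ Ac _ wM_gt0) ea a0) _.
apply: le_trans (lambda_max_ub (weighted_sym Ac wM) ea) _.
apply: lambda_max_le; [exact: E_gt0|exact: weighted_sym|] => x.
apply: le_trans (lambda_max_dot x (weighted_sym Ac wS)).
rewrite !dot_weighted; apply: ler_sum => i _; apply: ler_wpM2r; first exact: sqr_ge0.
by rewrite !mxE lef_pV2 ?posrE ?DMi_gt0 ?(adm_sigma H) // DMi_ge.
Qed.

End CommunicationGraph.

(** * Step size and sampling probabilities *)

Section StepSize.
Context {R : realType} {n m E d : nat}.
Variable D : instance R n m E d.
Hypothesis H : admissible D.
Local Notation P := (vproj D).
Local Notation Mk := (m%:R + Num.sqrt (m%:R * kappa_s D)).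
Variables (pcomm rho : R).
Hypothesis pcommE : pcomm = (1 + Num.sqrt (2 * gamma D / kappa_comm D) * Mk)^-1.
Hypothesis rho_gt0 : 0 < rho.
Hypothesis rhoE : rho ^+ 2 =
     Num.min (gamma D / kappa_comm D * pcomm ^+ 2)
             ((1 - pcomm) ^+ 2 / (2 * Mk ^+ 2)).

Local Notation g := (gamma D / kappa_comm D).

Lemma gk_gt0 : 0 < g.
Proof. by rewrite gamma_kappaE // divr_gt0 ?delta_gt0 ?lamS_gt0. Qed.

Lemma gk_le1 : g <= 1.
Proof. by rewrite gamma_kappaE // ler_pdivrMr ?lamS_gt0 // mul1r delta_le_lamS. Qed.

Lemma Mk_gt0 : 0 < Mk.
Proof. by rewrite ltr_pwDl ?sqrtr_ge0 // ltr0n (adm_m H). Qed.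

Lemma pcomm_gt0 : 0 < pcomm.
Proof.
by rewrite pcommE invr_gt0 ltr_pwDl // mulr_ge0 ?sqrtr_ge0 // ltW // Mk_gt0.
Qed.

Lemma sqrt2gk : Num.sqrt (2 * gamma D / kappa_comm D) = Num.sqrt 2 * Num.sqrt g.
Proof. by rewrite -mulrA sqrtrM. Qed.

Lemma pcompE : 1 - pcomm = pcomm * (Num.sqrt 2 * Num.sqrt g * Mk).
Proof.
have p0 := pcomm_gt0; have Mg := Mk_gt0.
have q0 : 0 <= Num.sqrt 2 * Num.sqrt g by rewrite mulr_ge0 ?sqrtr_ge0.
rewrite pcommE sqrt2gk; move: (Num.sqrt 2 * Num.sqrt g) Mk q0 Mg => a M a0 M0.
by field; rewrite gt_eqF // ltr_pwDl // mulr_ge0 // ltW.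
Qed.

Lemma rho_sqr : rho ^+ 2 = g * pcomm ^+ 2.
Proof.
rewrite rhoE pcompE !exprMn sqr_sqrtr // sqr_sqrtr ?(ltW gk_gt0) //.
have -> : pcomm ^+ 2 * (2 * g * Mk ^+ 2) / (2 * Mk ^+ 2) = g * pcomm ^+ 2.
  by move: Mk g Mk_gt0 => M x M0; field; rewrite gt_eqF.
exact: minxx.
Qed.

Lemma rho_comm : rho = pcomm * Num.sqrt g.
Proof.
have pg : 0 <= pcomm * Num.sqrt g by rewrite mulr_ge0 ?sqrtr_ge0 // ltW // pcomm_gt0.
apply/eqP; rewrite -(@eqrXn2 _ 2 _ _ isT (ltW rho_gt0) pg); apply/eqP.
by rewrite rho_sqr exprMn sqr_sqrtr ?(ltW gk_gt0) // mulrC.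
Qed.

Lemma rho_comp : rho * (Num.sqrt 2 * Mk) = 1 - pcomm.
Proof. by rewrite pcompE rho_comm; ring. Qed.

Lemma pcomp_gt0 : 0 < 1 - pcomm.
Proof. by rewrite -rho_comp !mulr_gt0 ?sqrtr_gt0 // Mk_gt0. Qed.

Lemma sum_sqr_le (b : 'I_m -> R) : (\sum_j b j) ^+ 2 <= m%:R * \sum_j b j ^+ 2.
Proof.
set S := \sum_j b j; have m0 : 0 < m%:R :> R by rewrite ltr0n (adm_m H).
(* Sum of [2 b c <= b^2 + c^2] with [c] the mean of the [b j]. *)
have : \sum_j (2 * (S / m%:R)) * b j <= \sum_j (b j ^+ 2 + (S / m%:R) ^+ 2).
  apply: ler_sum => j _; move: (S / m%:R) => c.
  by have := sqr_ge0 (b j - c); rewrite sqrrB mulr2n; lra.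
rewrite -mulr_sumr -/S big_split /= sumr_const card_ord -[_ ^+ 2 *+ _]mulr_natr.
rewrite -(ler_pM2l m0) mulrDr -lerBlDr.
have -> : m%:R * (2 * (S / m%:R) * S) - m%:R * ((S / m%:R) ^+ 2 * m%:R) = S ^+ 2.
  by field; rewrite gt_eqF.
by [].
Qed.

Lemma Lsig_ge0 i j : 0 <= Lsm D i j * (sigma D i)^-1.
Proof. by rewrite mulr_ge0 ?invr_ge0 // ltW ?(adm_L H) ?(adm_sigma H). Qed.

(** By Cauchy-Schwarz [S_i^2] is at most [m^2 + m * s] with [s] the sum of the [L / sigma]; as
    [s <= kappa_s], this is below [(m + sqrt (m * kappa_s))^2]. *)
Lemma S_le i : S_ D i <= Mk.
Proof.
have m0 : 0 <= m%:R :> R by [].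
have ks : 1 + (sigma D i)^-1 * \sum_(j < m) Lsm D i j <= kappa_s D.
  by rewrite /kappa_s (bigD1 i) //= le_max lexx.
have ks0 : 0 <= kappa_s D.
  apply: le_trans ks; rewrite addr_ge0 // mulr_ge0 ?invr_ge0 ?(ltW (adm_sigma H _)) //.
  by apply: sumr_ge0 => j _; rewrite ltW // (adm_L H).
have S0 : 0 <= S_ D i by apply: sumr_ge0 => j _; exact: sqrtr_ge0.
have M0 := ltW Mk_gt0.
rewrite -(ler_pXn2r (_ : 0 < 2)%N) ?nnegrE //.
apply: le_trans (sum_sqr_le _) _.
under eq_bigr => j _ do rewrite sqr_sqrtr ?addr_ge0 ?Lsig_ge0 //.
rewrite big_split /= sumr_const card_ord [X in _ <= X]sqrrD.
rewrite [X in _ <= _ + X]sqr_sqrtr ?mulr_ge0 //.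
have -> : \sum_(i0 < m) Lsm D i i0 / sigma D i = (sigma D i)^-1 * \sum_(j < m) Lsm D i j.
  by rewrite -mulr_suml mulrC.
move: ((sigma D i)^-1 * _) ks => s ks.
have h : m%:R * s <= m%:R * kappa_s D by rewrite ler_wpM2l //; lra.
have := sqrtr_ge0 (m%:R * kappa_s D); set r := Num.sqrt _ => r0.
have : 0 <= m%:R * r by rewrite mulr_ge0.
by rewrite expr2; nra.
Qed.

Lemma S_gt0 i : 0 < S_ D i.
Proof.
rewrite /S_ (bigD1 (Ordinal (adm_m H))) //= ltr_pwDl ?sumr_ge0 //.
by rewrite sqrtr_gt0 ltr_pwDl // Lsig_ge0.
Qed.

Lemma p_virt_gt0 i j : 0 < p_virt D pcomm i j.
Proof.
rewrite /p_virt divr_gt0 ?S_gt0 // mulr_gt0 ?pcomp_gt0 //.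
by rewrite sqrtr_gt0 ltr_pwDl // Lsig_ge0.
Qed.

Lemma p_edge_gt0 e : 0 < p_edge D pcomm e.
Proof. by case: e => [e|[i j]] /=; [exact: pcomm_gt0|exact: p_virt_gt0]. Qed.

Lemma sqrt2_ge1 : 1 <= Num.sqrt 2 :> R.
Proof. by rewrite -[X in X <= _]sqrtr1 ler_wsqrtr // ler1n. Qed.

(** It makes [rho / p_edge] usable as the weight of a convex combination. *)
Lemma rho_le_p e : rho <= p_edge D pcomm e.
Proof.
case: e => [e|[i j]] /=.
  rewrite rho_comm ger_pMr ?pcomm_gt0 //.
  by rewrite -[X in _ <= X]sqrtr1 ler_wsqrtr // gk_le1.
rewrite /p_virt ler_pdivlMr ?S_gt0 //.
apply: (@le_trans _ _ (1 - pcomm)); last first.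
  rewrite ler_peMr ?(ltW pcomp_gt0) // -[X in X <= _]sqrtr1 ler_wsqrtr //.
  by rewrite lerDl Lsig_ge0.
rewrite -rho_comp ler_pM2l //; apply: le_trans (S_le i) _.
by rewrite ler_peMl ?sqrt2_ge1 // ltW // Mk_gt0.
Qed.

Definition smul (c : edge E n m -> R) (l : @bvec R (edge E n m) d) : @bvec R (edge E n m) d :=
  of_blks (fun e => c e *: blk l e).

Lemma blk_smul c l e : blk (smul c l) e = c e *: blk l e.
Proof. exact: of_blksK. Qed.

Definition p_inv e := (p_edge D pcomm e)^-1.

(** On communication edges the form is at most [lamS / pcomm^2], and [rho^2 * lamS / pcomm^2 = delta
    <= sigma_A]. *)
Lemma comm_step_condition l : (forall i j, blk l (inr (i, j)) = 0) ->
  rho ^+ 2 * dot (smul p_inv l) (Mq D *m smul p_inv l) <= sigma_A D * dot l l.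
Proof.
move=> l0; rewrite dot_MqE //.
have sp e : blk (smul p_inv l) (inl e) = pcomm^-1 *: blk l (inl e) by rewrite blk_smul.
rewrite [X in _ * (_ + X)]big1 ?addr0 => [|i _]; last first.
  by rewrite big1 // => j _; rewrite blk_smul l0 scaler0 mulmx0 dot0l mulr0.
have -> : \sum_i (sigma D i)^-1 * dot (comm_part D (smul p_inv l) i + virt_part D (smul p_inv l) i)
     (comm_part D (smul p_inv l) i + virt_part D (smul p_inv l) i) =
   pcomm^-1 ^+ 2 * \sum_i (wS D) 0 i * dot (comm_part D l i) (comm_part D l i).
  rewrite mulr_sumr; apply: eq_bigr => i _.
  have -> : virt_part D (smul p_inv l) i = 0.
    by apply: big1 => j _; rewrite blk_smul l0 scaler0 mulmx0 scaler0.
  have -> : comm_part D (smul p_inv l) i = pcomm^-1 *: comm_part D l i.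
    by rewrite scaler_sumr; apply: eq_bigr => e _; rewrite sp !scalerA mulrC.
  by rewrite addr0 dotZl dotZr mxE; ring.
rewrite rho_sqr mulrA exprVn mulfK ?expf_neq0 ?gt_eqF ?pcomm_gt0 //.
have lle : \sum_e dot (blk l (inl e)) (blk l (inl e)) <= dot l l.
  rewrite dot_blk sum_sum_ord lerDl; apply: sumr_ge0 => i _.
  by apply: sumr_ge0 => j _; exact: dot_ge0.
apply: le_trans (_ : g * (lamS D * dot l l) <= _).
  rewrite ler_pM2l ?gk_gt0 //; apply: le_trans (comm_max _ _ _) _.
  by rewrite ler_pM2l // lamS_gt0.
rewrite gamma_kappaE // mulrA divfK ?gt_eqF ?lamS_gt0 //.
by rewrite ler_wpM2r ?dot_ge0 // sigma_A_ge_delta.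
Qed.

(** Probabilities proportional to the square roots cancel the factor [1 + L / sigma] and leave
    [delta * (S_i / Mk)^2], the same for all edges of node [i]. *)
Lemma virt_weight_le i j :
  rho ^+ 2 * (alpha D * (1 + Lsm D i j * (sigma D i)^-1) * (p_virt D pcomm i j)^-1 ^+ 2) <= delta D.
Proof.
have S0 := S_gt0 i; have M0 := Mk_gt0; have SM := S_le i; have d0 := delta_gt0 H.
have a0 : 0 < 1 + Lsm D i j * (sigma D i)^-1 by rewrite ltr_pwDl // Lsig_ge0.
rewrite /p_virt (alphaE H); set a := 1 + _ in a0 *.
have -> : rho ^+ 2 * (2 * delta D * a * ((1 - pcomm) * Num.sqrt a / S_ D i)^-1 ^+ 2) =
   delta D * (S_ D i ^+ 2 / Mk ^+ 2).
  have s0 : 0 < Num.sqrt a by rewrite sqrtr_gt0.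
  rewrite -{1}[a](sqr_sqrtr (ltW a0)) -rho_comp.
  have s2 : Num.sqrt 2 ^+ 2 = 2 :> R by rewrite sqr_sqrtr.
  have s20 : Num.sqrt 2 != 0 :> R by rewrite gt_eqF // sqrtr_gt0.
  rewrite -{1}s2; move: (Num.sqrt a) (Num.sqrt 2) (S_ D i) Mk (delta D) s0 s20 S0 M0 {SM a0 s2 d0}.
  move=> b c S M dd b0 c0 S0 M0.
  by field; rewrite c0 !gt_eqF.
have d0' := ltW d0; have S0' := ltW S0; have M0' := ltW M0.
apply: ler_piMr => //; rewrite ler_pdivrMr ?exprn_gt0 // mul1r.
by rewrite ler_pXn2r // nnegrE.
Qed.

(** One virtual edge per node is sampled, so the form splits over the nodes without cross terms. *)
Lemma virt_step_condition (phi : {ffun 'I_n -> 'I_m}) l :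
  (forall e, blk l (inl e) = 0) ->
  (forall i j, phi i != j -> blk l (inr (i, j)) = 0) ->
  rho ^+ 2 * dot (smul p_inv l) (Mq D *m smul p_inv l) <= sigma_A D * dot l l.
Proof.
move=> l0 l1; rewrite dot_MqE //.
apply: (@le_trans _ _ (delta D * dot l l)); last first.
  by rewrite ler_wpM2r ?dot_ge0 // sigma_A_ge_delta.
rewrite [X in _ <= _ * X]dot_blk [X in _ <= _ * X]sum_sum_ord.
rewrite [X in _ <= _ * (X + _)]big1 ?add0r => [|e _]; last by rewrite l0 dot0l.
rewrite -big_split /= !mulr_sumr; apply: ler_sum => i _.
have -> : comm_part D (smul p_inv l) i = 0.
  by apply: big1 => e _; rewrite blk_smul l0 !scaler0.
rewrite add0r [X in _ <= _ * X](bigD1 (phi i)) //= [X in _ <= _ * (_ + X)]big1 ?addr0; last first.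
  by move=> j jp; rewrite l1 ?dot0l // eq_sym.
rewrite [X in _ * (_ + X) <= _](bigD1 (phi i)) //= [X in _ * (_ + (_ + X)) <= _]big1 ?addr0; last first.
  by move=> j jp; rewrite blk_smul l1 ?scaler0 ?mulmx0 ?dot0l ?mulr0 // eq_sym.
set j := phi i.
have -> : virt_part D (smul p_inv l) i = mu_virt D i j *: (P i j *m blk (smul p_inv l) (inr (i, j))).
  rewrite /virt_part (bigD1 j) //= big1 ?addr0 // => k kj.
  by rewrite blk_smul l1 ?scaler0 ?mulmx0 ?scaler0 // eq_sym.
rewrite blk_smul /p_inv /= -scalemxAr !(dotZl, dotZr).
set u := blk l _; set q := (p_virt _ _ _ _)^-1.
have uu : dot (P i j *m u) (P i j *m u) <= dot u u.
  have := dot_ge0 (u - P i j *m u).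
  by rewrite !(dotDl, dotDr, dotNl, dotNr) (dot_proj (adm_proj H i j)) (proj_dot (adm_proj H i j)); lra.
apply: le_trans (_ : delta D * dot (P i j *m u) (P i j *m u) <= _); last first.
  by rewrite ler_pM2l ?delta_gt0.
have -> : rho ^+ 2 * ((sigma D i)^-1 * (mu_virt D i j * (mu_virt D i j * (q * (q * dot (P i j *m u) (P i j *m u))))) +
    alpha D * (q * (q * dot (P i j *m u) (P i j *m u)))) =
  (rho ^+ 2 * (((sigma D i)^-1 * mu_virt D i j ^+ 2 + alpha D) * q ^+ 2)) * dot (P i j *m u) (P i j *m u).
  by ring.
apply: ler_wpM2r; first exact: dot_ge0.
have := virt_weight_le i j; rewrite -/q (adm_mu_virtE H).
by congr (_ <= _); ring.
Qed.

Lemma block_step_condition (b : block n m) l :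
  (forall e, ~~ in_block b e -> blk l e = 0) ->
  rho ^+ 2 * dot (smul p_inv l) (Mq D *m smul p_inv l) <= sigma_A D * dot l l.
Proof.
case: b => [phi|] hl.
  by apply: (@virt_step_condition phi) => [e|i j ij]; rewrite hl.
by apply: comm_step_condition => i j; rewrite hl.
Qed.

Lemma time_identity tau : rho^-1 * (tau * pcomm + (1 - pcomm)) =
  Num.sqrt 2 * Mk + tau * Num.sqrt (kappa_comm D / gamma D).
Proof.
have g0 : 0 < Num.sqrt g by rewrite sqrtr_gt0 gk_gt0.
have -> : Num.sqrt (kappa_comm D / gamma D) = (Num.sqrt g)^-1.
  by rewrite -sqrtrV ?(ltW gk_gt0) // [g^-1]invf_div.
have p0 := pcomm_gt0; rewrite -rho_comp rho_comm.
move: Mk (Num.sqrt g) g0 (Num.sqrt 2) => M s s0 c.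
by field; rewrite !gt_eqF.
Qed.

End StepSize.

(** * Optimality of the dual point *)

Section Optimality.
Context {R : realType} {n m E d : nat}.
Variable D : instance R n m E d.
Hypothesis H : admissible D.
Local Notation A := (Amx D).
Local Notation P := (vproj D).
Local Notation bE := (@bvec R (edge E n m) d).

Definition vdom i j (a : 'cV[R]_d) := conj_dom (fun_of D i j) (P i j) (Lsm D i j) a.
Definition vval i j (a : 'cV[R]_d) := conj_val (fun_of D i j) (P i j) (Lsm D i j) a.

Definition edge_dom (e : edge E n m) (u : 'cV[R]_d) : Prop :=
  if e is inr (i, j) then vdom i j (- mu_virt D i j *: u) else True.
Definition edge_val (e : edge E n m) (u : 'cV[R]_d) : R :=
  if e is inr (i, j) then vval i j (- mu_virt D i j *: u) else 0.
Definition ldom (l : bE) := forall e, edge_dom e (blk l e).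
(** A real version of [FAstar]; the two agree on [ldom]. *)
Definition Fval (l : bE) := 1 / 2 * dot l (Mq D *m l) + \sum_e edge_val e (blk l e).

Lemma fstar_tildeE i j a : fstar_tilde D i j a =
  esaff (conj_slope (fun_of D i j) (P i j) (Lsm D i j))
        (conj_const (fun_of D i j) (P i j) (Lsm D i j)) a.
Proof.
exact: (conj_tildeE (adm_L H i j) (adm_proj H i j) (adm_smooth H i j)).
Qed.

Lemma fstar_tilde_dom i j a : vdom i j a -> fstar_tilde D i j a = (vval i j a)%:E.
Proof. by move=> da; rewrite fstar_tildeE (esaff_dom 0). Qed.

Lemma fstar_tilde_gtNy i j a : (-oo < fstar_tilde D i j a)%E.
Proof. by rewrite fstar_tildeE (esaff_gtNy 0). Qed.

Lemma fstar_tilde_lty i j a : (fstar_tilde D i j a < +oo)%E -> vdom i j a.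
Proof. by rewrite fstar_tildeE => /(esaff_lty 0). Qed.

Lemma sum_edge_val l : \sum_e edge_val e (blk l e) =
  \sum_i \sum_j vval i j (- mu_virt D i j *: blk l (inr (i, j))).
Proof. by rewrite sum_sum_ord big1 ?add0r. Qed.

Lemma FAstarE l : ldom l -> FAstar D l = (Fval l)%:E.
Proof.
move=> dl; rewrite /FAstar /Fval qnorm_dot EFinD; congr (_ + _)%E.
rewrite sum_edge_val -sumEFin; apply: eq_bigr => i _.
rewrite /= -sumEFin; apply: eq_bigr => j _.
exact: (fstar_tilde_dom (dl (inr (i, j)))).
Qed.

(** With [-oo] excluded, an infinite term cannot be hidden in a finite sum. *)
Lemma esum_lty (I : finType) (F : I -> \bar R) : (forall i, -oo < F i)%E ->
  ((-oo < \sum_i F i) /\ (\sum_i F i < +oo -> forall i, F i < +oo))%E.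
Proof.
move=> F0; have N (Q : pred I) : (-oo < \sum_(i | Q i) F i)%E.
  elim/big_ind: _ => [|x y|i _]; [exact: ltNyr| |exact: F0].
  by case: x => [x| |] //; case: y => [y| |] // _ _; exact: ltNyr.
split=> // Fy i; move: Fy; rewrite (bigD1 i) //=; have := N [pred k | k != i].
by case: (F i) (F0 i) => //=; case: (\sum_(_ | _) _)%E.
Qed.

Lemma FAstar_lty l : (FAstar D l < +oo)%E -> ldom l.
Proof.
have h i : (-oo < \sum_(j < m) fstar_tilde D i j (- mu_virt D i j *: blk l (inr (i, j)))%R)%E.
  by apply: (esum_lty _).1 => j; apply: fstar_tilde_gtNy.
move=> Fy; have {}Fy : (\sum_(i < n) \sum_(j < m) fstar_tilde D i j
    (- mu_virt D i j *: blk l (inr (i, j)))%R < +oo)%E.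
  by move: Fy (esum_lty h).1; rewrite /FAstar; case: (\sum_(i < n) _)%E.
case=> [e|[i j]] //=; apply: fstar_tilde_lty.
have hj k : (-oo < fstar_tilde D i k (- mu_virt D i k *: blk l (inr (i, k)))%R)%E.
  exact: fstar_tilde_gtNy.
exact: ((esum_lty hj).2 ((esum_lty h).2 Fy i) j).
Qed.

Lemma vdom_proj i j a : vdom i j a -> P i j *m a = a.
Proof. exact: (conj_dom_proj (adm_L H i j) (adm_proj H i j) (adm_smooth H i j)). Qed.

Lemma edge_dom_comb e t u v : 0 <= t -> t <= 1 -> edge_dom e u -> edge_dom e v ->
  edge_dom e ((1 - t) *: u + t *: v).
Proof.
case: e => [e|[i j]] //= t0 t1 du dv.
have -> : - mu_virt D i j *: ((1 - t) *: u + t *: v) =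
  (1 - t) *: (- mu_virt D i j *: u) + t *: (- mu_virt D i j *: v).
  by rewrite scalerDr !scalerA (mulrC _ (1 - t)) (mulrC _ t).
exact: saff_dom_comb.
Qed.

Lemma edge_val_comb e t u v : 0 <= t -> t <= 1 -> edge_dom e u -> edge_dom e v ->
  edge_val e ((1 - t) *: u + t *: v) <= (1 - t) * edge_val e u + t * edge_val e v.
Proof.
case: e => [e|[i j]] /= t0 t1 du dv; first by rewrite !mulr0 addr0.
have -> : - mu_virt D i j *: ((1 - t) *: u + t *: v) =
  (1 - t) *: (- mu_virt D i j *: u) + t *: (- mu_virt D i j *: v).
  by rewrite scalerDr !scalerA (mulrC _ (1 - t)) (mulrC _ t).
exact: (saff_comb 0).
Qed.

Variable theta_star : 'cV[R]_d.
Hypothesis theta_star_min : forall theta, objective D theta_star <= objective D theta.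
Local Notation gr i j := (grad (fun_of D i j) theta_star).

Lemma vdom_grad i j : vdom i j (gr i j).
Proof.
exact: (conj_dom_grad (adm_L H i j) (adm_proj H i j) (adm_convex H i j) (adm_smooth H i j)).
Qed.

Lemma linear_le_quadratic (N C : R) : 0 <= C ->
  (forall t, 0 < t -> t * N <= t ^+ 2 * C) -> N <= 0.
Proof.
move=> C0 h; rewrite leNgt; apply/negP => N0.
have c0 : 0 < 2 * (C + 1) by rewrite mulr_gt0 // ltr_pwDr.
have t0 : 0 < N / (2 * (C + 1)) by rewrite divr_gt0.
have := h _ t0; rewrite expr2 -mulrA ler_pM2l // mulrAC ler_pdivlMr //; nra.
Qed.

Definition local_grad i := sigma D i *: theta_star + \sum_j gr i j.

(* The quadratic upper model replaces a computation of the gradient of the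
   objective: along [- G] it would decrease below the minimum. *)
Lemma stationarity : \sum_i local_grad i = 0.
Proof.
set G := \sum_i _; apply/eqP; rewrite -dot_eq0 eq_le dot_ge0 andbT.
pose C := \sum_i (\sum_j Lsm D i j / 2 * dot G (P i j *m G) + sigma D i / 2 * dot G G).
apply: (@linear_le_quadratic _ C).
  apply: sumr_ge0 => i _; rewrite addr_ge0 ?mulr_ge0 ?dot_ge0 ?(ltW (adm_sigma H i)) //.
  apply: sumr_ge0 => j _; rewrite -(dot_proj (adm_proj H i j)).
  by rewrite mulr_ge0 ?dot_ge0 // divr_ge0 // ltW // (adm_L H).
move=> t t0; have := theta_star_min (theta_star + (- t) *: G).
have le i : local_obj D i (theta_star + (- t) *: G) <= local_obj D i theta_star
    - t * dot (local_grad i) G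
    + t ^+ 2 * (\sum_j Lsm D i j / 2 * dot G (P i j *m G) + sigma D i / 2 * dot G G).
  rewrite /local_obj /local_grad !normsq_dot.
  apply: (@le_trans _ _ (\sum_(j < m) (fun_of D i j theta_star - t * dot (gr i j) G
      + t ^+ 2 * (Lsm D i j / 2 * dot G (P i j *m G)))
      + sigma D i / 2 * dot (theta_star + (- t) *: G) (theta_star + (- t) *: G))).
    rewrite lerD2r; apply: ler_sum => j _.
    have := smooth_ub (adm_smooth H i j) theta_star ((- t) *: G).
    rewrite -scalemxAr !(dotZl, dotZr) -(proj_dot (adm_proj H i j) (gr i j)) (vdom_proj (vdom_grad i j)).
    by move=> h; apply: le_trans h _; rewrite le_eqVlt; apply/orP; left; apply/eqP; ring.
  rewrite !big_split /= sumrN -!mulr_sumr !(dotDl, dotDr, dotZl, dotZr) (dotC G theta_star).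
  rewrite [dot (\sum_(j < m) _) G]dot_suml.
  set a := \sum_(j < m) fun_of _ _ _ _; set b := \sum_(j < m) dot _ _.
  set c := \sum_(j < m) _; move: a b c (dot _ _) (dot _ _) (dot _ _) => a b c x y z.
  by rewrite le_eqVlt; apply/orP; left; apply/eqP; field.
rewrite /objective => h; have {h} := le_trans h (ler_sum _ (fun i _ => le i)).
rewrite !big_split /= sumrN -!mulr_sumr -dot_suml -/G -/C; lra.
Qed.

(** Divided by [sigma D i], this is the primal variable of node [i]. *)
Definition svec (l : bE) i := blk (A *m l) (inl i).

(** Each column of [Acomm] sums to zero, so only the virtual edges contribute. *)
Lemma sum_svec l : ldom l ->
  \sum_i svec l i = - \sum_i \sum_j - mu_virt D i j *: blk l (inr (i, j)).
Proof.
move=> dl; under eq_bigr => i _ do rewrite /svec blk_A_comm.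
rewrite big_split /= exchange_big big1 ?add0r => [|e _].
  rewrite -sumrN; apply: eq_bigr => i _; rewrite -sumrN; apply: eq_bigr => j _.
  by rewrite -[X in - X](vdom_proj (dl (inr (i, j)))) -scalemxAr scaleNr opprK.
rewrite -scaler_suml; have -> : \sum_i Acomm D i e = 0; last by rewrite scale0r.
under eq_bigr => i _ do rewrite mxE.
rewrite -mulr_sumr sumrB.
have one k : \sum_(i < n) ((i == k)%:R : R) = 1.
  by rewrite (bigD1 k) //= eqxx big1 ?addr0 // => i /negPf ->.
by rewrite !one subrr mulr0.
Qed.

(** On [vdom] this is the full Fenchel conjugate of [fun_of D i j], with the quadratic part
    restored. *)
Definition fen i j a := vval i j a + (2 * Lsm D i j)^-1 * qnorm (P i j) a.

(** At a virtual node the quadratic form of [Sg] is exactly the term subtracted in [fstar_tilde]. *)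
Lemma Fval_decomp l : ldom l -> Fval l =
  \sum_i (2 * sigma D i)^-1 * dot (svec l i) (svec l i) +
  \sum_i \sum_j fen i j (- mu_virt D i j *: blk l (inr (i, j))).
Proof.
move=> dl; rewrite /Fval dot_Mq // dot_Sg // sum_edge_val mulrDr -addrA.
congr (_ + _).
  rewrite mulr_sumr; apply: eq_bigr => i _; rewrite mulrA mul1r -invfM //.
rewrite mulr_sumr -big_split /=; apply: eq_bigr => i _.
rewrite mulr_sumr -big_split /=; apply: eq_bigr => j _.
have Pa := vdom_proj (dl (inr (i, j))); rewrite /fen /= addrC; congr (_ + _).
have -> : blk (A *m l) (inr (i, j)) = - mu_virt D i j *: blk l (inr (i, j)).
  by rewrite blk_A_virt -scaleNr scalemxAr Pa.
by rewrite mulrA mul1r -invfM qnorm_dot Pa.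
Qed.

(** [theta_star] is a subgradient of the conjugate at the gradient taken there. *)
Lemma fen_diff i j a : vdom i j a ->
  fen i j (gr i j) + dot (a - gr i j) theta_star <= fen i j a.
Proof.
move=> da.
have h1 := fenchel_young (adm_L H i j) (adm_proj H i j) theta_star da.
have h2 := conj_val_grad (adm_L H i j) (adm_proj H i j) (adm_convex H i j) (adm_smooth H i j) theta_star.
by rewrite dotBl /fen /vval; lra.
Qed.

(** The subgradient terms add up, by [sum_svec], to the linear part of the expansion of the node
    squares around [sigma D i *: theta_star], and cancel it. *)
Lemma Fval_growth l0 l : ldom l0 -> ldom l ->
  (forall i, svec l0 i = sigma D i *: theta_star) ->
  (forall i j, - mu_virt D i j *: blk l0 (inr (i, j)) = gr i j) ->
  Fval l0 + \sum_i (2 * sigma D i)^-1 *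
    dot (svec l i - sigma D i *: theta_star) (svec l i - sigma D i *: theta_star) <= Fval l.
Proof.
move=> dl0 dl sl0 vl0; rewrite !Fval_decomp //.
have : \sum_i \sum_j (fen i j (gr i j) +
    dot (- mu_virt D i j *: blk l (inr (i, j)) - gr i j) theta_star) <=
  \sum_i \sum_j fen i j (- mu_virt D i j *: blk l (inr (i, j))).
  by apply: ler_sum => i _; apply: ler_sum => j _; apply: fen_diff (dl (inr (i, j))).
have -> : \sum_i \sum_j (fen i j (gr i j) +
    dot (- mu_virt D i j *: blk l (inr (i, j)) - gr i j) theta_star) =
  \sum_i \sum_j fen i j (- mu_virt D i j *: blk l0 (inr (i, j))) +
    dot (\sum_i svec l0 i - \sum_i svec l i) theta_star.
  have -> : \sum_i svec l0 i - \sum_i svec l i =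
      \sum_i \sum_j (- mu_virt D i j *: blk l (inr (i, j)) - gr i j).
    rewrite !sum_svec // opprK [LHS]addrC -sumrB; apply: eq_bigr => i _.
    by rewrite -sumrB; apply: eq_bigr => j _; rewrite vl0.
  rewrite dot_suml -big_split; apply: eq_bigr => i _ /=.
  by rewrite dot_suml -big_split; apply: eq_bigr => j _ /=; rewrite vl0.
rewrite -sumrB dot_suml => h.
suff -> : \sum_i (2 * sigma D i)^-1 * dot (svec l i) (svec l i) =
   \sum_i (2 * sigma D i)^-1 * dot (svec l0 i) (svec l0 i) +
   \sum_i (2 * sigma D i)^-1 *
    dot (svec l i - sigma D i *: theta_star) (svec l i - sigma D i *: theta_star)
   - \sum_i dot (svec l0 i - svec l i) theta_star by lra.
rewrite -big_split -sumrB /=; apply: eq_bigr => i _.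
rewrite sl0 !(dotDl, dotDr, dotNl, dotNr, dotZl, dotZr) (dotC theta_star (svec l i)).
by field; rewrite gt_eqF // (adm_sigma H).
Qed.

(** The gradients dictate the virtual blocks; the communication blocks then solve a graph equation
    whose zero-sum condition is [stationarity]. *)
Lemma dual_point : exists l0, [/\ ldom l0,
  forall i, svec l0 i = sigma D i *: theta_star &
  forall i j, - mu_virt D i j *: blk l0 (inr (i, j)) = gr i j].
Proof.
have [c hc] := Acomm_solve H stationarity.
pose l0 : bE := of_blks (fun e => match e with
  | inl e => c e | inr (i, j) => - (mu_virt D i j)^-1 *: gr i j end).
have vl i j : - mu_virt D i j *: blk l0 (inr (i, j)) = gr i j.
  rewrite of_blksK scalerA mulNr mulrN opprK mulfV ?scale1r //.
  by rewrite gt_eqF // (adm_mu_virt H).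
exists l0; split=> //.
  by case=> [e|[i j]] //=; rewrite vl; apply: vdom_grad.
move=> i; rewrite /svec blk_A_comm; under eq_bigr => e _ do rewrite of_blksK.
rewrite hc /local_grad -addrA -big_split /= big1 ?addr0 // => j _.
have mu_l : mu_virt D i j *: blk l0 (inr (i, j)) = - gr i j.
  by rewrite -vl scaleNr opprK.
by rewrite scalemxAr mu_l mulmxN (vdom_proj (vdom_grad i j)) subrr.
Qed.

Variable theta_A : bE.
Hypothesis theta_A_min : forall l, (FAstar D theta_A <= FAstar D l)%E.

Lemma theta_A_dom : ldom theta_A.
Proof.
have [l0 [dl0 _ _]] := dual_point; apply: FAstar_lty.
by apply: le_lt_trans (theta_A_min l0) _; rewrite FAstarE // ltry.
Qed.

Lemma theta_A_le l : ldom l -> Fval theta_A <= Fval l.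
Proof.
move=> dl; have := theta_A_min l; rewrite !FAstarE ?lee_fin //.
exact: theta_A_dom.
Qed.

Lemma theta_A_primal i : svec theta_A i = sigma D i *: theta_star.
Proof.
have [l0 [dl0 sl0 vl0]] := dual_point.
have := Fval_growth dl0 theta_A_dom sl0 vl0; have := theta_A_le dl0.
set S := \sum_i _ => h1 h2.
have s0 k : 0 <= (2 * sigma D k)^-1 * dot (svec theta_A k - sigma D k *: theta_star)
    (svec theta_A k - sigma D k *: theta_star).
  by rewrite mulr_ge0 ?dot_ge0 // invr_ge0 mulr_ge0 // ltW // (adm_sigma H).
have : S == 0 by rewrite eq_le sumr_ge0 // andbT; lra.
rewrite psumr_eq0 // => /allP/(_ i (mem_index_enum _)).
rewrite mulf_eq0 invr_eq0 gt_eqF ?mulr_gt0 ?(adm_sigma H) //= dot_eq0 subr_eq0.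
by move=> /eqP.
Qed.

End Optimality.

(** * Convergence of ADFS *)

Section Simulation.
Context {R : realType} {n m E d : nat}.
Variable D : instance R n m E d.
Hypothesis H : admissible D.
Local Notation A := (Amx D).
Local Notation Sg := (pseudo_inv (Sigma D)).
Local Notation P := (vproj D).
Local Notation mu := (mu_virt D).
Local Notation bE := (@bvec R (edge E n m) d).

Lemma A_ker_virt (h : bE) i j : A *m h = 0 -> P i j *m blk h (inr (i, j)) = 0.
Proof.
move=> Ah; have := blk_A_virt D h i j; rewrite Ah blk0 => /esym/eqP.
by rewrite oppr_eq0 scaler_eq0 gt_eqF ?(adm_mu_virt H) //= => /eqP.
Qed.

(* Scalings that are constant on the communication edges preserve the kernel of
   [A], which is the direct sum of that of [Acomm] and those of the [P i j]. *)
Lemma smul_ker (c : edge E n m -> R) (h : bE) :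
  (forall e e', c (inl e) = c (inl e')) -> A *m h = 0 -> A *m smul c h = 0.
Proof.
move=> cc Ah; apply: blk_inj => -[i|[i j]]; rewrite blk0; last first.
  by rewrite blk_A_virt blk_smul -scalemxAr A_ker_virt // !scaler0 oppr0.
rewrite blk_A_comm [X in _ + X]big1 ?addr0 => [|j _]; last first.
  by rewrite blk_smul -scalemxAr A_ker_virt // !scaler0.
have := blk_A_comm D h i; rewrite Ah blk0 [X in _ + X]big1 ?addr0 => [|j _]; last first.
  by rewrite A_ker_virt // scaler0.
move=> h0.
transitivity (c (inl (Ordinal (E_gt0 H))) *: \sum_e Acomm D i e *: blk h (inl e)); last first.
  by rewrite -h0 scaler0.
rewrite scaler_sumr; apply: eq_bigr => e _.
by rewrite blk_smul !scalerA mulrC (cc e (Ordinal (E_gt0 H))).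
Qed.

Lemma dot_smul c (k l : bE) : dot k (smul c l) = dot (smul c k) l.
Proof.
by rewrite !dot_blk; apply: eq_bigr => e _; rewrite !blk_smul dotZl dotZr.
Qed.

Lemma in_range_smul c (l : bE) : (forall e e', c (inl e) = c (inl e')) ->
  in_range D l -> in_range D (smul c l).
Proof. by move=> cc hl k Ak; rewrite dot_smul hl // smul_ker. Qed.

(** A kernel vector of [A] pairs to zero with virtual blocks in the ranges of the projectors, so
    only the communication blocks matter, and these are borrowed from [l']. *)
Lemma in_range_eq_comm (l l' : bE) : in_range D l' ->
  (forall e, blk l (inl e) = blk l' (inl e)) ->
  (forall i j, P i j *m blk l (inr (i, j)) = blk l (inr (i, j))) -> in_range D l.
Proof.
move=> hl' lc lv k Ak; rewrite -(hl' _ Ak) !dot_blk !sum_sum_ord; congr (_ + _).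
  by apply: eq_bigr => e _; rewrite lc.
apply: eq_bigr => i _; apply: eq_bigr => j _.
rewrite -lv -(in_range_virt H i j hl') -!(proj_dot (adm_proj H i j)).
by rewrite A_ker_virt // !dot0l.
Qed.

Variables (pcomm rho : R).
Hypothesis rho_gt0 : 0 < rho.
Hypothesis p_gt0 : forall e, 0 < p_edge D pcomm e.
Local Notation pi_ := (p_inv D pcomm).
Local Notation eta := (rho / sigma_A D).

Definition bmask (b : block n m) (e : edge E n m) : R := (in_block b e)%:R.
Definition rr e := rho * pi_ e.

Lemma bmask_comm b e e' : bmask b (inl e) = bmask b (inl e').
Proof. by case: b. Qed.

(* A ghost state [g = (lv, lu)] of edge vectors represents the state of the
   algorithm: [v = A lv] and [x = A lx], where each block of [lx] is the
   combination of those of [lv] and [lu] with weights [rr] and [1 - rr].  The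
   update of [lu] does not depend on the sampled block.  [lN_] collects the
   blocks that the edges would receive if they were all sampled. *)
Definition lx_ (g : bE * bE) := smul rr g.1 + smul (fun e => 1 - rr e) g.2.
Definition ly_ g := (1 + rho)^-1 *: (lx_ g + rho *: g.1).
Definition lw_ g := (1 + rho)^-1 *: (g.1 + rho *: lx_ g).
Definition lG_ g := Mq D *m ly_ g.
Definition zeta_ g e := blk (lw_ g) e - (eta * pi_ e) *: blk (lG_ g) e.
Definition lN_ (g : bE * bE) : bE := of_blks (fun e => match e with
  | inl e => zeta_ g (inl e)
  | inr (i, j) => - (mu i j)^-1 *: prox (eta * mu i j ^+ 2 * (p_virt D pcomm i j)^-1)
                    (fstar_tilde D i j) (- mu i j *: zeta_ g (inr (i, j)))
  end).
Definition lv' b g := smul (bmask b) (lN_ g) + smul (fun e => 1 - bmask b e) (lw_ g).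
(** Blockwise the coefficients sum to 1 and solve [(1 - rr) lu' = ly - rr lw], which keeps the
    representation of [x] valid whether or not the edge is sampled. *)
Definition lu' (g : bE * bE) := smul (fun e => rho * (1 + rr e) / (1 + rho)) g.1 +
  smul (fun e => (1 - rr e * rho) / (1 + rho)) g.2.
Definition gstep b g := (lv' b g, lu' g).

Definition real_state (g : bE * bE) : state := (A *m lx_ g, A *m g.1).
Definition ginv (g : bE * bE) :=
  [/\ in_range D g.1, in_range D g.2, ldom D g.1 & ldom D g.2].

Lemma in_range_lx g : ginv g -> in_range D (lx_ g).
Proof.
move=> [g1 g2 _ _]; apply: in_rangeD; apply: in_range_smul => //.
Qed.

Lemma in_range_ly g : ginv g -> in_range D (ly_ g).
Proof.
move=> hg; apply: in_rangeZ; apply: in_rangeD (in_range_lx hg) (in_rangeZ _ _).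
by case: hg.
Qed.

Lemma in_range_lw g : ginv g -> in_range D (lw_ g).
Proof.
move=> hg; apply: in_rangeZ; apply: in_rangeD (in_rangeZ _ (in_range_lx hg)).
by case: hg.
Qed.

Lemma in_range_lG g : in_range D (lG_ g).
Proof. by rewrite /lG_ Mq_mul; apply: in_range_tr. Qed.

Lemma pseudo_inv_P b : pseudo_inv (P_ D pcomm b) =
  blk_diag (fun e => (bmask b e * pi_ e)%:M : 'M[R]_d).
Proof.
have -> : P_ D pcomm b = blk_diag (fun e => (bmask b e * p_edge D pcomm e)%:M : 'M[R]_d).
  congr blk_mx; apply/funext => e; apply/funext => e'.
  rewrite /bmask; case: eqP => /= [_|_]; last by rewrite raddf0.
  by case: in_block; rewrite ?mul1r ?mul0r.
apply: pseudo_inv_blk_diag => e; rewrite /p_inv; have pe := p_gt0 e.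
by rewrite /bmask; case: in_block; split;
  rewrite -?scalar_mxM ?tr_scalar_mx // ?mul0r // !mul1r ?mulfV ?mulVf ?mul1r // gt_eqF.
Qed.

Lemma pseudo_inv_P_mul b (l : bE) : pseudo_inv (P_ D pcomm b) *m l =
  smul (fun e => bmask b e * pi_ e) l.
Proof.
by rewrite pseudo_inv_P; apply: blk_inj => e; rewrite blk_diag_mulmx blk_smul mul_scalar_mx.
Qed.

(** [A^+ A l] differs from [l] by a kernel vector, which the block scaling keeps in the kernel. *)
Lemma Wtilde_A b (l : bE) : Wtilde D pcomm b *m (A *m l) =
  A *m smul (fun e => bmask b e * pi_ e) l.
Proof.
rewrite /Wtilde -!mulmxA pseudo_inv_P_mul; apply/eqP; rewrite -subr_eq0 -mulmxBr.
have -> : smul (fun e => bmask b e * pi_ e) (pseudo_inv A *m (A *m l)) -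
    smul (fun e => bmask b e * pi_ e) l =
    smul (fun e => bmask b e * pi_ e) (pseudo_inv A *m (A *m l) - l).
  by apply: blk_inj => e; rewrite blkB !blk_smul blkB scalerBr.
apply/eqP; apply: smul_ker => [e e'|]; first by rewrite (bmask_comm b e e').
rewrite mulmxBr !mulmxA; have [-> _ _ _] := pseudo_invP A.
by rewrite subrr.
Qed.

Lemma W_A b (l : bE) : W_ D pcomm b *m Sg *m (A *m l) =
  A *m smul (fun e => bmask b e * pi_ e) (Mq D *m l).
Proof. by rewrite Mq_mul /W_ -!mulmxA pseudo_inv_P_mul. Qed.

Lemma prox_vdom i j eta' z : 0 < eta' -> vdom D i j (prox eta' (fstar_tilde D i j) z).
Proof.
move=> e0; have -> : fstar_tilde D i j = esaff (conj_slope (fun_of D i j) (P i j) (Lsm D i j))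
        (conj_const (fun_of D i j) (P i j) (Lsm D i j)).
  by apply/funext => a; rewrite fstar_tildeE.
apply: (prox_dom 0 _ e0); exact: (conj_dom_grad (adm_L H i j) (adm_proj H i j)
  (adm_convex H i j) (adm_smooth H i j) 0).
Qed.

Lemma prox_vvar i j eta' z w : 0 < eta' -> vdom D i j w ->
  let v := prox eta' (fstar_tilde D i j) z in
  vval D i j v + eta'^-1 * dot (z - v) (w - v) <= vval D i j w.
Proof.
move=> e0 dw; have -> : fstar_tilde D i j = esaff (conj_slope (fun_of D i j) (P i j) (Lsm D i j))
        (conj_const (fun_of D i j) (P i j) (Lsm D i j)).
  by apply/funext => a; rewrite fstar_tildeE.
exact: (prox_variational 0 z e0 dw dw).
Qed.

Hypothesis sigA_gt0 : 0 < sigma_A D.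
Hypothesis rho_le_p : forall e, rho <= p_edge D pcomm e.

Lemma eta_gt0 : 0 < eta.
Proof. by rewrite divr_gt0. Qed.

Lemma prox_step_gt0 i j : 0 < eta * mu i j ^+ 2 * (p_virt D pcomm i j)^-1.
Proof.
apply: mulr_gt0; last by rewrite invr_gt0; exact: (p_gt0 (inr (i, j))).
by apply: mulr_gt0; [exact: eta_gt0|rewrite exprn_gt0 // (adm_mu_virt H)].
Qed.

Lemma mu_lN g i j : - mu i j *: blk (lN_ g) (inr (i, j)) =
  prox (eta * mu i j ^+ 2 * (p_virt D pcomm i j)^-1)
    (fstar_tilde D i j) (- mu i j *: zeta_ g (inr (i, j))).
Proof.
rewrite of_blksK scalerA mulNr mulrN opprK mulfV ?scale1r //.
by rewrite gt_eqF // (adm_mu_virt H).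
Qed.

Lemma ldom_lN g : ldom D (lN_ g).
Proof. by case=> [e|[i j]] //=; rewrite mu_lN; apply/prox_vdom/prox_step_gt0. Qed.

Lemma ldom_range (l : bE) i j : ldom D l -> P i j *m blk l (inr (i, j)) = blk l (inr (i, j)).
Proof.
move=> dl; have := vdom_proj H (dl (inr (i, j))).
rewrite -scalemxAr => /(scalerI _); apply.
by rewrite oppr_eq0 gt_eqF // (adm_mu_virt H).
Qed.

(** Communication blocks agree with those of a full gradient step, which is in range; proximal
    blocks are in the ranges of the projectors. *)
Lemma in_range_lN g : ginv g -> in_range D (lN_ g).
Proof.
move=> hg; apply: (@in_range_eq_comm _ (lw_ g - eta *: smul pi_ (lG_ g))).
- apply: in_rangeD (in_range_lw hg) _; rewrite -scaleN1r scalerA.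
  by apply: in_rangeZ; apply: in_range_smul (in_range_lG _).
- by move=> e; rewrite of_blksK /zeta_ blkB blkZ blk_smul scalerA.
- by move=> i j; apply: ldom_range (ldom_lN g).
Qed.

Lemma in_range_lv' b g : ginv g -> in_range D (lv' b g).
Proof.
move=> hg; apply: in_rangeD; apply: in_range_smul.
- exact: bmask_comm.
- exact: in_range_lN.
- by move=> e e'; rewrite (bmask_comm b e e').
- exact: in_range_lw.
Qed.

Lemma in_range_lu' g : ginv g -> in_range D (lu' g).
Proof. by move=> [g1 g2 _ _]; apply: in_rangeD; apply: in_range_smul. Qed.

Lemma rr_ge0 e : 0 <= rr e.
Proof. by rewrite /rr mulr_ge0 ?invr_ge0 ?ltW. Qed.

Lemma rr_le1 e : rr e <= 1.
Proof. by rewrite /rr /p_inv ler_pdivrMr // mul1r. Qed.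

Lemma rho1_gt0 : 0 < 1 + rho.
Proof. by rewrite ltr_pwDl // ltW. Qed.

Lemma blk_lw g e : let t := rho * (1 - rr e) / (1 + rho) in
  blk (lw_ g) e = (1 - t) *: blk g.1 e + t *: blk g.2 e.
Proof.
move=> t; rewrite !(blkZ, blkD, blk_smul) !(scalerDr, scalerA) addrA -scalerDl.
congr (_ *: _ + _ *: _); rewrite /t; have := rho1_gt0; move: (rr e) => r r0; field;
  by rewrite gt_eqF.
Qed.

Lemma blk_lu' g e : let t := (1 - rr e * rho) / (1 + rho) in
  blk (lu' g) e = (1 - t) *: blk g.1 e + t *: blk g.2 e.
Proof.
move=> t; rewrite !(blkD, blk_smul); congr (_ *: _ + _).
by rewrite /t; have := rho1_gt0; move: (rr e) => r r0; field; rewrite gt_eqF.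
Qed.

Hypothesis rho_le1 : rho <= 1.

Lemma lw_coef e : let t := rho * (1 - rr e) / (1 + rho) in 0 <= t /\ t <= 1.
Proof.
have := rr_ge0 e; have := rr_le1 e; move: (rr e) => r r1 r0 t.
have q0 := rho1_gt0; have r2 : 0 <= rho * r by rewrite mulr_ge0 // ltW.
have r3 : 0 <= rho * (1 - r) by rewrite mulr_ge0 ?subr_ge0 // ltW.
split; first by rewrite divr_ge0 // ltW.
by rewrite ler_pdivrMr // mul1r; lra.
Qed.

Lemma lu_coef e : let t := (1 - rr e * rho) / (1 + rho) in 0 <= t /\ t <= 1.
Proof.
have := rr_ge0 e; have := rr_le1 e; move: (rr e) => r r1 r0 t.
have q0 := rho1_gt0; have r2 : 0 <= r * rho by rewrite mulr_ge0 // ltW.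
have r3 : r * rho <= 1 by rewrite mulr_ile1 // ltW.
split; first by rewrite divr_ge0 ?subr_ge0 // ltW.
by rewrite ler_pdivrMr // mul1r; have := rho_gt0; lra.
Qed.

Lemma ldom_lw g : ginv g -> ldom D (lw_ g).
Proof.
move=> [_ _ d1 d2] e; rewrite blk_lw; have [t0 t1] := lw_coef e.
exact: edge_dom_comb.
Qed.

Lemma ldom_lu' g : ginv g -> ldom D (lu' g).
Proof.
move=> [_ _ d1 d2] e; rewrite blk_lu'; have [t0 t1] := lu_coef e.
exact: edge_dom_comb.
Qed.

Lemma blk_lv' b g e : blk (lv' b g) e =
  if in_block b e then blk (lN_ g) e else blk (lw_ g) e.
Proof.
rewrite blkD !blk_smul /bmask; case: in_block.
  by rewrite scale1r subrr scale0r addr0.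
by rewrite scale0r subr0 scale1r add0r.
Qed.

Lemma ldom_lv' b g : ginv g -> ldom D (lv' b g).
Proof.
move=> hg e; rewrite blk_lv'; case: ifP => _; first exact: ldom_lN.
exact: ldom_lw.
Qed.

Lemma ginv_step b g : ginv g -> ginv (gstep b g).
Proof.
move=> hg; split; [exact: in_range_lv'|exact: in_range_lu'|exact: ldom_lv'|exact: ldom_lu'].
Qed.

Lemma lx_step b g : lx_ (gstep b g) = ly_ g +
  rho *: smul (fun e => bmask b e * pi_ e) (lv' b g - lw_ g).
Proof.
apply: blk_inj => e; rewrite /lx_ /gstep /= 2!blkD !blkZ !blk_smul blkB blk_lu' blk_lv'.
rewrite /bmask /ly_ /lx_; have q0 := rho1_gt0.
have q1 : 1 + rho != 0 by rewrite gt_eqF.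
rewrite (_ : rho *: _ = (rr e * (in_block b e)%:R) *: ((if in_block b e then blk (lN_ g) e
   else blk (lw_ g) e) - blk (lw_ g) e)); last by rewrite !scalerA /rr; congr (_ *: _); ring.
have key : (1 - rr e) *: ((1 - (1 - rr e * rho) / (1 + rho)) *: blk g.1 e +
   (1 - rr e * rho) / (1 + rho) *: blk g.2 e) =
  (1 + rho)^-1 *: blk (smul rr g.1 + smul (fun e => 1 - rr e) g.2 + rho *: g.1) e
    - rr e *: blk (lw_ g) e.
  rewrite blk_lw !(blkZ, blkD, blk_smul).
  move: (blk g.1 e) (blk g.2 e) (rr e) => u v r.
  by apply/matrixP => a z; rewrite !mxE; field; rewrite gt_eqF.
rewrite key; case: in_block; first by rewrite mulr1 scalerBr addrCA.
by rewrite mulr0 scale0r addr0 addrCA subrr addr0.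
Qed.

(** The virtual block of [A *m l] is [- mu] times the edge block, so the proximal step at the node
    is that of [lN_]. The opposite sign of the edge at node [i] gives the correction added there. *)
Lemma simulation b g : ginv g ->
  adfs_step D pcomm rho b (real_state g) = real_state (gstep b g).
Proof.
move=> hg; rewrite /adfs_step /real_state /=; have q0 := rho1_gt0.
have q1 : 1 + rho != 0 by rewrite gt_eqF.
rewrite (_ : (1 + rho)^-1 *: _ = A *m ly_ g); last first.
  by rewrite /ly_ [rho *: _]scalemxAr -mulmxDr scalemxAr.
rewrite (_ : (1 - rho) *: (A *m g.1) + _ = A *m lw_ g); last first.
  rewrite !scalemxAr -mulmxDr; congr (_ *m _); rewrite /ly_ /lw_; move: (lx_ g) => x.
  by apply/matrixP => a z; rewrite !mxE; field; rewrite gt_eqF.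
rewrite W_A -/(lG_ g) [(rho / sigma_A D) *: _]scalemxAr -mulmxBr.
set lz := lw_ g - _.
have lzE e : blk lz e = if in_block b e then zeta_ g e else blk (lw_ g) e.
  rewrite /lz blkB [blk (_ *: smul _ _) _]blkZ blk_smul scalerA /zeta_ /bmask; case: in_block.
    by rewrite mul1r.
  by rewrite mul0r mulr0 scale0r subr0.
have lz_range : in_range D lz.
  apply: in_rangeD (in_range_lw hg) _; rewrite -scaleN1r; apply: in_rangeZ; apply: in_rangeZ.
  by apply: in_range_smul (in_range_lG g) => e e'; rewrite (bmask_comm b e e').
set v1 := match b with None => _ | Some _ => _ end.
suff -> : v1 = A *m lv' b g by rewrite -mulmxBr Wtilde_A [rho *: _]scalemxAr -mulmxDr -lx_step.
rewrite {}/v1; case: b lz lzE lz_range => [phi|] lz lzE lz_range; last first.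
  congr (_ *m _); apply: blk_inj => e; rewrite lzE blk_lv' /=.
  by case: e => [e|[i j]] //=; rewrite of_blksK.
have lNr i j := ldom_range i j (ldom_lN g).
have blkz i j : blk (A *m lz) (inr (i, j)) = - mu i j *: blk lz (inr (i, j)).
  by rewrite blk_A_virt -scaleNr (in_range_virt H i j lz_range).
apply: blk_inj => -[i|[i j]]; rewrite of_blksK; last first.
  rewrite [RHS]blk_A_virt blk_lv' /=; case: ifP => phij.
    rewrite blkz lzE /= phij lNr -scaleNr mu_lN //.
  by rewrite blkz lzE /= phij (in_range_virt H i j (in_range_lw hg)) scaleNr.
rewrite !blk_A_comm -addrA; congr (_ + _).
  by apply: eq_bigr => e _; rewrite lzE blk_lv'.
rewrite [X in _ + X]big_mkcond -big_split /=; apply: eq_bigr => j _.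
rewrite blk_lv' lzE /=; case: ifP => phij; last by rewrite addr0.
rewrite blkz lzE /= phij -mu_lN lNr.
have := in_range_virt H i j lz_range; rewrite lzE /= phij => ->.
by rewrite !scaleNr opprK addNKr.
Qed.

End Simulation.

(** * One-step contraction of the Lyapunov function *)

Section Descent.
Context {R : realType} {n m E d : nat}.
Variable D : instance R n m E d.
Hypothesis H : admissible D.
Local Notation mu := (mu_virt D).
Local Notation bE := (@bvec R (edge E n m) d).
Variables (pcomm rho : R).
Hypothesis rho_gt0 : 0 < rho.
Hypothesis rho_le1 : rho <= 1.
Local Notation pe := (p_edge D pcomm).
Hypothesis p_gt0 : forall e, 0 < pe e.
Hypothesis rho_le_p : forall e, rho <= pe e.
Hypothesis sigA_gt0 : 0 < sigma_A D.
Hypothesis block_cond : forall b (l : bE), (forall e, ~~ in_block b e -> blk l e = 0) ->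
  rho ^+ 2 * dot (smul (p_inv D pcomm) l) (Mq D *m smul (p_inv D pcomm) l)
    <= sigma_A D * dot l l.
Local Notation pi_ := (p_inv D pcomm).
Local Notation r := (rr D pcomm rho).
Local Notation sA := (sigma_A D).
Local Notation lx := (lx_ D pcomm rho).
Local Notation ly := (ly_ D pcomm rho).
Local Notation lw := (lw_ D pcomm rho).
Local Notation lG := (lG_ D pcomm rho).
Local Notation lN := (lN_ D pcomm rho).
Local Notation step := (gstep D pcomm rho).
Local Notation lv1 := (lv' D pcomm rho).
Local Notation lu1 := (lu' D pcomm rho).

Definition quad (l : bE) := 1 / 2 * dot l (Mq D *m l).

Lemma quadD (a b : bE) : quad (a + b) = quad a + dot (Mq D *m a) b + quad b.
Proof.
rewrite /quad mulmxDr !(dotDl, dotDr) (dotC b (Mq D *m a)).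
by rewrite (dot_mulmxr (Mq D) a b) (Mq_sym H); field.
Qed.

Lemma quadZ c (a : bE) : quad (c *: a) = c ^+ 2 * quad a.
Proof. by rewrite /quad -scalemxAr !(dotZl, dotZr); ring. Qed.

Variable th : bE.
Hypothesis th_range : in_range D th.
Hypothesis th_dom : ldom D th.

(* An upper bound on the non-quadratic part of the dual objective at [lx g];
   unlike that part itself, it contracts in expectation. *)
Definition psihat (g : bE * bE) :=
  \sum_e (r e * edge_val D e (blk g.1 e) + (1 - r e) * edge_val D e (blk g.2 e)).
Definition lyap g := sA / 2 * dot (g.1 - th) (g.1 - th) + quad (lx g) + psihat g.

Definition Dt g e := blk (lN g) e - blk (lw g) e.
Definition sq_to e (l : bE) := dot (blk l e - blk th e) (blk l e - blk th e).

Lemma dot_sub (l : bE) : dot (l - th) (l - th) = \sum_e sq_to e l.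
Proof. by rewrite dot_blk; apply: eq_bigr => e _; rewrite blkB. Qed.

Lemma lv_diff b g : lv1 b g - lw g = smul (bmask b) (lN g - lw g).
Proof.
apply: blk_inj => e; rewrite blkB blk_smul blkB blk_lv' /bmask.
by case: in_block; rewrite ?scale1r ?scale0r ?subrr.
Qed.

(** The step from [ly] is supported on the sampled block, so [block_cond] bounds the second-order
    term by a sum over its edges. *)
Lemma quad_step b g : quad (lx (step b g)) <= quad (ly g) +
  rho * \sum_e bmask b e * pi_ e * dot (blk (lG g) e) (Dt g e) +
  sA / 2 * \sum_e bmask b e * dot (Dt g e) (Dt g e).
Proof.
rewrite lx_step //; set k := smul (bmask b) (lN g - lw g).
have mm e : bmask b e * bmask b e = bmask b e :> R.
  by rewrite /bmask; case: in_block; rewrite ?mulr1 ?mulr0.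
have -> : smul (fun e => bmask b e * pi_ e) (lv1 b g - lw g) = smul pi_ k.
  apply: blk_inj => e; rewrite lv_diff !blk_smul !scalerA.
  by congr (_ *: _); rewrite mulrAC mm mulrC.
rewrite quadD quadZ dotZr; apply: lerD.
  rewrite lerD2l ler_pM2l // le_eqVlt; apply/orP; left; apply/eqP.
  rewrite -/(lG g) dot_blk; apply: eq_bigr => e _.
  by rewrite !blk_smul blkB !dotZr mulrA [pi_ e * _]mulrC.
have -> : \sum_e bmask b e * dot (Dt g e) (Dt g e) = dot k k.
  rewrite dot_blk; apply: eq_bigr => e _.
  by rewrite blk_smul blkB dotZl dotZr mulrA mm.
have hk' : forall e, ~~ in_block b e -> blk k e = 0.
  by move=> e /negPf eb; rewrite blk_smul /bmask eb scale0r.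
have := block_cond hk'; rewrite /quad; lra.
Qed.

Lemma dist_step b g : dot (lv1 b g - th) (lv1 b g - th) = dot (lw g - th) (lw g - th) +
  \sum_e bmask b e * (sq_to e (lN g) - sq_to e (lw g)).
Proof.
rewrite !dot_sub -big_split /=; apply: eq_bigr => e _; rewrite /sq_to blk_lv' /bmask.
by case: in_block; rewrite ?mul1r ?mul0r ?addr0 // addrC subrK.
Qed.

Lemma psihat_step b g : psihat (step b g) =
  \sum_e (r e * edge_val D e (blk (lw g) e) + (1 - r e) * edge_val D e (blk (lu1 g) e)) +
  \sum_e bmask b e * (r e * (edge_val D e (blk (lN g) e) - edge_val D e (blk (lw g) e))).
Proof.
rewrite -big_split /=; apply: eq_bigr => e _; rewrite /= blk_lv' /bmask.
by case: in_block; rewrite ?mul1r ?mul0r ?addr0 //; ring.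
Qed.

Lemma p_r e : pe e * r e = rho.
Proof. by rewrite /rr /p_inv mulrCA mulfV ?mulr1 // gt_eqF. Qed.

(** On virtual edges this is the proximal variational inequality tested at [th]; on communication
    edges, where the step is a plain gradient step, it is an equality. *)
Lemma edge_ineq g e : ginv D g ->
  rho * dot (blk (lG g) e) (blk (lN g) e - blk th e) + rho * edge_val D e (blk (lN g) e)
  + sA * pe e * dot (Dt g e) (blk (lN g) e - blk th e) <= rho * edge_val D e (blk th e).
Proof.
move=> hg; have eta0 := eta_gt0 rho_gt0 sigA_gt0.
case: e => [e|[i j]].
  rewrite /edge_val !mulr0 addr0 /Dt.
  have -> : blk (lN g) (inl e) - blk (lw g) (inl e) =
      - (rho / sA * pi_ (inl e)) *: blk (lG g) (inl e).
    by rewrite {1}/lN_ of_blksK /zeta_ addrAC subrr add0r scaleNr.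
  rewrite dotZl le_eqVlt; apply/orP; left; apply/eqP.
  have := p_gt0 (inl e); rewrite /p_inv; move: (pe _) (dot _ _) => p x p0.
  by field; rewrite !gt_eqF.
have p0 := p_gt0 (inr (i, j)); have m0 := adm_mu_virt H i j.
have := prox_vvar H (- mu i j *: zeta_ D pcomm rho g (inr (i, j)))
  (prox_step_gt0 H rho_gt0 p_gt0 sigA_gt0 i j) (th_dom (inr (i, j))).
rewrite /= -(mu_lN H) /Dt /zeta_ /edge_val.
move: (vval D i j _) (vval D i j _) => a b.
rewrite -!scalerBr !(dotZl, dotZr).
set N := blk (lN g) _; set W := blk (lw g) _; set T := blk th _; set G := blk (lG g) _.
rewrite /p_inv /= !(dotDl, dotDr, dotNl, dotNr, dotZl, dotZr).
rewrite /= in p0; move: (p_virt D pcomm i j) p0 (mu i j) m0 => p p0 c c0.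
move: (dot N N) (dot W N) (dot G N) (dot N T) (dot W T) (dot G T) => nn wn gn nt wt gt.
have s0 : sA != 0 by rewrite gt_eqF.
have r0 : rho != 0 by rewrite gt_eqF.
have c1 : c != 0 by rewrite gt_eqF.
have p1 : p != 0 by rewrite gt_eqF.
(* The [mu^2] of the proximal parameter cancels the two factors [- mu], and multiplying by [rho]
   turns [p / eta] into [sigma_A * p]. *)
rewrite -(ler_pM2l rho_gt0); apply: le_trans.
by rewrite le_eqVlt; apply/orP; left; apply/eqP; field; rewrite s0 r0 c1 p1.
Qed.

(** Strong convexity is used between [ly] and [th], plain convexity between [ly] and [lx]; the
    gradient terms cancel because [lx - ly] is [- rho] times [g.1 - ly]. *)
Lemma quad_descent g : ginv D g ->
  sA / 2 * dot (lw g - th) (lw g - th) + quad (ly g) - rho * dot (lG g) (lw g - th) <=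
  (1 - rho) * (sA / 2 * dot (g.1 - th) (g.1 - th) + quad (lx g)) + rho * quad th.
Proof.
move=> hg; set y := ly g; set v := g.1 - th; set G := lG g.
have q1 : 1 + rho != 0 by rewrite gt_eqF // rho1_gt0.
have ry : in_range D (th - y).
  by apply: in_rangeD => //; rewrite -scaleN1r; apply/in_rangeZ/in_range_ly.
have hs := sigma_A_strong H ry.
have eth : quad th = quad y + dot G (th - y) + quad (th - y).
  by rewrite -quadD addrC subrK.
have ex : quad (lx g) = quad y + dot G (lx g - y) + quad (lx g - y).
  by rewrite -quadD addrC subrK.
have q0 : 0 <= quad (lx g - y) by rewrite mulr_ge0 // Mq_psd.
have ew : lw g - th = (1 - rho) *: v + rho *: (y - th).
  rewrite /lw_ /v /y /ly_; move: (lx g) => x.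
  by apply/matrixP => i j; rewrite !mxE; field; rewrite gt_eqF // rho1_gt0.
have exy : (1 - rho) *: (lx g - y) = - rho *: (v - (y - th)) + rho ^+ 2 *: (v - (y - th)).
  rewrite /v /y /ly_; move: (lx g) => x.
  by apply/matrixP => i j; rewrite !mxE; field; rewrite gt_eqF // rho1_gt0.
have hG : (1 - rho) * dot G (lx g - y) = - rho * (1 - rho) * (dot G v - dot G (y - th)).
  by rewrite -dotZr exy !(dotDr, dotZr, dotNr); ring.
have hG2 : dot G (th - y) = - dot G (y - th) by rewrite -dotNr opprB.
have hd : dot (th - y) (th - y) = dot (y - th) (y - th).
  by rewrite -opprB dotNl dotNr opprK.
have cv := dot_ge0 (v - (y - th)).
have hs2 : sA / 2 * dot (y - th) (y - th) <= quad (th - y).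
  by rewrite /quad -hd; lra.
have hs3 : rho * (sA / 2 * dot (y - th) (y - th)) <= rho * quad (th - y).
  by rewrite ler_pM2l.
have hq : 0 <= (1 - rho) * quad (lx g - y) by rewrite mulr_ge0 // subr_ge0.
rewrite ew eth ex hG2; move: hs3 hG hq cv.
move: (quad y) (quad (th - y)) (quad (lx g - y)) (dot G (lx g - y)) => qy qt qx dx.
move: (y - th) => z; clearbody v G; clear -rho_gt0 rho_le1 sigA_gt0.
rewrite !(dotDl, dotDr, dotNl, dotNr, dotZl, dotZr) (dotC z v).
move: (dot v v) (dot v z) (dot z z) (dot G v) (dot G z) => vv vz zz gv gz hs hG hq cv.
have key : 0 <= sA / 2 * (rho * (1 - rho)) * (vv - vz + - (vz - zz)).
  apply: mulr_ge0; last by move: cv; lra.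
  by apply: mulr_ge0; [rewrite divr_ge0 // ltW | rewrite mulr_ge0 ?subr_ge0 // ltW].
(* The slack is a sum of three nonnegative terms: a multiple of [|v - z|^2], the strong convexity
   gap at [th], and the quadratic term at [lx]. *)
rewrite -subr_ge0.
apply: le_trans (_ : 0 <= sA / 2 * (rho * (1 - rho)) * (vv - vz + - (vz - zz)) +
  (rho * qt - rho * (sA / 2 * zz)) + (1 - rho) * qx) _.
  by move: hs key hq; lra.
rewrite le_eqVlt; apply/orP; left; apply/eqP.
have -> : (1 - rho) * (sA / 2 * vv + (qy + dx + qx)) =
  (1 - rho) * (sA / 2 * vv + (qy + qx)) + (1 - rho) * dx by ring.
by rewrite hG; field.
Qed.

Lemma blk_lx g e :
  blk (lx g) e = (1 - (1 - r e)) *: blk g.1 e + (1 - r e) *: blk g.2 e.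
Proof. by rewrite blkD !blk_smul subKr. Qed.

Lemma one_sub_r e : 0 <= 1 - r e /\ 1 - r e <= 1.
Proof.
have r0 := rr_ge0 rho_gt0 p_gt0 e; have r1 := rr_le1 p_gt0 rho_le_p e.
by rewrite subr_ge0 r1 gerBl r0.
Qed.

Lemma lyap_ge g : ginv D g -> (forall l, ldom D l -> Fval D th <= Fval D l) ->
  sA / 2 * dot (g.1 - th) (g.1 - th) + Fval D th <= lyap g.
Proof.
move=> [_ _ d1 d2] hmin; rewrite /lyap -addrA lerD2l.
have dx : ldom D (lx g).
  move=> e; rewrite blk_lx; have [t0 t1] := one_sub_r e.
  exact: edge_dom_comb.
apply: le_trans (hmin _ dx) _; rewrite /Fval lerD2l; apply: ler_sum => e _.
rewrite blk_lx; have [t0 t1] := one_sub_r e.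
apply: le_trans (edge_val_comb t0 t1 (d1 e) (d2 e)) _.
by rewrite subKr.
Qed.

Variable pw : block n m -> R.
Hypothesis pw_ge0 : forall b, 0 <= pw b.
Hypothesis pw_sum : \sum_b pw b = 1.
Hypothesis pw_marg : forall e, \sum_b pw b * bmask b e = pe e.

Lemma p_le1 e : pe e <= 1.
Proof.
rewrite -pw_marg -pw_sum; apply: ler_sum => b _; rewrite ler_piMr //.
by rewrite /bmask; case: in_block.
Qed.

(** It makes the coefficient [r e - rho] in [psihat_edge] nonnegative. *)
Lemma rho_le_r e : rho <= r e.
Proof.
have p0 := p_gt0 e; rewrite /rr /p_inv ler_pdivlMr //.
by rewrite ler_piMr ?p_le1 // ltW.
Qed.

(* These are the coefficients for which the convexity bounds add up exactly. *)
Lemma psihat_edge g e : ginv D g ->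
  (r e - rho) * edge_val D e (blk (lw g) e) + (1 - r e) * edge_val D e (blk (lu1 g) e) <=
  (1 - rho) * (r e * edge_val D e (blk g.1 e) + (1 - r e) * edge_val D e (blk g.2 e)).
Proof.
move=> [_ _ d1 d2]; rewrite blk_lw // blk_lu' //.
have [s0 s1] := lw_coef rho_gt0 p_gt0 rho_le_p e.
have [t0 t1] := lu_coef rho_gt0 p_gt0 rho_le_p rho_le1 e.
have [r0 _] := one_sub_r e.
have rr0 : 0 <= r e - rho by rewrite subr_ge0 rho_le_r.
have h1 := ler_wpM2l rr0 (edge_val_comb s0 s1 (d1 e) (d2 e)).
have h2 := ler_wpM2l r0 (edge_val_comb t0 t1 (d1 e) (d2 e)).
apply: le_trans (lerD h1 h2) _; rewrite le_eqVlt; apply/orP; left; apply/eqP.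
have q0 := rho1_gt0 rho_gt0.
by move: (r e) (edge_val _ _ _) (edge_val _ _ _) => x a b; field; rewrite gt_eqF.
Qed.

(** The contribution of edge [e] to the bound on [lyap] when it is sampled. *)
Definition gain g e := sA / 2 * (sq_to e (lN g) - sq_to e (lw g)) +
  rho * (pi_ e * dot (blk (lG g) e) (Dt g e)) + sA / 2 * dot (Dt g e) (Dt g e) +
  r e * (edge_val D e (blk (lN g) e) - edge_val D e (blk (lw g) e)).

Lemma gain_bound g e : ginv D g -> pe e * gain g e <= rho * edge_val D e (blk th e)
  - rho * edge_val D e (blk (lw g) e) - rho * dot (blk (lG g) e) (blk (lw g) e - blk th e).
Proof.
move=> hg; have := edge_ineq e hg; have pr := p_r e; rewrite /gain /Dt /sq_to.
have pp : pe e * pi_ e = 1 by rewrite mulfV // gt_eqF.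
move: (edge_val D e (blk (lN g) e)) (edge_val D e (blk (lw g) e))
  (edge_val D e (blk th e)) => a b c.
move: (blk (lN g) e) (blk (lw g) e) (blk th e) (blk (lG g) e) => N W T G.
have -> : pe e * (sA / 2 * (dot (N - T) (N - T) - dot (W - T) (W - T)) +
   rho * (pi_ e * dot G (N - W)) + sA / 2 * dot (N - W) (N - W) + r e * (a - b)) =
  sA * pe e * (1 / 2 * (dot (N - T) (N - T) - dot (W - T) (W - T) + dot (N - W) (N - W)))
  + rho * (pe e * pi_ e) * dot G (N - W) + (pe e * r e) * (a - b) by field.
rewrite pp pr.
(* Three-point identity: the change of distance and the squared step combine into the inner product
   of [edge_ineq]. *)
have -> : 1 / 2 * (dot (N - T) (N - T) - dot (W - T) (W - T) + dot (N - W) (N - W)) =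
    dot (N - W) (N - T).
  rewrite !(dotDl, dotDr, dotNl, dotNr) (dotC T N) (dotC W N) (dotC T W).
  by field.
rewrite !dotBr; lra.
Qed.

(** The bound on [lyap] after a step is affine in the indicators [bmask b e], so only the marginals
    [p_edge] matter in expectation; dependence between edges was dealt with by [block_cond]. *)
Lemma lyap_step g : ginv D g ->
  \sum_b pw b * lyap (step b g) <= (1 - rho) * lyap g + rho * Fval D th.
Proof.
move=> hg.
pose c0 := sA / 2 * dot (lw g - th) (lw g - th) + quad (ly g) +
  \sum_e (r e * edge_val D e (blk (lw g) e) + (1 - r e) * edge_val D e (blk (lu1 g) e)).
have h1 b : lyap (step b g) <= c0 + \sum_e bmask b e * gain g e.
  rewrite /lyap dist_step psihat_step; have := quad_step b g.
  rewrite !mulr_sumr => hq.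
  have -> : \sum_e bmask b e * gain g e =
    sA / 2 * (\sum_e bmask b e * (sq_to e (lN g) - sq_to e (lw g))) +
    \sum_e rho * (bmask b e * pi_ e * dot (blk (lG g) e) (Dt g e)) +
    \sum_e sA / 2 * (bmask b e * dot (Dt g e) (Dt g e)) +
    \sum_e bmask b e * (r e * (edge_val D e (blk (lN g) e) - edge_val D e (blk (lw g) e))).
    rewrite mulr_sumr -!big_split /=; apply: eq_bigr => e _.
    by rewrite /gain; ring.
  by rewrite /c0; lra.
have h2 : \sum_b pw b * lyap (step b g) <= c0 + \sum_e pe e * gain g e.
  apply: (@le_trans _ _ (\sum_b pw b * (c0 + \sum_e bmask b e * gain g e))).
    by apply: ler_sum => b _; apply: ler_wpM2l.
  under eq_bigr => b _ do rewrite mulrDr mulr_sumr.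
  rewrite big_split /= -mulr_suml pw_sum mul1r lerD2l exchange_big /=.
  apply: ler_sum => e _; rewrite -pw_marg mulr_suml.
  by apply: ler_sum => b _; rewrite mulrA.
apply: le_trans h2 _.
have h3 : \sum_e pe e * gain g e <= \sum_e (rho * edge_val D e (blk th e)
  - rho * edge_val D e (blk (lw g) e) - rho * dot (blk (lG g) e) (blk (lw g) e - blk th e)).
  by apply: ler_sum => e _; apply: gain_bound.
apply: le_trans (lerD (lexx c0) h3) _.
have h4 : \sum_e ((r e - rho) * edge_val D e (blk (lw g) e)
    + (1 - r e) * edge_val D e (blk (lu1 g) e)) <= (1 - rho) * psihat g.
  by rewrite mulr_sumr; apply: ler_sum => e _; apply: psihat_edge.
have h5 := quad_descent hg.
have -> : c0 + \sum_e (rho * edge_val D e (blk th e)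
  - rho * edge_val D e (blk (lw g) e) - rho * dot (blk (lG g) e) (blk (lw g) e - blk th e)) =
  (sA / 2 * dot (lw g - th) (lw g - th) + quad (ly g) - rho * dot (lG g) (lw g - th)) +
  \sum_e ((r e - rho) * edge_val D e (blk (lw g) e)
    + (1 - r e) * edge_val D e (blk (lu1 g) e)) + rho * \sum_e edge_val D e (blk th e).
  have -> : dot (lG g) (lw g - th) = \sum_e dot (blk (lG g) e) (blk (lw g) e - blk th e).
    by rewrite dot_blk; apply: eq_bigr => e _; rewrite blkB.
  rewrite !mulr_sumr /c0 -!addrA; do 2 congr (_ + _).
  rewrite -sumrN -!big_split /=; apply: eq_bigr => e _; ring.
rewrite /lyap /Fval -/(quad th); lra.
Qed.

End Descent.

(** * From the contraction to the error bound *)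

Section Convergence.
Context {R : realType} {n m E d : nat}.
Variable D : instance R n m E d.
Hypothesis H : admissible D.
Local Notation A := (Amx D).
Local Notation Sg := (pseudo_inv (Sigma D)).
Local Notation Mk := (m%:R + Num.sqrt (m%:R * kappa_s D)).
Local Notation bE := (@bvec R (edge E n m) d).
Variables (pcomm rho : R).
Hypothesis pcommE : pcomm = (1 + Num.sqrt (2 * gamma D / kappa_comm D) * Mk)^-1.
Hypothesis rho_gt0 : 0 < rho.
Hypothesis rhoE : rho ^+ 2 =
     Num.min (gamma D / kappa_comm D * pcomm ^+ 2)
             ((1 - pcomm) ^+ 2 / (2 * Mk ^+ 2)).
Variables (theta_star : 'cV[R]_d) (theta_A : bE).
Hypothesis theta_star_min : forall theta, objective D theta_star <= objective D theta.
Hypothesis theta_A_min : forall l, (FAstar D theta_A <= FAstar D l)%E.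

Let p_gt0 := p_edge_gt0 H pcommE rho_gt0 rhoE.
Let rho_le_p := rho_le_p H pcommE rho_gt0 rhoE.
Let block_cond := block_step_condition H pcommE rho_gt0 rhoE.
Let sigA_gt0 : 0 < sigma_A D.
Proof. exact: lt_le_trans (delta_gt0 H) (sigma_A_ge_delta H). Qed.
Let rho_le1 : rho <= 1.
Proof.
apply: le_trans (rho_le_p (inl (Ordinal (E_gt0 H)))) _ => /=.
by rewrite -subr_ge0 ltW // (pcomp_gt0 H pcommE rho_gt0 rhoE).
Qed.

(** The orthogonal projection of [theta_A] on the range of [A^T]. *)
Definition proj_theta := pseudo_inv A *m A *m theta_A.
Local Notation th := proj_theta.

Lemma A_proj_theta : A *m th = A *m theta_A.
Proof. by rewrite /th !mulmxA; have [-> _ _ _] := pseudo_invP A. Qed.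

Lemma proj_theta_range : in_range D th.
Proof.
move=> k Ak; rewrite /th dot_mulmxr; have [_ _ _ ->] := pseudo_invP A.
by rewrite -mulmxA Ak mulmx0 dot0l.
Qed.

(** The two vectors differ by a kernel vector and both blocks lie in the range of the projector.
    Hence domain and dual value survive the projection. *)
Lemma proj_theta_virt i j : blk th (inr (i, j)) = blk theta_A (inr (i, j)).
Proof.
have dA := theta_A_dom H theta_star_min theta_A_min.
rewrite -(in_range_virt H i j proj_theta_range) -(ldom_range H i j dA).
apply/eqP; rewrite -subr_eq0 -mulmxBr -blkB A_ker_virt //.
by rewrite mulmxBr A_proj_theta subrr.
Qed.

Lemma proj_theta_dom : ldom D th.
Proof.
have dA := theta_A_dom H theta_star_min theta_A_min.
by move=> [e|[i j]] //=; rewrite proj_theta_virt; apply: (dA (inr (i, j))).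
Qed.

Lemma Fval_proj_theta : Fval D th = Fval D theta_A.
Proof.
rewrite /Fval !dot_Mq // A_proj_theta !sum_edge_val; congr (_ + _).
by apply: eq_bigr => i _; apply: eq_bigr => j _; rewrite proj_theta_virt.
Qed.

Lemma Fval_proj_min l : ldom D l -> Fval D th <= Fval D l.
Proof. by move=> dl; rewrite Fval_proj_theta; apply: (theta_A_le H theta_star_min theta_A_min dl). Qed.

Definition err_mx := A^T *m (Sg *m Sg) *m A.

Lemma err_mx_sym : err_mx^T = err_mx.
Proof. by rewrite /err_mx !trmx_mul trmxK (tr_Sg H) !mulmxA. Qed.

Lemma dot_err_mx l : dot l (err_mx *m l) = dot (Sg *m (A *m l)) (Sg *m (A *m l)).
Proof.
rewrite /err_mx -!mulmxA dot_mulmxr trmxK.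
by rewrite (dot_mulmxr Sg _ (Sg *m _)) (tr_Sg H).
Qed.

Lemma lambda_err_gt0 : 0 < lambda_max err_mx.
Proof.
apply: lambda_max_gt0; first exact: err_mx_sym.
  by move=> l; rewrite dot_err_mx dot_ge0.
apply: contra_neq (Mq_neq0 H) => e0; apply: mulmx_ext => l; rewrite mul0mx Mq_mul.
have /eqP := dot_err_mx l; rewrite e0 mul0mx dot0r eq_sym dot_eq0 => /eqP ->.
by rewrite mulmx0.
Qed.

Lemma sq_error_le (v : bE) : sq_error (Sg *m (A *m v)) theta_star <=
  lambda_max err_mx * dot (v - th) (v - th).
Proof.
apply: le_trans (lambda_max_dot _ err_mx_sym); rewrite dot_err_mx.
rewrite [X in _ <= X]dot_blk sum_sum_ord -[X in X <= _]addr0; apply: lerD; last first.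
  by apply: sumr_ge0 => i _; apply: sumr_ge0 => j _; exact: dot_ge0.
apply: ler_sum => i _; rewrite normsq_dot.
suff -> : blk (Sg *m (A *m v)) (inl i) - theta_star = blk (Sg *m (A *m (v - th))) (inl i) by [].
rewrite !mulmxBr blkB; congr (_ - _); rewrite A_proj_theta blk_Sg_comm //.
have := theta_A_primal H theta_star_min theta_A_min i.
rewrite /svec => ->; rewrite scalerA mulVf ?scale1r //.
by rewrite gt_eqF // (adm_sigma H).
Qed.

Lemma smul0 (c : edge E n m -> R) : smul c (0 : bE) = 0.
Proof. by apply: blk_inj => e; rewrite blk_smul !blk0 scaler0. Qed.

Fixpoint ghost (b : nat -> block n m) t : bE * bE :=
  if t is t'.+1 then gstep D pcomm rho (b t') (ghost b t') else (0, 0).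

Lemma ghost_adapted t : adapted t (fun b => ghost b t).
Proof.
elim: t => [|t IH] b b' bb //=; rewrite bb //; congr gstep.
by apply: IH => s st; apply: bb; apply: ltnW.
Qed.

Lemma ghost_upd b t c :
  ghost (upd b t c) t.+1 = gstep D pcomm rho c (ghost b t).
Proof.
rewrite /= {1}/upd eqxx (ghost_adapted (b' := b)) // => s st.
by rewrite /upd ltn_eqF.
Qed.

Lemma adfs_adapted t : adapted t (fun b => adfs D pcomm rho b t).
Proof.
elim: t => [|t IH] b b' bb //=; rewrite bb //; congr adfs_step.
by apply: IH => s st; apply: bb; apply: ltnW.
Qed.

Hypothesis dom0 : ldom D (0 : bE).

(** [dom0] is the base case: the ghost trajectory starts at 0. *)
Lemma ghost_inv b t : ginv D (ghost b t).
Proof.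
elim: t => [|t IH]; first by split=> //; exact: in_range0.
exact: (ginv_step H).
Qed.

Lemma ghost_real b t : adfs D pcomm rho b t = real_state D pcomm rho (ghost b t).
Proof.
elim: t => [|t IH] /=.
  by rewrite /real_state /lx_ /= !smul0 addr0 mulmx0.
by rewrite IH (simulation H) //; apply: ghost_inv.
Qed.

Lemma lyap0 : lyap D pcomm rho th (0, 0) = sigma_A D / 2 * dot th th + Fval D 0.
Proof.
rewrite /lyap /= sub0r dotNl dotNr opprK -addrA; congr (_ + _).
rewrite /lx_ /= !smul0 addr0 /quad /Fval; congr (_ + _); apply: eq_bigr => e _ /=; ring.
Qed.

Variable pw : nat -> block n m -> R.
Hypothesis pw_ge0 : forall t b, 0 <= pw t b.
Hypothesis pw_sum : forall t, \sum_b pw t b = 1.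
Hypothesis pw_marg : forall t e, \sum_b pw t b * bmask b e = p_edge D pcomm e.

Lemma Ex_sq_error K : Ex pw (fun=> None) K (fun b => sq_error (adfs_output D pcomm rho b K) theta_star)
  <= lambda_max err_mx * (dot th th + 2 * (sigma_A D)^-1 * (Fval D 0 - Fval D th)) * (1 - rho) ^+ K.
Proof.
(* Subtracting the optimal value makes the recursion of [lyap_step] homogeneous. *)
pose L t b := lyap D pcomm rho th (ghost b t) - Fval D th.
have r1 : 0 <= 1 - rho by rewrite subr_ge0.
have Lstep t b : \sum_c pw t c * L t.+1 (upd b t c) <= (1 - rho) * L t b.
  have -> : \sum_c pw t c * L t.+1 (upd b t c) =
     \sum_c pw t c * lyap D pcomm rho th (gstep D pcomm rho c (ghost b t)) - Fval D th.
    rewrite -[X in _ - X]mul1r -(pw_sum t) mulr_suml -sumrB; apply: eq_bigr => c _.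
    by rewrite /L ghost_upd mulrBr.
  have := lyap_step H rho_gt0 rho_le1 p_gt0 rho_le_p sigA_gt0 block_cond
    proj_theta_range proj_theta_dom (pw_ge0 t) (pw_sum t) (pw_marg t) (ghost_inv b t).
  by rewrite /L; lra.
have hK := @Ex_supermartingale R _ pw (fun=> None) pw_ge0 L (1 - rho) r1 Lstep K.
have c0 : 0 <= lambda_max err_mx * (2 / sigma_A D).
  by rewrite mulr_ge0 ?divr_ge0 // ltW // lambda_err_gt0.
apply: (@le_trans _ _ (Ex pw (fun=> None) K (fun b => lambda_max err_mx * (2 / sigma_A D) * L K b))).
  apply: Ex_le => // b; rewrite /adfs_output ghost_real /=.
  apply: le_trans (sq_error_le _) _; rewrite -mulrA ler_pM2l ?lambda_err_gt0 //.
  have := lyap_ge rho_gt0 p_gt0 rho_le_p (ghost_inv b K) Fval_proj_min.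
  rewrite -/(L K b) -lerBrDr -/(L K b) => h.
  rewrite mulrAC ler_pdivlMr //; move: h; lra.
rewrite ExZ; apply: le_trans (ler_wpM2l c0 hK) _.
rewrite /L lyap0 le_eqVlt; apply/orP; left; apply/eqP.
by field; rewrite gt_eqF.
Qed.

End Convergence.

(** * Laws of finitely valued samples *)

Section Sampling.
Context {R : realType} {disp : measure_display} {T : measurableType disp}.
Variables (Pr : probability T R) (I : finType) (B : nat -> T -> I).
Hypothesis measB : forall t b, measurable [set w | B t w = b].

Definition law t b := fine (Pr [set w | B t w = b]).

Lemma lawE t b : Pr [set w | B t w = b] = (law t b)%:E.
Proof. by rewrite /law fineK // fin_num_measure. Qed.

Lemma law_ge0 t b : 0 <= law t b.
Proof. by rewrite /law fine_ge0. Qed.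

Lemma law_sum t (Q : pred I) :
  (\sum_b law t b * (Q b)%:R)%:E = Pr [set w | Q (B t w)].
Proof.
pose s := [seq b <- enum I | Q b].
have -> : [set w | Q (B t w)] = \bigcup_(b in [set` s]) [set w | B t w = b].
  apply/seteqP; split=> w /=.
    by move=> Qw; exists (B t w) => //=; rewrite mem_filter Qw mem_enum.
  by move=> [b /=]; rewrite mem_filter => /andP[Qb _] ->.
rewrite measure_fin_bigcup //; last first.
  by move=> b c _ _ [w [/= <- <-]].
have us : uniq s by rewrite filter_uniq // enum_uniq.
rewrite -(fsbig_seq _ _ us) /s big_filter big_enum_cond /=.
rewrite -sumEFin [RHS]big_mkcond /=; apply: eq_bigr => b _.
by rewrite lawE; case: (Q b); rewrite ?mulr1 ?mulr0.
Qed.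

End Sampling.

(** * Marginals of the sampled blocks, mean running time and the value of [C0] *)

Section SynchronousSampling.
Context {R : realType} {n m E d : nat}.
Variable D : instance R n m E d.
Hypothesis H : admissible D.
Context {disp : measure_display} {T : measurableType disp} (Pr : probability T R).
Variables (B : nat -> T -> block n m) (pcomm : R).
Hypothesis sampling : sync_sampling D Pr pcomm B.
Local Notation pw := (law Pr B).

Lemma sampling_meas t b : measurable [set w | B t w = b].
Proof. by have [h _ _ _] := sampling; apply: h. Qed.

Lemma sampling_sum t : \sum_b pw t b = 1.
Proof.
apply/EFin_inj; have := law_sum Pr sampling_meas t predT.
under [X in X%:E = _ -> _]eq_bigr do rewrite mulr1.
by move=> ->; rewrite -[RHS](probability_setT Pr); congr (Pr _); apply/seteqP.
Qed.

Lemma sampling_comm t : pw t None = pcomm.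
Proof. by have [_ h _ _] := sampling; rewrite /law h. Qed.

Lemma sampling_marg t e : \sum_b pw t b * bmask b e = p_edge D pcomm e.
Proof.
apply/EFin_inj; rewrite (law_sum Pr sampling_meas t (fun b => in_block b e)).
case: e => [e|[i j]] /=; last by have [_ _ h _] := sampling; apply: h.
have [_ h _ _] := sampling; rewrite -(h t); congr (Pr _).
by apply/seteqP; split=> w /=; case: (B t w).
Qed.

Lemma Ex_total_time tau K :
  Ex pw (fun=> None) K (fun b => total_time tau b K) = K%:R * (tau * pcomm + (1 - pcomm)).
Proof.
elim: K => [|K IH]; first by rewrite /= /total_time big_ord0 mul0r.
have it t : \sum_c pw t c * iter_time tau c = tau * pcomm + (1 - pcomm).
  have := sampling_sum t; rewrite (bigD1 None) //= sampling_comm => h.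
  rewrite (bigD1 None) //= sampling_comm mulrC; congr (_ + _).
  rewrite -h addrAC subrr add0r; apply: eq_bigr => -[c|] //= _.
  by rewrite mulr1.
rewrite ExS; have -> : Ex pw (fun=> None) K (fun b => \sum_c pw K c *
    total_time tau (upd b K c) K.+1) =
  Ex pw (fun=> None) K (fun b => total_time tau b K + (tau * pcomm + (1 - pcomm))).
  apply: Ex_ext => b; rewrite -(it K) -[total_time tau b K]mul1r -(sampling_sum K).
  rewrite mulr_suml -big_split /=; apply: eq_bigr => c _; rewrite -mulrDr; congr (_ * _).
  rewrite /total_time big_ord_recr /= {2}/upd eqxx; congr (_ + _).
  by apply: eq_bigr => t _; rewrite /upd ltn_eqF.
by rewrite ExD IH Ex_cst ?mulrSr ?mulrDl ?mul1r //; apply: sampling_sum.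
Qed.

Lemma total_time_adapted (tau : R) K :
  adapted K (fun b : nat -> block n m => total_time tau b K).
Proof. by move=> b b' bb; apply: eq_bigr => t _; rewrite bb. Qed.

Lemma sampling_expectation K (h : (nat -> block n m) -> R) :
  adapted K h -> (forall b, 0 <= h b) ->
  ('E_Pr[fun w => h (B^~ w)] = (Ex pw (fun=> None) K h)%:E)%E.
Proof.
move=> hK h0; have [mB _ _ ind] := sampling.
by apply: expectation_adapted => // t c; rewrite lawE.
Qed.

Lemma C0_finite (theta_A : @bvec R (edge E n m) d) : ldom D theta_A -> ldom D 0 ->
  C0 D theta_A = (lambda_max (err_mx D) * (dot (proj_theta D theta_A) (proj_theta D theta_A) +
    2 * (sigma_A D)^-1 * (Fval D 0 - Fval D theta_A)))%:E.
Proof. by move=> dA d0; rewrite /C0 !FAstarE // -?EFinB -!EFinM -EFinD -EFinM. Qed.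

(** [FAstar] is [+oo] at 0, and strict positivity of the factors in front excludes a product of 0
    and [+oo]. *)
Lemma C0_infinite (theta_A : @bvec R (edge E n m) d) : ldom D theta_A -> ~ ldom D 0 ->
  C0 D theta_A = +oo%E.
Proof.
move=> dA d0; rewrite /C0 (FAstarE H dA).
have -> : FAstar D 0 = +oo%E.
  apply/eqP; rewrite -leye_eq leNgt; apply/negP => h.
  by apply: d0; apply: FAstar_lty.
have s0 : 0 < 2 * (sigma_A D)^-1.
  by rewrite mulr_gt0 // invr_gt0; apply: lt_le_trans (delta_gt0 H) (sigma_A_ge_delta H).
rewrite addye // gt0_muley ?lte_fin // addey // gt0_muley //.
by rewrite lte_fin; apply: lambda_err_gt0.
Qed.

End SynchronousSampling.

Theorem theorem6p8 (R : realType) (n m E d : nat) (D : instance R n m E d)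
  (disp : measure_display) (T : measurableType disp) (Pr : probability T R)
  (B : nat -> T -> block n m)
  (theta_star : 'cV[R]_d) (theta_A : @bvec R (edge E n m) d)
  (pcomm rho eps tau : R) (K : nat)
  (n_gt1 : (1 < n)%N) (m_gt0 : (0 < m)%N) (d_gt0 : (0 < d)%N)
  (graph_simple : simple_graph D) (graph_connected : connected_graph D)
  (sigma_gt0 : forall i, 0 < sigma D i)
  (Lsm_gt0 : forall i j, 0 < Lsm D i j)
  (proj_orth : forall i j, orth_projector (vproj D i j))
  (f_convex : forall i j, convex_function setT (fun_of D i j))
  (f_smooth : forall i j, smooth_wrt (Lsm D i j) (vproj D i j) (fun_of D i j))
  (theta_star_min : forall theta, objective D theta_star <= objective D theta)
  (theta_A_min : forall l, (FAstar D theta_A <= FAstar D l)%E)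
  (mu_comm_gt0 : forall e, 0 < mu_comm D e)
  (mu_virt_gt0 : forall i j, 0 < mu_virt D i j)
  (mu_virtE : forall i j, mu_virt D i j ^+ 2 = alpha D * Lsm D i j)
  (sampling : sync_sampling D Pr pcomm B)
  (pcommE : pcomm =
     (1 + Num.sqrt (2 * gamma D / kappa_comm D) *
          (m%:R + Num.sqrt (m%:R * kappa_s D)))^-1)
  (rho_gt0 : 0 < rho)
  (rhoE : rho ^+ 2 =
     Num.min (gamma D / kappa_comm D * pcomm ^+ 2)
             ((1 - pcomm) ^+ 2 /
                (2 * (m%:R + Num.sqrt (m%:R * kappa_s D)) ^+ 2)))
  (eps_gt0 : 0 < eps) (tau_ge0 : 0 <= tau)
  (KE : K%:R = rho^-1 * ln eps^-1) :
  ('E_Pr[fun w => sq_error (adfs_output D pcomm rho (B^~ w) K) theta_star]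
     <= C0 D theta_A * eps%:E)%E /\
  ('E_Pr[fun w => total_time tau (B^~ w) K]
     <= ((Num.sqrt 2 * (m%:R + Num.sqrt (m%:R * kappa_s D)) +
          tau * Num.sqrt (kappa_comm D / gamma D)) * ln (1 / eps))%:E)%E.
Proof.
have H : admissible D.
  by split=> //; apply: ltn_trans n_gt1.
have dA := theta_A_dom H theta_star_min theta_A_min.
have pw_ge0 := law_ge0 Pr B; have pw_sum := sampling_sum sampling.
have pw_marg := sampling_marg sampling.
have rho1 : rho <= 1.
  apply: le_trans (rho_le_p H pcommE rho_gt0 rhoE (inl (Ordinal (E_gt0 H)))) _.
  by rewrite /= -subr_ge0 ltW // (pcomp_gt0 H pcommE rho_gt0 rhoE).
split; last first.
  rewrite (sampling_expectation sampling (K := K)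
    (h := fun b => total_time tau b K)); last 2 first.
  - exact: total_time_adapted.
  - by move=> b; apply: sumr_ge0 => t _; rewrite /iter_time; case: (b t).
  rewrite (Ex_total_time sampling) lee_fin KE mulrAC.
  by rewrite (time_identity H pcommE rho_gt0 rhoE) div1r mulrC.
rewrite (sampling_expectation sampling (K := K)
  (h := fun b => sq_error (adfs_output D pcomm rho b K) theta_star)); last 2 first.
- by move=> b b' bb; rewrite /adfs_output (adfs_adapted D pcomm rho bb).
- by move=> b; apply: sumr_ge0 => i _; rewrite normsq_dot dot_ge0.
(* The ghost trajectory needs its starting point 0 in the domain; otherwise the right-hand side is
   [+oo]. *)
have [d0|d0] := pselect (ldom D 0); last by rewrite (C0_infinite H) // gt0_mulye // leey.
rewrite (C0_finite H) // -EFinM lee_fin.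
apply: le_trans (Ex_sq_error H pcommE rho_gt0 rhoE theta_star_min theta_A_min d0
  pw_ge0 pw_sum pw_marg K) _.
rewrite (Fval_proj_theta H theta_star_min theta_A_min); apply: ler_wpM2l.
  apply: mulr_ge0; first exact: ltW (lambda_err_gt0 H).
  apply: addr_ge0; first exact: dot_ge0.
  apply: mulr_ge0; last first.
    by rewrite subr_ge0; apply: (theta_A_le H theta_star_min theta_A_min d0).
  rewrite mulr_ge0 // invr_ge0 ltW //.
  exact: lt_le_trans (delta_gt0 H) (sigma_A_ge_delta H).
(* [1 - rho <= exp (- rho)], and by [KE] the power [K] of the latter is [eps]. *)
apply: (@le_trans _ _ (expR (- rho) ^+ K)).
  by apply: lerXn2r; rewrite ?nnegrE ?subr_ge0 ?expR_ge0 //; apply: expR_ge1Dx.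
rewrite -expRM_natl KE mulrN mulrAC mulVf ?gt_eqF // mul1r expRN lnK ?invrK //.
by rewrite posrE invr_gt0.
Qed.
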